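(* For each $n$, let $G=G_n$ be a graph on the observations $\{1,\dots,n\}$ with edge set also denoted $G$. For a node $i$ let $G_i$ be the set of edges incident to $i$ (so $|G_i|$ is the degree of $i$). For an edge $e=(e_-,e_+)$ let $A_e=G_{e_-}\cup G_{e_+}$ and $B_e=\bigcup_{e^*\in A_e}A_{e^*}$. Work under the permutation null distribution (uniform over the $n!$ orderings of the observations, with $G$ fixed). Define, for $1\le t<n$, $R_1(t)$ (resp. $R_2(t)$) as the number of edges of $G$ with both endpoints having index $\le t$ (resp. $>t$), $R_w(t)=\frac{n-t-1}{n-2}R_1(t)+\frac{t-1}{n-2}R_2(t)$, $R_{\mathrm{diff}}(t)=R_1(t)-R_2(t)$, and let $Z_w(t)$, $Z_{\mathrm{diff}}(t)$ be $R_w(t)$, $R_{\mathrm{diff}}(t)$ standardized by their permutation-null mean and standard deviation. For $1\le t_1<t_2\le n$, $m=t_2-t_1$, define $R_1(t_1,t_2)$ (resp. $R_2(t_1,t_2)$) as the number of edges with both endpoints having index outside (resp. inside) $(t_1,t_2]$, $R_w(t_1,t_2)=\frac{m-1}{n-2}R_1(t_1,t_2)+\frac{n-m-1}{n-2}R_2(t_1,t_2)$, $R_{\mathrm{diff}}(t_1,t_2)=R_1(t_1,t_2)-R_2(t_1,t_2)$, and $Z_w(t_1,t_2)$, $Z_{\mathrm{diff}}(t_1,t_2)$ their standardizations. Write $[x]$ for the largest integer not exceeding $x$. Assume that, as $n\to\infty$, $|G|=O(n^\alpha)$ for some $1\le\alpha<1.5$, $\sum_{e\in G}|A_e||B_e|=o(n^{1.5\alpha})$,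 $\sum_{e\in G}|A_e|^2=o(n^{\alpha+0.5})$, and $\sum_{i=1}^n|G_i|^2-\frac{4|G|^2}{n}=O\big(\sum_{i=1}^n|G_i|^2\big)$. Then, as $n\to\infty$: 1. $\{Z_{\mathrm{diff}}([nu]):0<u<1\}$ and $\{Z_w([nu]):0<u<1\}$ converge in finite-dimensional distributions to independent Gaussian processes $\{Z^*_{\mathrm{diff}}(u):0<u<1\}$ and $\{Z^*_w(u):0<u<1\}$; 2. $\{Z_{\mathrm{diff}}([nu],[nv]):0<u<v<1\}$ and $\{Z_w([nu],[nv]):0<u<v<1\}$ converge in finite-dimensional distributions to independent two-dimensional Gaussian random fields $\{Z^*_{\mathrm{diff}}(u,v)\}$ and $\{Z^*_w(u,v)\}$.
   Context: Here $a_n=O(b_n)$ means $a_n$ has the same order as $b_n$ and $a_n=o(b_n)$ means $a_n$ has order smaller than $b_n$. *)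

(* Defs.v *)
From HB Require Import structures.
From mathcomp Require Import all_boot all_order all_algebra perm.
From mathcomp Require Import all_classical all_reals all_analysis.
Set Implicit Arguments. Unset Strict Implicit. Unset Printing Implicit Defensive.
Import Order.TTheory GRing.Theory Num.Theory.
Import numFieldNormedType.Exports.
Local Open Scope classical_set_scope.
Local Open Scope ring_scope.

Section Graphs.
Variable n : nat.
(* A (simple, undirected) graph on the observations 'I_n (= {1,..,n}, 0-based)
   is given by a symmetric irreflexive relation g.  Each edge is listed once as
   the ordered pair (e.1, e.2) with e.1 < e.2. *)
Definition edges (g : rel 'I_n) : {set 'I_n * 'I_n} :=
  [set e : 'I_n * 'I_n | (e.1 < e.2)%N && g e.1 e.2].

Definition inc_edges (g : rel 'I_n) (i : 'I_n) : {set 'I_n * 'I_n} :=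
  [set e in edges g | (e.1 == i) || (e.2 == i)].

Definition Aset (g : rel 'I_n) (e : 'I_n * 'I_n) : {set 'I_n * 'I_n} :=
  inc_edges g e.1 :|: inc_edges g e.2.

Definition Bset (g : rel 'I_n) (e : 'I_n * 'I_n) : {set 'I_n * 'I_n} :=
  \bigcup_(f in Aset g e) Aset g f.
End Graphs.

Section Stats.
Variable R : realType.
Variable n : nat.

(* Permutation null distribution: sigma : 'S_n assigns to observation i its
   position sigma i in the ordering (0-based, so "index <= t" (1-based) is
   "sigma i < t"); the law is uniform over the n! permutations. *)
Definition permE (f : {perm 'I_n} -> R) : R :=
  (n`!%:R)^-1 * \sum_(s : {perm 'I_n}) f s.

Definition permSD (f : {perm 'I_n} -> R) : R :=
  Num.sqrt (permE (fun s => (f s - permE f) ^+ 2)).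

Definition standardize (f : {perm 'I_n} -> R) (s : {perm 'I_n}) : R :=
  (f s - permE f) / permSD f.

Variable g : rel 'I_n.

Definition R1 (t : nat) (s : {perm 'I_n}) : R :=
  #|[set e in edges g | (s e.1 < t)%N && (s e.2 < t)%N]|%:R.
Definition R2 (t : nat) (s : {perm 'I_n}) : R :=
  #|[set e in edges g | (t <= s e.1)%N && (t <= s e.2)%N]|%:R.
Definition Rw (t : nat) (s : {perm 'I_n}) : R :=
  (n%:R - t%:R - 1) / (n%:R - 2) * R1 t s + (t%:R - 1) / (n%:R - 2) * R2 t s.
Definition Rdiff (t : nat) (s : {perm 'I_n}) : R := R1 t s - R2 t s.
Definition Zw (t : nat) := standardize (Rw t).
Definition Zdiff (t : nat) := standardize (Rdiff t).

(* changed interval (t1, t2] (1-based), i.e. positions p with t1 <= p < t2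
   (0-based) *)
Definition inside (t1 t2 : nat) (p : nat) : bool := (t1 <= p)%N && (p < t2)%N.
Definition R1i (t1 t2 : nat) (s : {perm 'I_n}) : R :=
  #|[set e in edges g | ~~ inside t1 t2 (s e.1) && ~~ inside t1 t2 (s e.2)]|%:R.
Definition R2i (t1 t2 : nat) (s : {perm 'I_n}) : R :=
  #|[set e in edges g | inside t1 t2 (s e.1) && inside t1 t2 (s e.2)]|%:R.
Definition Rwi (t1 t2 : nat) (s : {perm 'I_n}) : R :=
  let m : R := t2%:R - t1%:R in
  (m - 1) / (n%:R - 2) * R1i t1 t2 s + (n%:R - m - 1) / (n%:R - 2) * R2i t1 t2 s.
Definition Rdiffi (t1 t2 : nat) (s : {perm 'I_n}) : R :=
  R1i t1 t2 s - R2i t1 t2 s.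
Definition Zwi (t1 t2 : nat) := standardize (Rwi t1 t2).
Definition Zdiffi (t1 t2 : nat) := standardize (Rdiffi t1 t2).
End Stats.

(* [x] : largest integer not exceeding x, as a natural number (x >= 0 here) *)
Definition floorn (R : realType) (x : R) : nat := `|Num.floor x|%N.

Section Gauss.
Variable R : realType.

(* Iterated integral of g over the first d coordinates against d independent
   standard normal laws (the d-dimensional standard Gaussian measure). *)
Fixpoint gauss_int (d : nat) (g : (nat -> R) -> R) : R :=
  match d with
  | 0 => g (fun _ => 0)
  | d'.+1 => Rintegral (normal_prob (0:R) 1) setT
               (fun x => gauss_int d' (fun z => g (fun i => if i == d' then x else z i)))
  end.

(* E[f(Y)] for the Gaussian vector Y = mu + Z *m L, Z standard Gaussian row
   vector; Y ~ N(mu, L^T L). *)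
Definition gauss_expect (d : nat) (mu : 'rV[R]_d) (L : 'M[R]_d)
    (f : 'rV[R]_d -> R) : R :=
  gauss_int d (fun z => f (mu + (\row_(j < d) z j) *m L)).

(* Convergence in distribution of random vectors X n defined on the
   permutation null (uniform on 'S_n), towards N(mu, L^T L):
   E f(X_n) -> E f(Y) for every bounded continuous f. *)
Definition cvg_dist_gauss (d : nat) (X : forall n, {perm 'I_n} -> 'rV[R]_d)
    (mu : 'rV[R]_d) (L : 'M[R]_d) : Prop :=
  forall f : 'rV[R]_d -> R, continuous f -> (exists M : R, forall x, `|f x| <= M) ->
    (fun n => permE (fun s => f (X n s))) @ \oo --> gauss_expect mu L f.
End Gauss.

Arguments Zw {R n} g t s.
Arguments Zdiff {R n} g t s.
Arguments Zwi {R n} g t1 t2 s.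
Arguments Zdiffi {R n} g t1 t2 s.

(* Main.v *)
Require Import Defs.
From HB Require Import structures.
From mathcomp Require Import all_boot all_order all_algebra perm.
From mathcomp Require Import all_classical all_reals all_analysis.
From mathcomp Require Import measurable_realfun ring lra.
Import Order.TTheory GRing.Theory Num.Theory.
Import numFieldNormedType.Exports.
Import Defs.
Local Open Scope classical_set_scope.
Local Open Scope ring_scope.
Set Implicit Arguments. Unset Strict Implicit. Unset Printing Implicit Defensive.

(* Write y for the centred indicator of the positions inside a change window.
   Up to affine changes, R_diff is the linear statistic sum_i a_i y(s i), with a
   the normalised centred degrees, and R_w is the bilinear statistic
   sum_(i,j) h_ij y(s i) y(s j) / 2, with h = adjacency / sqrt |G|, plus a
   negligible multiple of the former. Since y sums to zero, invariance of the
   uniform law under s |-> tperm i j * s gives the exact identity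
     n E[y(s i) F(s)] = E[sum_j y(s j) (F(tperm i j * s) - F(s))].
   For T a linear combination of these statistics over several windows, it
   yields E[T psi(T)] = lambda E[psi'(T)] + O(del), where lambda contains no
   linear-bilinear cross term: this is the asymptotic independence. The error del
   is controlled by sum_e |A_e|^2 and the degree variance. Taking psi = sin gives
   a differential inequality for the characteristic function of T, hence its
   convergence to exp(-lambda/2). Bounded continuous functions are reached by
   Bernstein approximation in the variables sin (x_i / t), t large, tightness
   coming from unit second moments. *)

(** * Gaussian integrals *)

(** The first-order coefficients of [psi (T (sw i j s)) - psi (T s)] are explicit sums, and the work
    lies in their concentration. The linear-bilinear coefficient is again a linear statistic, with
    weight vector h a; its variance is bounded through the Hilbert-Schmidt norm of h^2, that is
    through closed 4-walks, so it is small however degrees and adjacency are linked. The same norm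
    makes the bilinear-bilinear coefficient concentrate at 2 n K^2, K being the covariance of two
    windows. Hence the limit correlations of R_w are the squares of those of R_diff. The weights of
    R_w cancel the linear part up to a factor 1/(n-2). The degree variance condition keeps the norm
    of the centred degrees large enough for a Lyapunov bound on a. All errors are measured by one
    parameter del, and the asymptotic hypotheses say that each del in ]0, 1] is eventually
    admissible. The normalising variances are obtained from exact covariance formulas and from the
    Stein identity with psi the identity, which is why psi T is controlled in L2 there and not
    uniformly. *)

Section GaussCharacteristic.
Context {R : realType}.
Notation mu := (@lebesgue_measure R).
Notation pdf := (@normal_pdf R 0 1).

Lemma integral_normal_prob (f : R -> \bar R) :
  (normal_prob (0 : R) 1).-integrable setT f ->
  (\int[normal_prob (0 : R) 1]_x f x = \int[mu]_x (f x * (pdf x)%:E))%E.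
Proof.
move=> /integrableP[mf finf].
have dom := @normal_prob_dominates R 0 1.
rewrite -(Radon_Nikodym_change_of_variables dom)//=; last first.
  by apply/integrableP; split.
apply: ae_eq_integral => //.
- exact: emeasurable_funM.
- apply: emeasurable_funM => //=; apply/measurable_EFinP.
  exact: measurable_normal_pdf.
- apply: ae_eqe_mul2l => /=.
  rewrite Radon_NikodymE//=.
  case: cid => /= h [h1 h2 h3].
  apply: integral_ae_eq => //=.
  + by apply/measurable_EFinP; exact: measurable_normal_pdf.
  + by move=> E E01 mE; rewrite -h3.
Qed.

Lemma bounded_integrable (f : R -> R) (M : R) :
  measurable_fun setT f -> (forall x, `|f x| <= M) ->
  (normal_prob (0 : R) 1).-integrable setT (EFin \o f).
Proof.
move=> mf fM; apply: (@le_integrable _ _ _ _ _ measurableT _ (cst M%:E)).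
- exact/measurable_EFinP.
- move=> x _ /=; rewrite lee_fin (le_trans (fM x))//.
  exact: ler_norm.
- exact: finite_measure_integrable_cst.
Qed.

Lemma normal_pdf01E (x : R) :
  pdf x = normal_peak 1 * expR (- x ^+ 2 / 2).
Proof. by rewrite normal_pdfE// /normal_fun subr0 expr1n -mulr_natl mulr1. Qed.

Lemma is_derive_affine (a b x : R) : is_derive x 1 (fun x => a * x + b) a.
Proof.
apply: is_derive_eq.
by rewrite /GRing.scale/=; ring.
Qed.

Lemma is_derive_expR_comp (h : R -> R) (dh x : R) :
  is_derive x 1 h dh -> is_derive x 1 (fun z => expR (h z)) (dh * expR (h x)).
Proof.
move=> h1; have h2 := is_derive_expR (h x).
by have := is_derive1_comp h2 h1; rewrite mulrC.
Qed.

Lemma is_derive_normal_pdf (x : R) : is_derive x 1 pdf (- x * pdf x).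
Proof.
rewrite (_ : pdf = (fun x => normal_peak 1 * expR (- x ^+ 2 / 2))); last first.
  by apply/funext => z; rewrite normal_pdf01E.
have h1 : is_derive x 1 (fun z : R => - z ^+ 2 / 2) (- x).
  by apply: is_derive_eq; rewrite /GRing.scale/=; lra.
have h2 := is_derive_expR_comp h1.
by apply: is_derive_eq; rewrite /GRing.scale/=; ring.
Qed.

Lemma is_derive_sin_affine (a b x : R) :
  is_derive x 1 (fun z => sin (a * z + b)) (a * cos (a * x + b)).
Proof.
by have := is_derive1_comp (f := sin) (g := fun z => a * z + b) (is_derive_sin (a * x + b)) (is_derive_affine a b x); rewrite mulrC.
Qed.

Lemma is_derive_cos_affine (a b x : R) :
  is_derive x 1 (fun z => cos (a * z + b)) (- (a * sin (a * x + b))).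
Proof.
by have := is_derive1_comp (f := cos) (g := fun z => a * z + b) (is_derive_cos (a * x + b)) (is_derive_affine a b x); rewrite mulrC mulrN.
Qed.

(** Since |x| <= 1 + x^2/4 <= exp (x^2/4), the integrand is dominated by a multiple of the normal
    density of variance 2; hence [s] and [c]. *)
Lemma integrable_id_normal_pdf : mu.-integrable setT (fun x => (x * pdf x)%:E).
Proof.
pose s : R := Num.sqrt 2.
have s0 : s != 0 by rewrite sqrtr_eq0 -ltNge.
pose c := normal_peak 1 / normal_peak s.
have c0 : 0 <= c by rewrite divr_ge0// normal_peak_ge0.
apply: (@le_integrable _ _ _ mu _ measurableT _
  (fun x => (c%:E * (normal_pdf 0 s x)%:E)%E)).
- by apply/measurable_EFinP/measurable_funM => //; exact: measurable_normal_pdf.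
- move=> x _ /=; rewrite lee_fin normrM [`|pdf x|]ger0_norm ?normal_pdf_ge0//.
  rewrite [leRHS]ger0_norm; last by rewrite mulr_ge0// normal_pdf_ge0.
  rewrite normal_pdf01E normal_pdfE// /normal_fun subr0 mulrCA.
  rewrite [leRHS]mulrA /c divfK; last by rewrite gt_eqF// normal_peak_gt0.
  apply: ler_wpM2l; first exact: normal_peak_ge0.
  have -> : - x ^+ 2 / (s ^+ 2 *+ 2) = x ^+ 2 / 4 + (- x ^+ 2 / 2).
    by rewrite sqr_sqrtr// -mulr_natr; field.
  rewrite expRD ler_pM2r ?expR_gt0//.
  apply: le_trans (expR_ge1Dx _).
  have := sqr_ge0 (`|x| / 2 - 1); rewrite -[x ^+ 2]real_normK ?num_real//.
  move: `|x| => t; nra.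
- by apply: integrableZl => //; exact: integrable_normal_pdf.
Qed.

Lemma continuous_derive (f df : R -> R) :
  (forall x : R, is_derive x 1 f (df x)) -> continuous f.
Proof.
move=> h x; apply: differentiable_continuous; apply/derivable1_diffP.
by case: (h x).
Qed.

Lemma integrable_bounded_pdf (f : R -> R) (M : R) : continuous f ->
  (forall x, `|f x| <= M) -> mu.-integrable setT (fun x => (f x * pdf x)%:E).
Proof.
move=> cf fM.
apply: (@le_integrable _ _ _ mu _ measurableT _
  (fun x => (M%:E * (pdf x)%:E)%E)).
- apply/measurable_EFinP/measurable_funM; last exact: measurable_normal_pdf.
  exact: continuous_measurable_fun.
- move=> x _ /=; rewrite lee_fin !normrM; apply: ler_wpM2r => //.
  by apply: le_trans (fM x) _; exact: ler_norm.
- by apply: integrableZl => //; exact: integrable_normal_pdf.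
Qed.

Lemma integrable_bounded_id_pdf (f : R -> R) : continuous f ->
  (forall x, `|f x| <= 1) -> mu.-integrable setT (fun x => (f x * (x * pdf x))%:E).
Proof.
move=> cf fM; apply: le_integrable integrable_id_normal_pdf => //.
  apply/measurable_EFinP/measurable_funM; first exact: continuous_measurable_fun.
  by apply: measurable_funM => //; exact: measurable_normal_pdf.
by move=> x _ /=; rewrite lee_fin normrM ler_piMl.
Qed.

(** These are the boundary terms at n and -n of the integration by parts below; exp (n^2/2) >= 1 +
    n^2/2 >= (n+1)/2 makes them O(1/(n+1)). *)
Lemma cvg_normal_pdf_sin (a b : R) (e : R) : e = 1 \/ e = -1 ->
  (fun n : nat => sin (a * (e * n%:R) + b) * pdf (e * n%:R)) @ \oo --> (0 : R).
Proof.
move=> he; apply/norm_cvg0P.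
apply: (@squeeze_cvgr _ _ _ _ (cst 0) (fun n : nat => 2 * normal_peak 1 * n.+1%:R^-1)).
- apply: nearW => n; rewrite normr_ge0/= normrM.
  rewrite [`|pdf _|]ger0_norm ?normal_pdf_ge0// normal_pdf01E.
  have -> : - (e * n%:R) ^+ 2 / 2 = - (n%:R ^+ 2 / 2) :> R.
    by case: he => ->; field.
  apply: (@le_trans _ _ (1 * (normal_peak 1 * expR (- (n%:R ^+ 2 / 2))))).
    apply: ler_wpM2r; first by rewrite mulr_ge0 ?expR_ge0 ?normal_peak_ge0.
    by rewrite ler_norml sin_geN1 sin_le1.
  rewrite mul1r -mulrA mulrCA; apply: ler_wpM2l; first exact: normal_peak_ge0.
  rewrite expRN -[leRHS]invrK lef_pV2 ?posrE ?expR_gt0//.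
  rewrite invf_div; apply: le_trans (expR_ge1Dx _).
  by rewrite -natr1; have := sqr_ge0 (n%:R - 1 : R); move: n%:R => t; nra.
- exact: cvg_cst.
- rewrite -(mulr0 (2 * normal_peak 1)); apply: cvgMr; exact: cvg_harmonic.
Qed.

(** Stein's identity for the normal law. [f] is the derivative of [F]; its integral over [-n, n] is
    a vanishing boundary term, and by domination it also tends to the integral over the line. *)
Lemma normal_sin_by_parts (a b : R) :
  (\int[mu]_x (sin (a * x + b) * (x * pdf x)))%R =
  a * (\int[mu]_x (cos (a * x + b) * pdf x))%R.
Proof.
pose F x := sin (a * x + b) * pdf x.
pose f x := a * (cos (a * x + b) * pdf x) - sin (a * x + b) * (x * pdf x).
have dF (x : R) : is_derive x 1 F (f x).
  have h1 := is_derive_sin_affine a b x; have h2 := is_derive_normal_pdf x.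
  by apply: is_derive_eq; rewrite /f /GRing.scale/=; ring.
have csin : continuous (fun x : R => sin (a * x + b)).
  exact: (continuous_derive (is_derive_sin_affine a b)).
have ccos : continuous (fun x : R => cos (a * x + b)).
  exact: (continuous_derive (is_derive_cos_affine a b)).
have cpdf : continuous pdf by exact: (continuous_derive is_derive_normal_pdf).
have cf : continuous f.
  move=> x; apply: cvgB.
    by apply: cvgM; [exact: cvg_cst|apply: cvgM; [exact: ccos|exact: cpdf]].
  by apply: cvgM; [exact: csin|apply: cvgM; [exact: cvg_id|exact: cpdf]].
have i1 : mu.-integrable setT (EFin \o (fun x => cos (a * x + b) * pdf x)).
  by apply: (@integrable_bounded_pdf _ 1) => // x; rewrite ler_norml cos_geN1 cos_le1.
have i2 : mu.-integrable setT (EFin \o (fun x => sin (a * x + b) * (x * pdf x))).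
  by apply: integrable_bounded_id_pdf => // x; rewrite ler_norml sin_geN1 sin_le1.
have i3 : mu.-integrable setT (EFin \o (fun x => a * (cos (a * x + b) * pdf x))).
  rewrite (_ : EFin \o _ = (fun x => a%:E * (cos (a * x + b) * pdf x)%:E)%E)//.
  exact: integrableZl.
have i4 : mu.-integrable setT (EFin \o f).
  rewrite (_ : EFin \o f = (fun x => (a * (cos (a * x + b) * pdf x))%:E
     - (sin (a * x + b) * (x * pdf x))%:E)%E)//.
  exact: integrableB.
suff : (\int[mu]_x f x)%R = 0.
  rewrite /f RintegralB// RintegralZl//.
  by move/eqP; rewrite subr_eq0 => /eqP.
pose I (n : nat) : set R := `[- n%:R, n%:R]%classic.
have lim1 : (\int[mu]_x (f \_ (I n)) x)%R @[n --> \oo] --> (\int[mu]_x f x)%R.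
  apply: fine_cvg; rewrite fineK; last exact: integrable_fin_num.
  apply: (@dominated_cvg _ _ _ mu _ measurableT (fun n x => ((f \_ (I n)) x)%:E) _ (fun x => `|(f x)%:E|)%E).
  - move=> n; apply/measurable_EFinP; apply/(measurable_restrictT _ _).1 => //.
      exact: measurable_itv.
    by apply: measurable_funTS; exact: continuous_measurable_fun.
  - move=> x _; apply: cvg_near_cst.
    near=> n; rewrite patchE mem_set// /I /= in_itv/= -ler_norml.
    by near: n; exact: nbhs_infty_ger.
  - by [].
  - exact: integrable_abse.
  - move=> n x _; rewrite patchE; case: ifPn => //=.
    by rewrite normr0 lee_fin.
have lim2 : (\int[mu]_x (f \_ (I n)) x)%R @[n --> \oo] --> (0 : R).
  have lim3 : (fun n : nat => sin (a * (1 * n%:R) + b) * pdf (1 * n%:R)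
        - sin (a * (-1 * n%:R) + b) * pdf (-1 * n%:R)) @ \oo --> (0 : R).
    rewrite -[X in _ --> X](subr0 0).
    by apply: cvgB; apply: cvg_normal_pdf_sin; [left|right].
  apply: cvg_trans lim3; apply: near_eq_cvg; near=> n.
  have n0 : (- n%:R < n%:R :> R).
    have n1 : (0 < n)%N by near: n; exact: nbhs_infty_gt.
    by rewrite (@lt_trans _ _ 0)// ?oppr_lt0 ltr0n.
  rewrite -Rintegral_mkcond /Rintegral (@continuous_FTC2 _ f F)//=.
  - by rewrite /F mul1r mulN1r.
  - exact: continuous_subspaceT.
  - split.
    + by move=> x _; case: (dF x).
    + by apply: cvg_at_right_filter; exact: (continuous_derive dF).
    + by apply: cvg_at_left_filter; exact: (continuous_derive dF).
  - by move=> x _; rewrite derive1E; case: (dF x).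
exact: (cvg_unique _ lim1 lim2).
Unshelve. all: by end_near. Qed.
End GaussCharacteristic.

Section GaussCos.
Context {R : realType}.
Notation mu := (@lebesgue_measure R).
Notation pdf := (@normal_pdf R 0 1).

Lemma is_derive0_const (f : R -> R) :
  (forall x : R, is_derive x 1 f 0) -> forall x, f x = f 0.
Proof. by move=> h x; apply: is_derive_0_is_cst. Qed.

(** Differentiating in the frequency and applying Stein's identity gives H' c = - c H c, so exp
    (c^2/2) H c is constant, equal to its value cos b at 0. *)
Lemma Rintegral_normal_cos (a b : R) :
  (\int[normal_prob 0 1]_x cos (a * x + b))%R = expR (- a ^+ 2 / 2) * cos b.
Proof.
have ccos (c : R) : continuous (fun x : R => cos (c * x + b)).
  exact: (continuous_derive (is_derive_cos_affine c b)).
have csin (c : R) : continuous (fun x : R => sin (c * x + b)).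
  exact: (continuous_derive (is_derive_sin_affine c b)).
have cos1 (t : R) : `|cos t| <= 1 by rewrite ler_norml cos_geN1 cos_le1.
have sin1 (t : R) : `|sin t| <= 1 by rewrite ler_norml sin_geN1 sin_le1.
pose H (c : R) := (\int[mu]_x (cos (c * x + b) * pdf x))%R.
have -> : (\int[normal_prob 0 1]_x cos (a * x + b))%R = H a.
  rewrite /Rintegral integral_normal_prob//.
  apply: (@bounded_integrable _ _ 1) => //.
  exact: continuous_measurable_fun.
have iH (c : R) : mu.-integrable setT (EFin \o (fun x => cos (c * x + b) * pdf x)).
  exact: (@integrable_bounded_pdf _ _ 1).
have iH' (c : R) : mu.-integrable setT (EFin \o (fun x => sin (c * x + b) * (x * pdf x))).
  exact: integrable_bounded_id_pdf.
have dfc (c x : R) : is_derive c 1 (fun c => cos (c * x + b) * pdf x)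
   (- (sin (c * x + b) * (x * pdf x))).
  have h : is_derive c 1 (fun c => cos (c * x + b)) (- (x * sin (c * x + b))).
    rewrite (_ : (fun c => _) = (fun c => cos (x * c + b))); last first.
      by apply/funext => z; rewrite mulrC.
    by rewrite (mulrC c); exact: is_derive_cos_affine.
  by apply: is_derive_eq; rewrite /GRing.scale/=; ring.
have d1 (c x : R) : partial1of2 (fun c x => cos (c * x + b) * pdf x) c x
   = - (sin (c * x + b) * (x * pdf x)).
  by rewrite partial1of2E; case: (dfc c x).
have dH (c : R) : is_derive c 1 H (- (c * H c)).
  have Ic : `]c - 1, c + 1[%classic c.
    by rewrite /= in_itv/=; apply/andP; split; lra.
  pose G (x : R) := `|x * pdf x|.
  have iG : mu.-integrable setT (EFin \o G).
    by have := integrable_abse integrable_id_normal_pdf; exact.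
  have G0 x : 0 <= G x by rewrite /G.
  have Gub (y x : R) : `]c - 1, c + 1[%classic y -> setT x ->
    `|partial1of2 (fun c x => cos (c * x + b) * pdf x) y x| <= G x.
    by move=> _ _; rewrite d1 normrN normrM /G ler_piMl.
  have der (y x : R) : `]c - 1, c + 1[%classic y -> setT x ->
     derivable (fun c : R => cos (c * x + b) * pdf x) y 1.
    by move=> _ _; case: (dfc y x).
  have iH1 (y : R) : `]c - 1, c + 1[%classic y ->
     mu.-integrable setT (EFin \o (fun x => cos (y * x + b) * pdf x)).
    by move=> _; exact: iH.
  have dv := derivable_under_integral measurableT Ic iH1 der G0 iG Gub.
  have := differentiation_under_integral measurableT Ic iH1 der G0 iG Gub.
  rewrite (_ : (\int[mu]_x _)%R = - (c * H c)) => [e|].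
    by apply: DeriveDef => //; rewrite -derive1E.
  under eq_Rintegral do rewrite d1.
  rewrite -normal_sin_by_parts -mulN1r -RintegralZl//.
  by apply: eq_Rintegral => x _; rewrite mulN1r.
pose F (c : R) := expR (c ^+ 2 / 2) * H c.
have dF (c : R) : is_derive c 1 F 0.
  have h1 : is_derive c 1 (fun z : R => z ^+ 2 / 2) c.
    by apply: is_derive_eq; rewrite /GRing.scale/=; lra.
  have h2 := is_derive_expR_comp h1; have h3 := dH c.
  by apply: is_derive_eq; rewrite /GRing.scale/=; ring.
have := is_derive0_const dF a.
rewrite /F expr0n/= mul0r expR0 mul1r.
have -> : H 0 = cos b.
  rewrite /H; under eq_Rintegral do rewrite mul0r add0r.
  rewrite RintegralZl//; last exact: integrable_normal_pdf.
  by rewrite /Rintegral integral_normal_pdf mulr1.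
by move=> <-; rewrite mulrA -expRD mulNr addNr expR0 mul1r.
Qed.
End GaussCos.

(** * Iterated Gaussian integrals of bounded continuous functions *)

Section GaussInt.
Context {R : realType}.
Notation N01 := (normal_prob (0 : R) 1).

Definition upd (d : nat) (x : R) (z : nat -> R) : nat -> R :=
  fun i => if i == d then x else z i.

(** Continuity is sequential, along coordinatewise convergence of sequences: this is the form that
    dominated convergence produces and consumes. *)
Definition bcont (M : R) (g : (nat -> R) -> R) :=
  (forall z, `|g z| <= M) /\
  (forall (zn : nat -> nat -> R) (z : nat -> R),
    (forall i, (fun n => zn n i) @ \oo --> z i) ->
    (fun n => g (zn n)) @ \oo --> g z).

Lemma bcont_upd M g d x : bcont M g -> bcont M (fun z => g (upd d x z)).
Proof.
move=> [gM gc]; split=> [z|zn z h]; first exact: gM.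
apply: gc => i; rewrite /upd; case: eqP => // _; exact: cvg_cst.
Qed.

(** One induction for both claims: measurability of the outer integrand comes from its continuity,
    which is the convergence claim in the smaller dimension, and its integrability from the
    bound. *)
Lemma gauss_int_cont d :
  (forall g M, bcont M g -> `|gauss_int d g| <= M) /\
  (forall (gn : nat -> (nat -> R) -> R) g M, (forall n, bcont M (gn n)) ->
     bcont M g -> (forall z, (fun n => gn n z) @ \oo --> g z) ->
     (fun n => gauss_int d (gn n)) @ \oo --> gauss_int d g).
Proof.
elim: d => [|d [IH1 IH2]]; first by split=> [g M [gM _]|gn g M _ _ h] /=; [exact: gM|exact: h].
have Ic g M : bcont M g -> continuous (fun x => gauss_int d (fun z => g (upd d x z))).
  move=> gb x; apply/(@cvg_nbhsP _ R^o) => w wx.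
  apply: (IH2 _ _ M) => [n||z]; [exact: bcont_upd|exact: bcont_upd|].
  apply: gb.2 => i; rewrite /upd; case: eqP => // _; exact: cvg_cst.
have Im g M : bcont M g -> measurable_fun setT (fun x => gauss_int d (fun z => g (upd d x z))).
  by move=> gb; apply: continuous_measurable_fun; exact: (Ic _ M).
have Ib g M x : bcont M g -> `|gauss_int d (fun z => g (upd d x z))| <= M.
  by move=> gb; apply: IH1; exact: bcont_upd.
have Ii g M : bcont M g -> N01.-integrable setT
    (EFin \o (fun x => gauss_int d (fun z => g (upd d x z)))).
  move=> gb; apply: (@bounded_integrable _ _ M); first exact: (Im _ M).
  by move=> x; exact: Ib.
split.
  move=> g M gb; rewrite [gauss_int _ _]/=.
  apply: le_trans (le_normr_Rintegral measurableT (Ii _ _ gb)) _.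
  have -> : M = (\int[N01]_x M)%R.
    rewrite Rintegral_cst//.
    by have /(congr1 fine) /= -> := integral_normal_pdf (0 : R) 1; rewrite mulr1.
  apply: le_Rintegral => //.
  - have := integrable_abse (Ii _ _ gb); exact.
  - exact: finite_measure_integrable_cst.
  - by move=> x _; exact: Ib.
move=> gn g M gnb gb h; rewrite [gauss_int _ _]/=.
apply: fine_cvg; rewrite fineK; last exact: (integrable_fin_num _ (Ii _ _ gb)).
apply: (@dominated_cvg _ _ _ N01 _ measurableT
  (fun n x => (gauss_int d (fun z => gn n (upd d x z)))%:E) _ (cst M%:E)).
- by move=> n; apply/measurable_EFinP; exact: (Im _ M).
- move=> x _; apply: cvg_EFin; first exact: nearW.
  apply: (IH2 _ _ M) => [n||z]; [exact: bcont_upd|exact: bcont_upd|exact: h].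
- by [].
- exact: finite_measure_integrable_cst.
- by move=> n x _ /=; rewrite lee_fin; exact: Ib.
Qed.

Lemma gauss_int_norm_le d g M : bcont M g -> `|gauss_int d g| <= M.
Proof. exact: (gauss_int_cont d).1. Qed.

Lemma gauss_int_cvg d (gn : nat -> (nat -> R) -> R) g M :
  (forall n, bcont M (gn n)) -> bcont M g -> (forall z, (fun n => gn n z) @ \oo --> g z) ->
  (fun n => gauss_int d (gn n)) @ \oo --> gauss_int d g.
Proof. exact: (gauss_int_cont d).2. Qed.

Lemma gauss_int_integrable d g M : bcont M g ->
  N01.-integrable setT (EFin \o (fun x => gauss_int d (fun z => g (upd d x z)))).
Proof.
move=> gb; apply: (@bounded_integrable _ _ M) => [|x]; last first.
  by apply: gauss_int_norm_le; exact: bcont_upd.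
apply: continuous_measurable_fun => x; apply/(@cvg_nbhsP _ R^o) => w wx.
apply: (@gauss_int_cvg _ _ _ M) => [n||z]; [exact: bcont_upd|exact: bcont_upd|].
apply: gb.2 => i; rewrite /upd; case: eqP => // _; exact: cvg_cst.
Qed.

Lemma gauss_intZD d (k : R) g h M M' : bcont M g -> bcont M' h ->
  gauss_int d (fun z => k * g z + h z) = k * gauss_int d g + gauss_int d h.
Proof.
elim: d g h => [//|d IH] g h gb hb /=.
rewrite -RintegralZl//; last exact: (@gauss_int_integrable _ _ M).
rewrite -RintegralD//.
- by apply: eq_Rintegral => x _; rewrite -IH//; exact: bcont_upd.
- rewrite (_ : EFin \o _ = (fun x => k%:E * (EFin \o (fun x => gauss_int d (fun z => g (upd d x z)))) x)%E)//.
  by apply: integrableZl => //; exact: (@gauss_int_integrable _ _ M).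
- exact: (@gauss_int_integrable _ _ M').
Qed.

(** The phase b is general so that the outermost variable can be absorbed into it by the
    induction. *)
Lemma gauss_int_cos d (c : nat -> R) (b : R) :
  gauss_int d (fun z => cos (\sum_(j < d) c j * z j + b)) =
  expR (- (\sum_(j < d) c j ^+ 2) / 2) * cos b.
Proof.
elim: d b => [|d IH] b /=; first by rewrite !big_ord0 oppr0 mul0r expR0 mul1r add0r.
transitivity (\int[N01]_x (expR (- (\sum_(j < d) c j ^+ 2) / 2) * cos (c d * x + b)))%R.
  apply: eq_Rintegral => x _; rewrite -IH; congr gauss_int; apply/funext => z.
  rewrite big_ord_recr/= eqxx -addrA; congr (cos (_ + _)).
  by apply: eq_bigr => j _; rewrite ltn_eqF.
rewrite RintegralZl//; last first.
  apply: (@bounded_integrable _ _ 1).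
    by apply: continuous_measurable_fun; exact: (continuous_derive (is_derive_cos_affine (c d) b)).
  by move=> x; rewrite ler_norml cos_geN1 cos_le1.
rewrite Rintegral_normal_cos big_ord_recr/= mulrA -expRD; congr (expR _ * _).
by ring.
Qed.
End GaussInt.

(** * Convergence in distribution from cosines *)

Section CoinFlips.
Context {R : realType} {I : finType}.
Variable p : I -> R.

Definition coin (b : bool) : R := if b then 1 else -1.
(** Probability of the outcome w for independent signs with means [p q], when these lie in
    [-1, 1]. *)
Definition flip_weight (w : {ffun I -> bool}) : R :=
  \prod_q ((1 + coin (w q) * p q) / 2).

Lemma flip_weight_sum (F : I -> bool -> R) :
  \sum_w flip_weight w * \prod_q F q (w q) =
  \prod_q ((1 + p q) / 2 * F q true + (1 - p q) / 2 * F q false).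
Proof.
transitivity (\sum_(w : {ffun I -> bool}) \prod_q ((1 + coin (w q) * p q) / 2 * F q (w q))).
  by apply: eq_bigr => w _; rewrite big_split.
rewrite -(bigA_distr_bigA (fun q b => (1 + coin b * p q) / 2 * F q b)).
by apply: eq_bigr => q _; rewrite big_bool/= mul1r mulN1r.
Qed.

Lemma flip_weight1 : \sum_w flip_weight w = 1.
Proof.
transitivity (\sum_w flip_weight w * \prod_(q : I) (1 : R)).
  by apply: eq_bigr => w _; rewrite big1 ?mulr1.
rewrite (flip_weight_sum (fun _ _ => 1)).
by rewrite big1// => q _; field.
Qed.

Lemma flip_weight_cov (q q' : I) :
  \sum_w flip_weight w * ((coin (w q) - p q) * (coin (w q') - p q')) =
  (q == q')%:R * (1 - p q ^+ 2).
Proof.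
(* Both factors are written as one product over all coins, so that independence applies; for q <> q'
   the factor at q has mean zero. *)
pose F r b := (if r == q then coin b - p r else 1) * (if r == q' then coin b - p r else 1).
transitivity (\sum_w flip_weight w * \prod_r F r (w r)).
  apply: eq_bigr => w _; congr (_ * _); rewrite big_split/=.
  by rewrite -!big_mkcond/= !big_pred1_eq.
rewrite flip_weight_sum (bigD1 q)//= /F eqxx.
have [<-|qq'] := eqVneq q q'.
  rewrite big1 ?mulr1 ?mul1r /coin => [|r /negbTE rq]; first by field.
  by rewrite rq; field.
by rewrite /coin (_ : _ + _ = 0) ?mul0r//; field.
Qed.

Lemma flip_weight_var (A : {pred I}) :
  (forall q, `|p q| <= 1) ->
  \sum_w flip_weight w * (\sum_(q in A) (coin (w q) - p q)) ^+ 2 <= #|A|%:R.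
Proof.
move=> p1.
have -> : \sum_w flip_weight w * (\sum_(q in A) (coin (w q) - p q)) ^+ 2 =
   \sum_(q in A) \sum_(q' in A) (q == q')%:R * (1 - p q ^+ 2).
  transitivity (\sum_w \sum_(q in A) \sum_(q' in A)
     flip_weight w * ((coin (w q) - p q) * (coin (w q') - p q'))).
    apply: eq_bigr => w _; rewrite expr2 mulr_suml mulr_sumr.
    by apply: eq_bigr => q _; rewrite !mulr_sumr.
  rewrite exchange_big/=; apply: eq_bigr => q _.
  rewrite exchange_big/=; apply: eq_bigr => q' _.
  exact: flip_weight_cov.
rewrite -sum1_card natr_sum; apply: ler_sum => q qA.
rewrite (bigD1 q)//= eqxx mul1r big1 => [|q' /andP[_ /negbTE h]]; last first.
  by rewrite eq_sym h mul0r.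
by rewrite addr0 lerBlDr lerDl sqr_ge0.
Qed.

Lemma flip_weight_ge0 w : (forall q, `|p q| <= 1) -> 0 <= flip_weight w.
Proof.
move=> p1; apply: prodr_ge0 => q _; rewrite divr_ge0//.
have := p1 q; rewrite ler_norml /coin => /andP[h1 h2].
by case: (w q); lra.
Qed.
End CoinFlips.

(** * Quadratic modulus of continuity *)

Section Modulus.
Context {R : realType} {d : nat}.

(** Uniform continuity treats y near x; for y far from x the trivial bound 2 M is below C times the
    squared distance. The quadratic form is chosen so that averaging over y produces a variance. *)
Lemma quadratic_modulus (f : 'rV[R]_d -> R) (M T e : R) : continuous f ->
  (forall x, `|f x| <= M) -> 0 < e ->
  exists2 C, 0 <= C & forall x y : 'rV[R]_d, (forall i, `|x 0 i| <= T) ->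
    `|f x - f y| <= e + C * \sum_i (x 0 i - y 0 i) ^+ 2.
Proof.
move=> fc fM e0.
pose K := [set v : 'rV[R]_d | forall i, `[- T, T]%classic (v ord0 i)].
have cK : compact K.
  by apply: (@rV_compact R d (fun=> `[- T, T]%classic)) => i; exact: segment_compact.
pose P (dl : R) (x : 'rV[R]_d) := forall y, ball x dl y -> `|f x - f y| <= e.
(* The near-covering form of compactness gives one radius for all x in the cube, while y may leave
   it. *)
have : \forall dl \near (0 : R)^'+, K `<=` P dl.
  apply: (compact_near_coveringP K).1 => // x Kx.
  have /cvgrPdist_lt /(_ (e / 2)) := fc x.
  rewrite divr_gt0// => /(_ erefl) /nbhs_ballP[r /= r0 hr].
  exists (ball x (r / 2), [set t | t < r / 2]); first split => /=.
  - by apply: nbhsx_ballx; rewrite divr_gt0.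
  - by apply: nbhs_right_lt; rewrite divr_gt0.
  - case=> x' dl [/= xx' dlr] y x'y.
    have h1 : `|f x - f x'| < e / 2.
      by apply: hr; apply: le_ball xx'; lra.
    have h2 : `|f x - f y| < e / 2.
      apply: hr; rewrite (splitr r); apply: ball_triangle xx' _.
      by apply: le_ball x'y; exact: ltW.
    have := ler_normB (f x - f y) (f x - f x').
    by rewrite opprB addrC addrA subrK; lra.
move=> hdl.
near (0 : R)^'+ => dl.
have dl0 : 0 < dl by near: dl; exact: nbhs_right_gt.
have hP : K `<=` P dl by near: dl.
have M0 : 0 <= M by exact: le_trans (fM 0).
exists (2 * M / dl ^+ 2); first by rewrite divr_ge0// ?mulr_ge0// sqr_ge0.
move=> x y xT.
have Kx : K x by move=> i; rewrite /= in_itv/= -ler_norml.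
have S0 : 0 <= \sum_i (x 0 i - y 0 i) ^+ 2 by apply: sumr_ge0 => i _; exact: sqr_ge0.
have [h|h] := ltP (\sum_i (x 0 i - y 0 i) ^+ 2) (dl ^+ 2).
  rewrite (@le_trans _ _ e)// ?lerDl ?mulr_ge0 ?invr_ge0 ?sqr_ge0//.
  apply: hP => //; split=> // i j; rewrite ord1.
  suff : `|x 0 j - y 0 j| < dl by [].
  rewrite ltNge; apply/negP => hd; move: h; apply/negP; rewrite -leNgt.
  have hd2 : dl ^+ 2 <= (x 0 j - y 0 j) ^+ 2.
    by rewrite -[leRHS]real_normK ?num_real// lerXn2r// nnegrE ltW.
  apply: le_trans hd2 _; rewrite (bigD1 j)//= lerDl.
  by apply: sumr_ge0 => k _; exact: sqr_ge0.
apply: (@le_trans _ _ (2 * M)).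
  apply: le_trans (ler_normB _ _) _; have := fM x; have := fM y; lra.
apply: (@le_trans _ _ (2 * M / dl ^+ 2 * dl ^+ 2)).
  by rewrite divfK// expf_neq0// gt_eqF.
apply: (@le_trans _ _ (2 * M / dl ^+ 2 * \sum_i (x 0 i - y 0 i) ^+ 2)).
  by apply: ler_wpM2l => //; rewrite divr_ge0// ?mulr_ge0// sqr_ge0.
by rewrite lerDr ltW.
Unshelve. all: by end_near. Qed.
End Modulus.

Section Taylor.
Context {R : realType}.

Lemma MVT_between (f df : R -> R) (x y : R) :
  (forall x : R, is_derive x 1 f (df x)) ->
  exists2 c, `|c - x| <= `|y - x| & f y - f x = df c * (y - x).
Proof.
move=> h; have fc := continuous_derive h.
have [xy|yx|->] := ltgtP x y; last by exists y; rewrite ?subrr ?mulr0.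
- have [c cxy e] := @MVT _ f df x y xy (fun x _ => h x) (continuous_subspaceT fc).
  exists c => //; move: cxy; rewrite in_itv/= => /andP[c1 c2].
  by rewrite !ger0_norm ?subr_ge0 ?ltW// ltrD2r.
- have [c cxy e] := @MVT _ f df y x yx (fun x _ => h x) (continuous_subspaceT fc).
  exists c; last by rewrite -opprB e -mulrN opprB.
  move: cxy; rewrite in_itv/= => /andP[c1 c2].
  by rewrite ![`|_ - x|]distrC !ger0_norm ?subr_ge0 ?ltW// ltrD2l ltrN2.
Qed.

Lemma derive_lipschitz (f df : R -> R) (M x y : R) :
  (forall x : R, is_derive x 1 f (df x)) -> (forall x, `|df x| <= M) ->
  `|f y - f x| <= M * `|y - x|.
Proof.
move=> h hM; have [c _ ->] := MVT_between x y h.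
by rewrite normrM ler_wpM2r.
Qed.

Lemma derive_taylor1 (f df : R -> R) (M x h : R) :
  (forall x : R, is_derive x 1 f (df x)) ->
  (forall x y, `|df y - df x| <= M * `|y - x|) -> 0 <= M ->
  `|f (x + h) - f x - h * df x| <= M * h ^+ 2.
Proof.
move=> hd hM M0; have [c cx ->] := MVT_between x (x + h) hd.
move: cx; rewrite addrAC subrr add0r => cx.
rewrite (mulrC h) -mulrBl normrM -real_normK ?num_real// expr2 mulrA ler_wpM2r//.
by apply: le_trans (hM _ _) _; exact: ler_wpM2l.
Qed.

Lemma cos_norm_le1 (x : R) : `|cos x| <= 1.
Proof. by rewrite ler_norml cos_geN1 cos_le1. Qed.

Lemma sin_norm_le1 (x : R) : `|sin x| <= 1.
Proof. by rewrite ler_norml sin_geN1 sin_le1. Qed.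

Lemma cos_lipschitz (x y : R) : `|cos y - cos x| <= `|y - x|.
Proof.
rewrite -[leRHS]mul1r; apply: (@derive_lipschitz cos (fun x => - sin x)) => t.
by rewrite normrN sin_norm_le1.
Qed.

Lemma sin_sub_id_le (x : R) : `|sin x - x| <= x ^+ 2.
Proof.
have := @derive_taylor1 sin cos 1 0 x (@is_derive_sin R).
rewrite add0r sin0 subr0 cos0 mulr1 mul1r; apply => // y z.
by rewrite mul1r cos_lipschitz.
Qed.

End Taylor.

(** * Expectation under the permutation law *)

Section PermE.
Context {R : realType} {n : nat}.
Implicit Types f g : {perm 'I_n} -> R.

Lemma eq_permE f g : f =1 g -> permE f = permE g.
Proof. by move=> fg; rewrite /permE; under eq_bigr do rewrite fg. Qed.

Lemma permED f g : permE (fun s => f s + g s) = permE f + permE g.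
Proof. by rewrite /permE big_split mulrDr. Qed.

Lemma permEN f : permE (fun s => - f s) = - permE f.
Proof. by rewrite /permE sumrN mulrN. Qed.

Lemma permEB f g : permE (fun s => f s - g s) = permE f - permE g.
Proof. by rewrite permED permEN. Qed.

Lemma permEZ (k : R) f : permE (fun s => k * f s) = k * permE f.
Proof. by rewrite /permE -mulr_sumr mulrCA. Qed.

Lemma permE_sum (I : Type) (r : seq I) (P : pred I) (F : I -> {perm 'I_n} -> R) :
  permE (fun s => \sum_(i <- r | P i) F i s) = \sum_(i <- r | P i) permE (F i).
Proof. by rewrite /permE exchange_big mulr_sumr. Qed.

Lemma permE_cst (c : R) : permE (fun _ : {perm 'I_n} => c) = c.
Proof.
rewrite /permE sumr_const card_Sn -[c *+ _]mulr_natl mulrA mulVf ?mul1r//.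
Qed.

Lemma permE_le f g : (forall s, f s <= g s) -> permE f <= permE g.
Proof.
move=> fg; rewrite /permE ler_wpM2l ?invr_ge0//.
by apply: ler_sum => s _; exact: fg.
Qed.

Lemma permE_ge0 f : (forall s, 0 <= f s) -> 0 <= permE f.
Proof. by move=> f0; rewrite -(permE_cst 0); exact: permE_le. Qed.

Lemma permE_norm f : `|permE f| <= permE (fun s => `|f s|).
Proof.
rewrite ler_norml -permEN; apply/andP; split; apply: permE_le => s.
  by rewrite lerNl -normrN ler_norm.
exact: ler_norm.
Qed.

Lemma permE_norm_dist f g : `|permE f - permE g| <= permE (fun s => `|f s - g s|).
Proof. by rewrite -permEB; exact: permE_norm. Qed.
End PermE.

Section RowConvergence.
Context {R : realType}.

Lemma cvg_sumr (T : Type) (F : set_system T) {FF : Filter F} (I : Type)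
    (r : seq I) (f : I -> T -> R) (l : I -> R) :
  (forall i, f i x @[x --> F] --> l i) ->
  (\sum_(i <- r) f i x) @[x --> F] --> \sum_(i <- r) l i.
Proof.
move=> h; elim: r => [|i r IH].
  by rewrite big_nil; under eq_fun do rewrite big_nil; exact: cvg_cst.
rewrite big_cons; under eq_fun do rewrite big_cons.
by apply: cvgD => //; exact: h.
Qed.

Lemma cvg_rV (T : Type) (F : set_system T) {FF : Filter F} d
    (f : T -> 'rV[R]_d) (l : 'rV[R]_d) :
  (forall i, f x 0 i @[x --> F] --> l 0 i) -> f x @[x --> F] --> l.
Proof.
move=> h; apply/cvg_ballP => e e0.
have : \forall x \near F, forall i, ball (l 0 i) e (f x 0 i).
  by apply: filter_forall => i; have /cvg_ballP := h i; exact.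
by apply: filterS => x hx; split=> // i j; rewrite ord1; exact: hx.
Qed.

Section Continuity.
Variable T : topologicalType.
Implicit Types f g : T -> R.

Lemma continuous_addf f g : continuous f -> continuous g ->
  continuous (fun x => f x + g x).
Proof. by move=> fc gc x; apply: cvgD; [exact: fc|exact: gc]. Qed.

Lemma continuous_mulf f g : continuous f -> continuous g ->
  continuous (fun x => f x * g x).
Proof. by move=> fc gc x; apply: cvgM; [exact: fc|exact: gc]. Qed.

Lemma continuous_cstf (c : R) : continuous (fun _ : T => c).
Proof. by move=> x; exact: cvg_cst. Qed.

Lemma continuous_sumf (I : Type) (r : seq I) (F : I -> T -> R) :
  (forall i, continuous (F i)) -> continuous (fun x => \sum_(i <- r) F i x).
Proof. by move=> Fc x; apply: cvg_sumr => i; exact: Fc. Qed.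

Lemma continuous_compf f (h : R -> R) : continuous f -> continuous h ->
  continuous (fun x => h (f x)).
Proof. by move=> fc hc x; apply: continuous_comp; [exact: fc|exact: hc]. Qed.
End Continuity.
End RowConvergence.

(** * Test functions closed under trigonometric multiplication *)

Section Criterion.
Context {R : realType} {d : nat}.
Variables (X : forall n, {perm 'I_n} -> 'rV[R]_d) (L : 'M[R]_d).
Implicit Types (f g h : 'rV[R]_d -> R) (k M : R).
Local Notation EX n f := (permE (fun s => f (X (n := n) s))).
Local Notation G f := (gauss_expect 0 L f).

Definition lin (th : 'I_d -> R) (x : 'rV[R]_d) := \sum_i th i * x 0 i.

Lemma lin_continuous th : continuous (lin th).
Proof.
apply: continuous_sumf => i; apply: continuous_mulf; first exact: continuous_cstf.
exact: coord_continuous.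
Qed.

Lemma cos_lin_continuous th b : continuous (fun x => cos (lin th x + b)).
Proof.
apply: continuous_compf (@continuous_cos R).
by apply: continuous_addf; [exact: lin_continuous|exact: continuous_cstf].
Qed.

Lemma bcont_rV f M : continuous f -> (forall x, `|f x| <= M) ->
  bcont M (fun z => f (0 + (\row_(j < d) z j) *m L)).
Proof.
move=> fc fM; split=> [z|zn z h]; first exact: fM.
apply: (@continuous_cvg _ _ _ _ _ (fun n => 0 + (\row_(j < d) zn n j) *m L)); first exact: fc.
apply: cvg_rV => i; rewrite add0r !mxE.
under eq_fun do rewrite add0r !mxE.
apply: cvg_sumr => j; rewrite !mxE; under eq_fun do rewrite mxE.
by apply: cvgM; [exact: h|exact: cvg_cst].
Qed.

Lemma gauss_expectZD k f g M M' : continuous f -> (forall x, `|f x| <= M) ->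
  continuous g -> (forall x, `|g x| <= M') ->
  G (fun x => k * f x + g x) = k * G f + G g.
Proof.
move=> fc fM gc gM; rewrite /gauss_expect.
exact: (gauss_intZD _ _ (bcont_rV fc fM) (bcont_rV gc gM)).
Qed.

Lemma gauss_expect_dist f g e M : continuous f -> (forall x, `|f x| <= M) ->
  continuous g -> (forall x, `|f x - g x| <= e) -> `|G f - G g| <= e.
Proof.
move=> fc fM gc fge.
have gM x : `|g x| <= M + e.
  have -> : g x = f x - (f x - g x) by rewrite opprB addrC subrK.
  by apply: le_trans (ler_normB _ _) _; exact: lerD.
have -> : G f - G g = G (fun x => (-1) * g x + f x).
  by rewrite (gauss_expectZD _ gc gM fc fM); ring.
apply: gauss_int_norm_le; apply: (@bcont_rV (fun x => -1 * g x + f x)).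
  apply: continuous_addf => //; apply: continuous_mulf => //.
  exact: continuous_cstf.
by move=> x; rewrite mulN1r addrC.
Qed.

(** Every frequency and phase is built into the definition: this makes the class stable under
    multiplication by sines, so that all trigonometric polynomials are reached from the constant
    1. *)
Definition good (g : 'rV[R]_d -> R) := [/\ continuous g,
  exists M, forall x, `|g x| <= M &
  forall th b, (fun n => EX n (fun x => g x * cos (lin th x + b))) @ \oo -->
    G (fun x => g x * cos (lin th x + b))].

Lemma good_cvg g : good g -> (fun n => EX n g) @ \oo --> G g.
Proof.
case=> _ _ /(_ (fun=> 0) 0).
have e x : g x * cos (lin (fun=> 0) x + 0) = g x.
  by rewrite /lin big1 ?addr0 ?cos0 ?mulr1// => i _; rewrite mul0r.
under eq_fun do under eq_permE do rewrite e.
by have -> : (fun x => g x * cos (lin (fun=> 0) x + 0)) = g by exact/funext.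
Qed.

Lemma continuous_ZD k (f g : 'rV[R]_d -> R) : continuous f -> continuous g ->
  continuous (fun x => k * f x + g x).
Proof.
move=> fc gc; apply: continuous_addf => //; apply: continuous_mulf => //.
exact: continuous_cstf.
Qed.

Lemma bounded_cos_mul (g : 'rV[R]_d -> R) M th b : (forall x, `|g x| <= M) ->
  forall x, `|g x * cos (lin th x + b)| <= M.
Proof.
by move=> gM x; rewrite normrM; apply: le_trans (gM x); rewrite ler_piMr// cos_norm_le1.
Qed.

Lemma good_ZD k g h : good g -> good h -> good (fun x => k * g x + h x).
Proof.
move=> [gc [M gM] gl] [hc [M' hM] hl]; split.
- exact: continuous_ZD.
- exists (`|k| * M + M') => x; apply: le_trans (ler_normD _ _) _.
  by apply: lerD => //; rewrite normrM ler_wpM2l.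
- move=> th b.
  have e x : (k * g x + h x) * cos (lin th x + b) =
    k * (g x * cos (lin th x + b)) + h x * cos (lin th x + b) by ring.
  rewrite [X in _ --> G X](_ : _ = (fun x => k * (g x * cos (lin th x + b)) + h x * cos (lin th x + b))); last exact/funext.
  rewrite (@gauss_expectZD _ _ _ M M').
  + rewrite (_ : (fun n => _) = (fun n => k * EX n (fun x => g x * cos (lin th x + b)) +
        EX n (fun x => h x * cos (lin th x + b)))); last first.
      by apply/funext => n; rewrite -permEZ -permED; exact: eq_permE.
    by apply: cvgD => //; apply: cvgM => //; exact: cvg_cst.
  + exact/continuous_mulf/cos_lin_continuous.
  + exact: bounded_cos_mul.
  + exact/continuous_mulf/cos_lin_continuous.
  + exact: bounded_cos_mul.
Qed.

(** By product-to-sum, sine times cosine is half the difference of two sines at the frequencies [t1]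
    and [t2]; a phase shift by pi/2 turns them into cosines. *)
Lemma good_mul_sin g (om al be : R) (i : 'I_d) : good g ->
  good (fun x => g x * (al + be * sin (om * x 0 i))).
Proof.
move=> gg; have [gc [M gM] gl] := gg.
pose u := fun j => if j == i then om else 0.
have lu x : lin u x = om * x 0 i.
  rewrite /lin (bigD1 i)//= /u eqxx big1 ?addr0// => j /negbTE ->.
  by rewrite mul0r.
have linD th th' x : lin (fun j => th j + th' j) x = lin th x + lin th' x.
  by rewrite /lin -big_split; apply: eq_bigr => j _; rewrite mulrDl.
have linB th th' x : lin (fun j => th j - th' j) x = lin th x - lin th' x.
  by rewrite /lin -sumrB; apply: eq_bigr => j _; rewrite mulrBl.
have sc : continuous (fun x : 'rV[R]_d => sin (om * x 0 i)).
  apply: continuous_compf (@continuous_sin R).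
  by apply: continuous_mulf; [exact: continuous_cstf|exact: coord_continuous].
split.
- apply: continuous_mulf => //; apply: continuous_addf; first exact: continuous_cstf.
  by apply: continuous_mulf => //; exact: continuous_cstf.
- exists (M * (`|al| + `|be|)) => x; rewrite normrM; apply: ler_pM => //.
  apply: le_trans (ler_normD _ _) _; rewrite lerD2l normrM ler_piMr//.
  exact: sin_norm_le1.
- move=> th b.
  pose C t c := fun x => g x * cos (lin t x + c).
  pose t1 j := th j + u j; pose t2 j := th j - u j.
  have e x : g x * (al + be * sin (om * x 0 i)) * cos (lin th x + b) =
    al * C th b x + ((be / 2) * C t1 (b - pi / 2) x + (- (be / 2)) * C t2 (b - pi / 2) x).
    rewrite /C /t1 /t2 linD linB lu !addrA !cosBpihalf.
    rewrite [lin th x + _ + b]addrAC [lin th x - _ + b]addrAC sinD sinB.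
    by field.
  have Cc t c : continuous (C t c) by exact/continuous_mulf/cos_lin_continuous.
  have CM t c x : `|C t c x| <= M by exact: bounded_cos_mul.
  rewrite [X in _ --> G X](_ : _ = (fun x => al * C th b x + ((be / 2) * C t1 (b - pi / 2) x + (- (be / 2)) * C t2 (b - pi / 2) x))); last exact/funext.
  rewrite [X in X @ _ --> _](_ : _ = (fun n => al * EX n (C th b) + ((be / 2) * EX n (C t1 (b - pi / 2)) +
     (- (be / 2)) * EX n (C t2 (b - pi / 2))))); last first.
    by apply/funext => n; rewrite -!permEZ -!permED; exact: eq_permE.
  have D1 : continuous (fun x => - (be / 2) * C t2 (b - pi / 2) x).
    by apply: continuous_mulf => //; exact: continuous_cstf.
  have D2 x : `|- (be / 2) * C t2 (b - pi / 2) x| <= `|be / 2| * M.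
    by rewrite normrM normrN ler_wpM2l.
  rewrite (@gauss_expectZD _ _ _ M (`|be / 2| * M + `|be / 2| * M)) => //; first last.
  + move=> x; apply: le_trans (ler_normD _ _) _; apply: lerD => //.
    by rewrite normrM ler_wpM2l.
  + exact: continuous_ZD.
  rewrite (@gauss_expectZD _ _ _ M (`|be / 2| * M)) => //.
  have -> : G (fun x => - (be / 2) * C t2 (b - pi / 2) x) = - (be / 2) * G (C t2 (b - pi / 2)).
    have z0 (x : 'rV[R]_d) : `|(fun=> 0 : R) x| <= 0 by rewrite normr0.
    have zc : continuous (fun _ : 'rV[R]_d => 0 : R) by exact: continuous_cstf.
    rewrite (_ : (fun x => _) = (fun x => - (be / 2) * C t2 (b - pi / 2) x + 0)); last first.
      by apply/funext => x; rewrite addr0.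
    rewrite (gauss_expectZD _ (Cc _ _) (CM _ _) zc z0).
    rewrite [X in _ + X](_ : _ = 0) ?addr0//.
    by apply/eqP; rewrite -normr_le0; exact: gauss_int_norm_le (bcont_rV zc z0).
  apply: cvgD; first by apply: cvgM; [exact: cvg_cst|exact: gl].
  by apply: cvgD; apply: cvgM; [exact: cvg_cst|exact: gl|exact: cvg_cst|exact: gl].
Qed.
End Criterion.

Section Approximation.
Context {R : realType} {d : nat}.
Variables (X : forall n, {perm 'I_n} -> 'rV[R]_d) (L : 'M[R]_d).
Hypothesis good1 : good X L (fun=> 1).
Implicit Types f : 'rV[R]_d -> R.

Lemma good_cst c : good X L (fun=> c).
Proof.
rewrite (_ : (fun=> c) = (fun x : 'rV[R]_d => (c - 1) * (fun=> 1) x + (fun=> 1) x)).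
  exact: good_ZD.
by apply/funext => x; rewrite mulr1 subrK.
Qed.

Lemma good_sum (I : Type) (r : seq I) (F : I -> 'rV[R]_d -> R) :
  (forall i, good X L (F i)) -> good X L (fun x => \sum_(i <- r) F i x).
Proof.
move=> h; elim: r => [|i r IH].
  by under eq_fun do rewrite big_nil; exact: good_cst.
rewrite [X in good _ _ X](_ : _ = (fun x : 'rV[R]_d => 1 * F i x + \sum_(i <- r) F i x)).
  exact: good_ZD.
by apply/funext => x; rewrite big_cons mul1r.
Qed.

Lemma good_prod_sin (I : Type) (r : seq I) (c : R) (om al be : I -> R) (i : I -> 'I_d) :
  good X L (fun x => c * \prod_(q <- r) (al q + be q * sin (om q * x 0 (i q)))).
Proof.
elim: r => [|q r IH].
  by under eq_fun do rewrite big_nil; exact: good_cst.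
rewrite [X in good _ _ X](_ : _ = (fun x : 'rV[R]_d => (c * \prod_(q <- r) (al q + be q * sin (om q * x 0 (i q))))
   * (al q + be q * sin (om q * x 0 (i q))))).
  exact: good_mul_sin.
by apply/funext => x; rewrite big_cons; ring.
Qed.

(** A bounded surrogate for x, tending to x as T grows, whose coordinates have polynomials that are
    trigonometric polynomials in x. *)
Definition sin_rescale (T : R) (x : 'rV[R]_d) : 'rV[R]_d :=
  \row_i (T * sin (T^-1 * x 0 i)).

Lemma sin_rescale_continuous T : continuous (sin_rescale T).
Proof.
move=> x; apply: (cvg_rV (F := nbhs x)) => i; rewrite mxE.
under eq_fun do rewrite mxE.
suff : continuous (fun x : 'rV[R]_d => T * sin (T^-1 * x 0 i)) by exact.
apply: continuous_mulf; first exact: continuous_cstf.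
apply: continuous_compf (@continuous_sin R).
by apply: continuous_mulf; [exact: continuous_cstf|exact: coord_continuous].
Qed.

(** A Bernstein node: each coordinate is T times the average of its own N signs. If these signs have
    mean sin (x_i / T), the node has mean [sin_rescale T x]. *)
Definition flip_node (N : nat) (T : R) (w : {ffun 'I_d * 'I_N -> bool}) : 'rV[R]_d :=
  \row_i (T / N%:R * \sum_(q | q.1 == i) coin (w q)).

(* Bernstein approximation in the variables sin (x_i / T), written as an
   expectation over independent biased coin flips. *)
Lemma good_approx f (M T e : R) : continuous f -> (forall x, `|f x| <= M) ->
  0 < T -> 0 < e ->
  exists2 P, good X L P & forall x, `|f (sin_rescale T x) - P x| <= e.
Proof.
move=> fc fM T0 e0.
have [C C0 hC] := quadratic_modulus T fc fM (divr_gt0 e0 (ltr0Sn R 1)).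
(* The variance of a node is at most T^2 / N.+1 per coordinate; N makes C times the sum over the d
   coordinates at most e / 2. *)
have [N hN] : exists N : nat, C * d%:R * T ^+ 2 / (e / 2) <= N.+1%:R.
  exists (Num.Def.archi_bound (C * d%:R * T ^+ 2 / (e / 2))).
  apply: ltW; apply: lt_trans (archi_boundP _) _; last by rewrite ltr_nat.
  by apply: divr_ge0; [rewrite !mulr_ge0// ltW|rewrite ltW// divr_gt0].
pose p (x : 'rV[R]_d) (q : 'I_d * 'I_N.+1) := sin (T^-1 * x 0 q.1).
have p1 x q : `|p x q| <= 1 by exact: sin_norm_le1.
exists (fun x => \sum_w f (flip_node T w) * flip_weight (p x) w).
  apply: good_sum => w.
  rewrite [X in good _ _ X](_ : _ = (fun x : 'rV[R]_d => f (flip_node T w) *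
     \prod_q (1 / 2 + coin (w q) / 2 * sin (T^-1 * x 0 q.1)))).
    exact: (@good_prod_sin _ _ _ (fun=> T^-1) (fun=> 1 / 2) (fun q => coin (w q) / 2) fst).
  apply/funext => x; congr (_ * _); apply: eq_bigr => q _.
  by rewrite /p mulrDl mulrAC.
move=> x; set y := sin_rescale T x.
have yT i : `|y 0 i| <= T.
  by rewrite mxE normrM gtr0_norm// ler_piMr ?sin_norm_le1// ltW.
have -> : f y - \sum_w f (flip_node T w) * flip_weight (p x) w =
   \sum_w flip_weight (p x) w * (f y - f (flip_node T w)).
  rewrite -{1}[f y]mul1r -(flip_weight1 (p x)) mulr_suml -sumrB.
  by apply: eq_bigr => w _; ring.
apply: le_trans (ler_norm_sum _ _ _) _.
apply: (@le_trans _ _ (\sum_w flip_weight (p x) w * (e / 2 + C *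
    \sum_i (y 0 i - flip_node T w 0 i) ^+ 2))).
  apply: ler_sum => w _; rewrite normrM ger0_norm ?flip_weight_ge0//.
  by apply: ler_wpM2l; [exact: flip_weight_ge0|exact: hC].
under eq_bigr do rewrite mulrDr.
rewrite big_split/= -mulr_suml flip_weight1 mul1r.
suff : \sum_w flip_weight (p x) w * (C * \sum_i (y 0 i - flip_node T w 0 i) ^+ 2)
   <= C * (d%:R * (T ^+ 2 / N.+1%:R)).
  move=> h; have h2 : C * (d%:R * (T ^+ 2 / N.+1%:R)) <= e / 2.
    rewrite !mulrA ler_pdivrMr ?ltr0n// [e / 2 * _]mulrC -ler_pdivrMr ?divr_gt0//.
    by rewrite -[_ * T * T]mulrA.
  by have := le_trans h h2; lra.
have -> : \sum_w flip_weight (p x) w * (C * \sum_i (y 0 i - flip_node T w 0 i) ^+ 2)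
  = C * \sum_i \sum_w flip_weight (p x) w * (y 0 i - flip_node T w 0 i) ^+ 2.
  rewrite exchange_big/= mulr_sumr; apply: eq_bigr => w _.
  by rewrite mulrCA mulr_sumr.
apply: ler_wpM2l => //.
rewrite mulr_natl -[X in _ *+ X]card_ord -sumr_const; apply: ler_sum => i _.
pose A := [pred q : 'I_d * 'I_N.+1 | q.1 == i].
have cA : #|A| = N.+1.
  rewrite -sum1_card big_mkcond/=.
  rewrite -(pair_bigA _ (fun j (r : 'I_N.+1) => if j \in pred1 i then 1 else 0)%N)/=.
  rewrite (bigD1 i)//= inE eqxx sum1_card card_ord big1 ?addn0// => j ji.
  by rewrite big1// => r _; rewrite inE (negbTE ji).
have e1 w : (y 0 i - flip_node T w 0 i) ^+ 2 =
   (T / N.+1%:R) ^+ 2 * (\sum_(q in A) (coin (w q) - p x q)) ^+ 2.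
  rewrite -exprMn -sqrrN opprB; congr (_ ^+ 2).
  rewrite !mxE sumrB mulrBr; congr (_ - _).
  rewrite (eq_bigr (fun=> sin (T^-1 * x 0 i))) => [|q /eqP <-//].
  by rewrite sumr_const cA -mulr_natr; field.
under eq_bigr do rewrite e1 mulrCA.
rewrite -mulr_sumr.
apply: (@le_trans _ _ ((T / N.+1%:R) ^+ 2 * #|A|%:R)).
  by apply: ler_wpM2l; [exact: sqr_ge0|exact: flip_weight_var].
by rewrite cA le_eqVlt; apply/orP; left; apply/eqP; field.
Qed.
End Approximation.

(** * The cosine criterion *)

Section CriterionMain.
Context {R : realType} {d : nat}.
Variables (X : forall n, {perm 'I_n} -> 'rV[R]_d) (L : 'M[R]_d).
Local Notation EX n f := (permE (fun s => f (X (n := n) s))).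
Local Notation G f := (gauss_expect 0 L f).

Lemma gauss_expect_cos th b :
  G (fun x => cos (lin th x + b)) =
  expR (- (\sum_i (\sum_j th j * L i j) ^+ 2) / 2) * cos b.
Proof.
(* [gauss_int] works on infinite sequences, so the d coefficients are extended by 0. *)
pose c (i : nat) := if insub i is Some i' then \sum_j th j * L i' j else 0.
have cE (i : 'I_d) : c i = \sum_j th j * L i j by rewrite /c valK.
rewrite /gauss_expect.
have -> : (fun z : nat -> R => cos (lin th (0 + (\row_(j < d) z j) *m L) + b)) =
   (fun z => cos (\sum_(j < d) c j * z j + b)).
  apply/funext => z; congr (cos (_ + b)); rewrite add0r /lin.
  under eq_bigr do rewrite mxE mulr_sumr.
  rewrite exchange_big/=; apply: eq_bigr => i _; rewrite cE mulr_suml.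
  by apply: eq_bigr => j _; rewrite mxE; ring.
rewrite gauss_int_cos; congr (expR (- _ / 2) * _).
by apply: eq_bigr => i _; rewrite cE.
Qed.

Lemma cvg_sin_rescale (x : 'rV[R]_d) :
  sin_rescale (n.+1%:R) x @[n --> \oo] --> x.
Proof.
apply: cvg_rV => i; under eq_fun do rewrite mxE.
apply/cvgrPdist_le => e e0.
have h : (x 0 i ^+ 2 * n.+1%:R^-1) @[n --> \oo] --> (0 : R).
  by rewrite -(mulr0 (x 0 i ^+ 2)); apply: cvgMr; exact: cvg_harmonic.
have /cvgrPdist_le /(_ e e0) := h; apply: filterS => n.
rewrite sub0r normrN => hn; apply: le_trans hn; rewrite distrC.
set t := n.+1%:R; have t0 : 0 < t :> R by rewrite ltr0n.
have -> : t * sin (t^-1 * x 0 i) - x 0 i = t * (sin (t^-1 * x 0 i) - t^-1 * x 0 i).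
  by field; rewrite gt_eqF.
rewrite normrM gtr0_norm//; apply: le_trans (ler_wpM2l (ltW t0) (sin_sub_id_le _)) _.
apply: le_trans _ (ler_norm _); rewrite le_eqVlt; apply/orP; left; apply/eqP.
by field; rewrite gt_eqF.
Qed.

Lemma sin_rescale_dist (t : R) (x : 'rV[R]_d) i : 0 < t ->
  (x 0 i - sin_rescale t x 0 i) ^+ 2 <= (x 0 i ^+ 2 / t) ^+ 2.
Proof.
move=> t0; rewrite -real_normK ?num_real// lerXn2r ?nnegrE//.
  by rewrite divr_ge0 ?sqr_ge0// ltW.
rewrite mxE distrC.
have -> : t * sin (t^-1 * x 0 i) - x 0 i = t * (sin (t^-1 * x 0 i) - t^-1 * x 0 i).
  by field; rewrite gt_eqF.
rewrite normrM gtr0_norm//; apply: le_trans (ler_wpM2l (ltW t0) (sin_sub_id_le _)) _.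
by rewrite le_eqVlt; apply/orP; left; apply/eqP; field; rewrite gt_eqF.
Qed.

(* Outside the cube of side T0 the trivial bound 2 M is absorbed by the last term. *)
Lemma rescale_dist_le (f : 'rV[R]_d -> R) (M e T0 : R) : continuous f ->
  (forall x, `|f x| <= M) -> 0 < e -> 1 <= T0 ->
  exists2 C, 0 <= C & forall t x, 1 <= t ->
    `|f x - f (sin_rescale t x)| <= e + C / t + 2 * M / T0 * \sum_i x 0 i ^+ 2.
Proof.
move=> fc fM e0 T1.
have M0 : 0 <= M by exact: le_trans (fM 0).
have [C C0 hC] := quadratic_modulus T0 fc fM e0.
have S0 (x : 'rV[R]_d) : 0 <= \sum_i x 0 i ^+ 2 by apply: sumr_ge0 => i _; exact: sqr_ge0.
have T00 : 0 < T0 by apply: lt_le_trans T1.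
have [K4 K4E] : {K4 | K4 = T0 ^+ 4} by exists (T0 ^+ 4).
have K0 : 0 <= C * d%:R * K4.
  by rewrite K4E; apply: mulr_ge0; [exact: mulr_ge0|exact/exprn_ge0/ltW].
exists (C * d%:R * K4) => //.
move=> t x t1; have t0 : 0 < t by apply: lt_le_trans t1.
have [/forallP xT|] := boolP [forall i, `|x 0 i| <= T0].
  apply: le_trans (hC x (sin_rescale t x) xT) _.
  rewrite -addrA lerD2l; apply: (@le_trans _ _ (C * d%:R * K4 / t)); last first.
    by rewrite lerDl mulr_ge0// divr_ge0 ?mulr_ge0// ltW.
  rewrite -!mulrA ler_wpM2l// mulr_natl -[X in _ *+ X]card_ord -sumr_const.
  apply: ler_sum => i _; apply: le_trans (sin_rescale_dist x i t0) _.
  rewrite expr_div_n -exprM; apply: ler_pM.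
  - by rewrite exprn_even_ge0.
  - by rewrite invr_ge0 exprn_ge0// ltW.
  - have -> : x 0 i ^+ (2 * 2) = `|x 0 i| ^+ 4.
      by rewrite -normrX ger0_norm// exprn_even_ge0.
    rewrite K4E; by rewrite lerXn2r ?nnegrE ?(ltW T00).
  - by rewrite lef_pV2 ?posrE ?exprn_gt0// ler_eXnr.
rewrite negb_forall => /existsP[i]; rewrite -ltNge => xi.
apply: (@le_trans _ _ (2 * M)).
  apply: le_trans (ler_normB _ _) _; have := fM x; have := fM (sin_rescale t x); lra.
apply: (@le_trans _ _ (2 * M / T0 * \sum_i x 0 i ^+ 2)); last first.
  by rewrite lerDr addr_ge0 ?(ltW e0)// divr_ge0// ltW.
rewrite -mulrA ler_peMr ?mulr_ge0// mulrC ler_pdivlMr// mul1r (bigD1 i)//=.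
apply: (@le_trans _ _ (x 0 i ^+ 2)); last first.
  by rewrite lerDl; apply: sumr_ge0 => j _; exact: sqr_ge0.
rewrite -real_normK ?num_real//; apply: (@le_trans _ _ `|x 0 i|); first exact: ltW.
by rewrite ler_eXnr//; apply: le_trans (ltW xi).
Qed.

Theorem cvg_dist_gauss_cos (C : R) :
  (\forall n \near \oo, forall i, EX n (fun x => x 0 i ^+ 2) <= C) ->
  (forall th b, (fun n => EX n (fun x => cos (lin th x + b))) @ \oo -->
     expR (- (\sum_i (\sum_j th j * L i j) ^+ 2) / 2) * cos b) ->
  cvg_dist_gauss X 0 L.
Proof.
move=> tight hcos f fc [M fM].
have M0 : 0 <= M by exact: le_trans (fM 0).
have good1 : good X L (fun=> 1).
  split; [exact: continuous_cstf|by exists 1 => x; rewrite normr1|move=> th b].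
  rewrite [X in X @ _ --> _](_ : _ = (fun n => EX n (fun x => cos (lin th x + b)))); last first.
    by apply/funext => n; apply: eq_permE => s; rewrite mul1r.
  rewrite [X in _ --> X](_ : _ = G (fun x => cos (lin th x + b))); last first.
    by congr gauss_expect; apply/funext => x; rewrite mul1r.
  by rewrite gauss_expect_cos.
have c0 n : (\forall m \near \oo, (n <= m)%N) by exact: nbhs_infty_ge.
apply/cvgrPdist_le => e' e'0.
(* The closing triangle inequality has four pieces of size e and one of size 3 e, the latter from
   the three terms of [rescale_dist_le]. *)
pose e := e' / 7; have e0 : 0 < e by rewrite divr_gt0.
have C0 : 0 <= `|C| by [].
(* Large enough that coordinate second moments below [|C|] bring the term with 2 M / T0 under e. *)
pose T0 := 1 + 2 * M * d%:R * `|C| / e.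
have T01 : 1 <= T0 by rewrite lerDl; apply: divr_ge0; [rewrite !mulr_ge0|exact: ltW].
have T00 : 0 < T0 by apply: lt_le_trans T01.
have [C1 C10 hC1] := rescale_dist_le fc fM e0 T01.
have hG : (fun n => G (fun x => f (sin_rescale n.+1%:R x))) @ \oo --> G f.
  apply: (@gauss_int_cvg _ _ _ _ M) => [n||z].
  - apply: (@bcont_rV _ _ L (fun x => f (sin_rescale n.+1%:R x)) M) => //.
    by move=> x; apply: continuous_comp; [exact: sin_rescale_continuous|exact: fc].
  - exact: bcont_rV.
  - by apply: continuous_cvg; [exact: fc|exact: cvg_sin_rescale].
(* The scale m is fixed before n: it serves the Gaussian side, and the permutation side uniformly in
   n. *)
have [m [hm1 hm2]] : exists m : nat, `|G f - G (fun x => f (sin_rescale m.+1%:R x))| <= e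
   /\ C1 / m.+1%:R <= e.
  near \oo => m; exists m; split.
    by near: m; have /cvgrPdist_le /(_ e e0) := hG.
  near: m; have h : (C1 * m.+1%:R^-1) @[m --> \oo] --> (0 : R).
    by rewrite -(mulr0 C1); apply: cvgMr; exact: cvg_harmonic.
  have /cvgrPdist_le /(_ e e0) := h; apply: filterS => n.
  by rewrite sub0r normrN; apply: le_trans; exact: ler_norm.
pose fm x := f (sin_rescale m.+1%:R x).
have fmc : continuous fm.
  by move=> x; apply: continuous_comp; [exact: sin_rescale_continuous|exact: fc].
have [P gP hP] := good_approx good1 fc fM (ltr0Sn R m) e0.
have /cvgrPdist_le /(_ e e0) hPn := good_cvg gP.
have GP : `|G fm - G P| <= e.
  have [Pc _ _] := gP.
  exact: (gauss_expect_dist L fmc (fun x => fM _) Pc hP).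
near=> n.
have tn : forall i, EX n (fun x => x 0 i ^+ 2) <= C by near: n.
have Pn : `|G P - EX n P| <= e by near: n.
have h1 : `|EX n f - EX n fm| <= 3 * e.
  apply: le_trans (permE_norm_dist _ _) _.
  apply: (@le_trans _ _ (permE (fun s => e + C1 / m.+1%:R + 2 * M / T0 * \sum_i (X (n := n) s) 0 i ^+ 2))).
    by apply: permE_le => s; apply: hC1; rewrite ler1n.
  rewrite permED permE_cst permEZ permE_sum.
  have : 2 * M / T0 * \sum_i permE (fun s => (X (n := n) s) 0 i ^+ 2) <= e.
    apply: (@le_trans _ _ (2 * M / T0 * (d%:R * `|C|))).
      apply: ler_wpM2l; first by rewrite divr_ge0 ?mulr_ge0// ltW.
      rewrite mulr_natl -[X in _ *+ X]card_ord -sumr_const; apply: ler_sum => i _.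
      by apply: le_trans (tn i) _; exact: ler_norm.
    rewrite mulrAC ler_pdivrMr// mulrDr mulr1 [e * _]mulrC divfK ?gt_eqF//.
    by rewrite !mulrA lerDr ltW.
  by move=> h; apply: le_trans (lerD (lerD (lexx e) hm2) h) _; lra.
have h2 : `|EX n fm - EX n P| <= e.
  apply: le_trans (permE_norm_dist _ _) _.
  by rewrite -[leRHS](@permE_cst R n); apply: permE_le => s; exact: hP.
have -> : G f - EX n f = (G f - G fm) + (G fm - G P) + (G P - EX n P)
  - (EX n fm - EX n P) - (EX n f - EX n fm) by ring.
have := ler_normB ((G f - G fm) + (G fm - G P) + (G P - EX n P) - (EX n fm - EX n P)) (EX n f - EX n fm).
have := ler_normB ((G f - G fm) + (G fm - G P) + (G P - EX n P)) (EX n fm - EX n P).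
have := ler_normD ((G f - G fm) + (G fm - G P)) (G P - EX n P).
have := ler_normD (G f - G fm) (G fm - G P).
have e7 : e' = 7 * e by rewrite /e; field.
by move: hm1 GP Pn h1 h2; rewrite -/fm e7; lra.
Unshelve. all: by end_near. Qed.
End CriterionMain.

(** * Stein's method by random transpositions *)

Section Swap.
Context {R : realType} {n : nat}.
Implicit Types (s : {perm 'I_n}) (y z b v u : 'I_n -> R) (c : 'I_n -> 'I_n -> R).

(** The transposition acts on observations before s assigns positions, so i and j exchange their
    positions. *)
Definition sw (i j : 'I_n) s : {perm 'I_n} := (tperm i j * s)%g.

Lemma swE i j s l : sw i j s l = s (tperm i j l).
Proof. by rewrite /sw permM. Qed.

Lemma sw_left i j s : sw i j s i = s j. Proof. by rewrite swE tpermL. Qed.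

Lemma sw_right i j s : sw i j s j = s i. Proof. by rewrite swE tpermR. Qed.

Lemma permE_sw i j (f : {perm 'I_n} -> R) :
  permE (fun s => f (sw i j s)) = permE f.
Proof.
rewrite /permE; congr (_ * _); rewrite [RHS](reindex_inj (mulgI (tperm i j))).
by [].
Qed.

Lemma sum_perm y s : \sum_i y (s i) = \sum_p y p.
Proof. by rewrite [RHS](reindex_inj (@perm_inj _ s)). Qed.

Lemma swap_stein y i (F : {perm 'I_n} -> R) : \sum_p y p = 0 ->
  n%:R * permE (fun s => y (s i) * F s) =
  permE (fun s => \sum_j y (s j) * (F (sw i j s) - F s)).
Proof.
move=> y0; transitivity (\sum_j permE (fun s => y (s j) * F (sw i j s))).
  rewrite (eq_bigr (fun=> permE (fun s => y (s i) * F s))).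
    by rewrite sumr_const card_ord mulr_natl.
  move=> j _; rewrite -(permE_sw i j (fun s => y (s i) * F s)).
  by apply: eq_permE => s; rewrite sw_left.
rewrite -permE_sum; apply: eq_permE => s.
under [RHS]eq_bigr do rewrite mulrBr.
by rewrite sumrB -mulr_suml sum_perm y0 mul0r subr0.
Qed.

(** It vanishes for i = j, so the increment formulas below hold for all i and j without case
    distinction. *)
Definition dlt (i j l : 'I_n) : R := (l == i)%:R - (l == j)%:R.

Lemma sum_delta v i : \sum_l v l * (l == i)%:R = v i.
Proof.
rewrite (bigD1 i)//= eqxx mulr1 big1 ?addr0// => l /negbTE ->.
by rewrite mulr0.
Qed.

Lemma sum_dlt v i j : \sum_l v l * dlt i j l = v i - v j.
Proof.
under eq_bigr do rewrite mulrBr.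
by rewrite sumrB !sum_delta.
Qed.

Lemma swap_value y i j s l :
  y (sw i j s l) = y (s l) + (y (s j) - y (s i)) * dlt i j l.
Proof.
rewrite swE /dlt; case: tpermP => [->|->|/eqP/negbTE -> /eqP/negbTE ->].
- by rewrite eqxx; case: eqP => [->|_]/=; ring.
- by rewrite eqxx; case: eqP => [->|_]/=; ring.
- by rewrite subrr mulr0 addr0.
Qed.

Definition lstat b y s := \sum_l b l * y (s l).

Lemma lstat_sw b y i j s :
  lstat b y (sw i j s) = lstat b y s + (y (s j) - y (s i)) * (b i - b j).
Proof.
rewrite /lstat -[b i - b j]sum_dlt mulr_sumr -big_split; apply: eq_bigr => l _.
by rewrite swap_value /=; ring.
Qed.

Definition bstat c y z s := \sum_l y (s l) * lstat (c l) z s.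

(** The last term is the second-order one: the sum of c l m * dlt i j l * dlt i j m over l and m
    reduces to - (c i j + c j i) when the diagonal is zero. *)
Lemma bstat_sw c y z i j s : (forall l, c l l = 0) ->
  bstat c y z (sw i j s) = bstat c y z s
  + (y (s j) - y (s i)) * (lstat (c i) z s - lstat (c j) z s)
  + (z (s j) - z (s i)) * (lstat (fun k => c k i) y s - lstat (fun k => c k j) y s)
  - (y (s j) - y (s i)) * (z (s j) - z (s i)) * (c i j + c j i).
Proof.
move=> c0.
have e1 : bstat c y z (sw i j s) = \sum_l y (s l) * lstat (c l) z (sw i j s)
   + (y (s j) - y (s i)) * (lstat (c i) z (sw i j s) - lstat (c j) z (sw i j s)).
  rewrite -[_ - lstat (c j) _ _](sum_dlt (fun l => lstat (c l) z (sw i j s))).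
  rewrite mulr_sumr -big_split; apply: eq_bigr => l _.
  by rewrite swap_value /=; ring.
rewrite e1 !lstat_sw !c0.
have -> : \sum_l y (s l) * lstat (c l) z (sw i j s) = bstat c y z s +
   (z (s j) - z (s i)) * (lstat (fun k => c k i) y s - lstat (fun k => c k j) y s).
  rewrite /lstat -sumrB mulr_sumr /bstat -big_split; apply: eq_bigr => l _.
  by rewrite -!/(lstat _ _ _) lstat_sw /=; ring.
by ring.
Qed.

Lemma sum2_prod (f g : 'I_n -> R) : \sum_i \sum_j f i * g j = (\sum_i f i) * (\sum_j g j).
Proof. by rewrite mulr_suml; apply: eq_bigr => i _; rewrite mulr_sumr. Qed.

(** The common shape of all first-order Stein coefficients. Expansion gives four products, and the
    one containing the bare sum of y is zero. *)
Lemma swap_form (f g y z : 'I_n -> R) : \sum_l y l = 0 ->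
  \sum_i \sum_j f i * y j * ((z j - z i) * (g i - g j)) =
  (\sum_l f l * g l) * (\sum_l y l * z l) - (\sum_l f l) * (\sum_l g l * (y l * z l))
  + (\sum_l f l * z l) * (\sum_l g l * y l).
Proof.
move=> y0.
transitivity (\sum_i \sum_j ((f i * g i) * (y j * z j) - f i * (g j * (y j * z j))
   - (f i * g i * z i) * y j + (f i * z i) * (g j * y j))).
  by apply: eq_bigr => i _; apply: eq_bigr => j _; ring.
under eq_bigr do rewrite big_split/= !sumrB.
by rewrite big_split/= !sumrB !sum2_prod y0 mulr0 subr0.
Qed.

(** The Stein identity with F = [lstat a z] returns the main term plus the left-hand expectation
    itself; moving it across turns n into n - 1. *)
Lemma lstat_cov a y z : \sum_l a l = 0 -> \sum_p y p = 0 ->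
  (n%:R - 1) * permE (fun s => lstat a y s * lstat a z s) =
  (\sum_l a l ^+ 2) * (\sum_p y p * z p).
Proof.
move=> a0 y0.
have e : n%:R * permE (fun s => lstat a y s * lstat a z s) =
   permE (fun s => (\sum_l a l ^+ 2) * (\sum_p y p * z p) + lstat a z s * lstat a y s).
  transitivity (\sum_i a i * (n%:R * permE (fun s => y (s i) * lstat a z s))).
    under eq_bigr do rewrite mulrCA -permEZ.
    rewrite -mulr_sumr -permE_sum; congr (_ * _); apply: eq_permE => s.
    by rewrite /lstat mulr_suml; apply: eq_bigr => i _; ring.
  under eq_bigr do rewrite (swap_stein _ _ y0) -permEZ.
  rewrite -permE_sum; apply: eq_permE => s.
  transitivity (\sum_i \sum_j a i * y (s j) * ((z (s j) - z (s i)) * (a i - a j))).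
    apply: eq_bigr => i _; rewrite mulr_sumr; apply: eq_bigr => j _.
    by rewrite lstat_sw; ring.
  rewrite (@swap_form a a (fun l => y (s l)) (fun l => z (s l))) ?sum_perm//.
  rewrite a0 mul0r subr0; congr (_ * _ + _).
  exact: (sum_perm (fun p => y p * z p)).
rewrite mulrBl e permED permE_cst mul1r.
rewrite (_ : permE (fun s => lstat a z s * lstat a y s) = permE (fun s => lstat a y s * lstat a z s)).
  by rewrite addrK.
by apply: eq_permE => s; rewrite mulrC.
Qed.

(** Centring b leaves the statistic unchanged, because y sums to zero, and can only decrease the sum
    of squares. The factor 2 bounds n / (n - 1). *)
Lemma lstat_var b y : (1 < n)%N -> \sum_p y p = 0 -> (forall p, `|y p| <= 1) ->
  permE (fun s => lstat b y s ^+ 2) <= 2 * \sum_l b l ^+ 2.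
Proof.
move=> n1 y0 y1.
have n0 : n%:R != 0 :> R by rewrite pnatr_eq0 -lt0n ltnW.
pose m := (\sum_l b l) / n%:R; pose a l := b l - m.
have a0 : \sum_l a l = 0.
  by rewrite sumrB sumr_const card_ord -mulr_natr divfK// subrr.
have ab : \sum_l a l ^+ 2 <= \sum_l b l ^+ 2.
  have -> : \sum_l a l ^+ 2 = \sum_l (b l ^+ 2 - 2 * m * b l + m ^+ 2).
    by apply: eq_bigr => l _; rewrite /a; ring.
  rewrite big_split sumrB/= -mulr_sumr sumr_const card_ord -mulr_natr.
  have -> : \sum_l b l = m * n%:R by rewrite divfK.
  have := mulr_ge0 (sqr_ge0 m) (ler0n R n); nra.
have las s : lstat b y s = lstat a y s.
  rewrite /lstat /a; under [RHS]eq_bigr do rewrite mulrBl.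
  by rewrite sumrB -mulr_sumr sum_perm y0 mulr0 subr0.
have -> : permE (fun s => lstat b y s ^+ 2) = permE (fun s => lstat a y s * lstat a y s).
  by apply: eq_permE => s; rewrite las expr2.
have := lstat_cov y a0 y0.
have n2 : 2 <= n%:R :> R by rewrite (ler_nat _ 2).
have Y2 : \sum_p y p * y p <= n%:R.
  rewrite -[n in leRHS]card_ord -sum1_card natr_sum; apply: ler_sum => p _.
  by rewrite -expr2 -real_normK ?num_real// exprn_ile1.
have S0 : 0 <= \sum_l a l ^+ 2 by apply: sumr_ge0 => l _; exact: sqr_ge0.
have E0 : 0 <= permE (fun s => lstat a y s * lstat a y s).
  by apply: permE_ge0 => s; rewrite -expr2 sqr_ge0.
move: (permE _) (\sum_l a l ^+ 2) (\sum_l b l ^+ 2) (\sum_p y p * y p) ab Y2 S0 E0.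
move=> E A B Y AB Yn A0 E0 eq.
suff : (n%:R - 1) * E <= (n%:R - 1) * (2 * B) by rewrite ler_pM2l// subr_gt0 (ltr_nat _ 1).
rewrite eq; nra.
Qed.
End Swap.

(** * Cauchy-Schwarz inequalities *)

Section CauchySchwarz.
Context {R : realType}.

Lemma sum_CS (I : finType) (f g : I -> R) :
  (\sum_i f i * g i) ^+ 2 <= (\sum_i f i ^+ 2) * (\sum_i g i ^+ 2).
Proof.
have h : 0 <= \sum_i \sum_j (f i * g j - f j * g i) ^+ 2.
  by apply: sumr_ge0 => i _; apply: sumr_ge0 => j _; exact: sqr_ge0.
have e : \sum_i \sum_j (f i * g j - f j * g i) ^+ 2 =
   2 * ((\sum_i f i ^+ 2) * (\sum_i g i ^+ 2)) - 2 * (\sum_i f i * g i) ^+ 2.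
  transitivity (\sum_i \sum_j (f i ^+ 2 * g j ^+ 2 + g i ^+ 2 * f j ^+ 2
     - 2 * (f i * g i) * (f j * g j))).
    by apply: eq_bigr => i _; apply: eq_bigr => j _; ring.
  have sp (u v : I -> R) : \sum_i \sum_j u i * v j = (\sum_i u i) * (\sum_j v j).
    by rewrite mulr_suml; apply: eq_bigr => i _; rewrite mulr_sumr.
  under eq_bigr do rewrite sumrB big_split/=.
  by rewrite sumrB big_split/= !sp -mulr_sumr; ring.
by move: h; rewrite e; lra.
Qed.

Lemma sum_sqr_le (I : finType) (f : I -> R) :
  (\sum_i f i) ^+ 2 <= #|I|%:R * \sum_i f i ^+ 2.
Proof.
have := sum_CS (fun=> 1) f; rewrite sumr_const expr1n -[1 *+ _]mulr_natl mulr1.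
by under eq_bigr do rewrite mul1r.
Qed.

Lemma sum_cst_ord n (x : R) : \sum_(j < n) x = n%:R * x.
Proof. by rewrite sumr_const card_ord mulr_natl. Qed.

Lemma permE_CS n (f g : {perm 'I_n} -> R) :
  permE (fun s => f s * g s) ^+ 2 <= permE (fun s => f s ^+ 2) * permE (fun s => g s ^+ 2).
Proof.
by rewrite /permE exprMn [leRHS]mulrACA -expr2 ler_wpM2l ?sqr_ge0 ?sum_CS.
Qed.

Lemma permE_CS_le n (f g : {perm 'I_n} -> R) (A B : R) : 0 <= A -> 0 <= B ->
  permE (fun s => f s ^+ 2) <= A ^+ 2 -> permE (fun s => g s ^+ 2) <= B ^+ 2 ->
  permE (fun s => `|f s * g s|) <= A * B.
Proof.
move=> A0 B0 hf hg.
have -> : permE (fun s => `|f s * g s|) = permE (fun s => `|f s| * `|g s|).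
  by apply: eq_permE => s; rewrite normrM.
have E0 : 0 <= permE (fun s => `|f s| * `|g s|).
  by apply: permE_ge0 => s; rewrite mulr_ge0.
suff : permE (fun s => `|f s| * `|g s|) ^+ 2 <= (A * B) ^+ 2.
  by rewrite ler_sqr ?nnegrE// mulr_ge0.
rewrite [leRHS]exprMn.
apply: le_trans (permE_CS _ _) _.
have e (k : {perm 'I_n} -> R) : permE (fun s => `|k s| ^+ 2) = permE (fun s => k s ^+ 2).
  by apply: eq_permE => s; rewrite real_normK ?num_real.
by rewrite !e; apply: ler_pM => //; apply: permE_ge0 => s; exact: sqr_ge0.
Qed.

Lemma permE_norm_le n (f : {perm 'I_n} -> R) (A : R) : 0 <= A ->
  permE (fun s => f s ^+ 2) <= A ^+ 2 -> permE (fun s => `|f s|) <= A.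
Proof.
move=> A0 hf; have := @permE_CS_le n f (fun=> 1) A 1 A0 ler01 hf.
rewrite (_ : permE (fun=> _) = 1 ^+ 2); last by rewrite permE_cst !expr1n.
rewrite mulr1 => /(_ (lexx _)).
by under eq_permE do rewrite mulr1.
Qed.
End CauchySchwarz.

(** * Bilinear permutation statistics *)

Section Bilinear.
Context {R : realType} {n : nat}.
Variables (c : 'I_n -> 'I_n -> R) (y z : 'I_n -> R).
Hypotheses (n1 : (1 < n)%N) (c0 : forall l, c l l = 0)
  (y0 : \sum_p y p = 0) (z0 : \sum_p z p = 0)
  (y1 : forall p, `|y p| <= 1) (z1 : forall p, `|z p| <= 1).
Let H i s := lstat (c i) z s.
Let K i s := lstat (fun k => c k i) y s.
Let B s := bstat c y z s.
Let Rem (s : {perm 'I_n}) := \sum_i \sum_j c i j * (y (s i) * (z (s i) - z (s j))).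

(** The swap also changes [H i], through the weight c i j. Undoing the swap in this extra term
    leaves F unswapped there, multiplied by [Rem]. *)
Lemma bstat_stein (F : {perm 'I_n} -> R) :
  n%:R * permE (fun s => bstat c y z s * F s) =
  permE (fun s => \sum_i \sum_j y (s j) * H i s * (F (sw i j s) - F s))
  - permE (fun s => Rem s * F s).
Proof.
transitivity (\sum_i n%:R * permE (fun s => y (s i) * (H i s * F s))).
  rewrite -mulr_sumr -permE_sum; congr (_ * _); apply: eq_permE => s.
  by rewrite /bstat mulr_suml; apply: eq_bigr => i _; rewrite /H mulrA.
under eq_bigr do rewrite (swap_stein _ _ y0).
have e i : permE (fun s => \sum_j y (s j) * (H i (sw i j s) * F (sw i j s) - H i s * F s)) =
  permE (fun s => \sum_j y (s j) * H i s * (F (sw i j s) - F s)) -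
  permE (fun s => \sum_j c i j * (y (s i) * (z (s i) - z (s j))) * F s).
  rewrite !permE_sum -sumrB; apply: eq_bigr => j _.
  rewrite -(permE_sw i j (fun s => c i j * (y (s i) * (z (s i) - z (s j))) * F s)).
  rewrite -permEB; apply: eq_permE => s.
  by rewrite sw_left sw_right /H lstat_sw c0; ring.
under eq_bigr do rewrite e.
rewrite sumrB -!permE_sum; congr (_ - _); apply: eq_permE => s.
rewrite /Rem mulr_suml; apply: eq_bigr => i _.
by rewrite mulr_suml.
Qed.

Lemma bstat_rem_sqr s : Rem s ^+ 2 <= 4 * n%:R ^+ 2 * \sum_i \sum_j c i j ^+ 2.
Proof.
rewrite /Rem pair_bigA/= [\sum_i \sum_j _]pair_bigA/=.
apply: le_trans (sum_sqr_le _) _.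
rewrite card_prod card_ord natrM -expr2 mulr_sumr mulr_sumr; apply: ler_sum => p _.
have := y1 (s p.1); have := z1 (s p.1); have := z1 (s p.2); rewrite !ler_norml.
move: (y _) (z _) (z _) (c _ _) => a b d e hb hd ha.
rewrite exprMn mulrA [leRHS](_ : _ = n%:R ^+ 2 * e ^+ 2 * 4); last by ring.
apply: ler_wpM2l; first by rewrite mulr_ge0// sqr_ge0.
have -> : 4 = 1 ^+ 2 * 2 ^+ 2 :> R by ring.
rewrite exprMn; apply: ler_pM; rewrite ?sqr_ge0//.
  by rewrite -real_normK ?num_real// lerXn2r ?nnegrE// ler_norml.
rewrite -real_normK ?num_real// lerXn2r ?nnegrE// ler_norml; lra.
Qed.

Lemma mul_le_sqrD (p u v : R) : `|p| <= 2 -> p * (u * v) <= u ^+ 2 + v ^+ 2.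
Proof.
move=> p2; apply: le_trans (ler_norm _) _; rewrite !normrM.
apply: (@le_trans _ _ (2 * (`|u| * `|v|))).
  by apply: ler_wpM2r => //; rewrite mulr_ge0.
rewrite -[u ^+ 2]real_normK ?num_real// -[v ^+ 2]real_normK ?num_real//.
by have := sqr_ge0 (`|u| - `|v|); nra.
Qed.

(** Each product of [H i s] with a part of the increment is split by [mul_le_sqrD]; the last one
    counts twice, so the square of [H i s] occurs 2 + 1 + 1 + 1 + 2 = 7 times. *)
Lemma bstat_incr_le i j (s : {perm 'I_n}) :
  y (s j) * H i s * (B (sw i j s) - B s) <= 7 * H i s ^+ 2 + H j s ^+ 2
   + K i s ^+ 2 + K j s ^+ 2 + 4 * c i j ^+ 2 + 4 * c j i ^+ 2.
Proof.
rewrite /B bstat_sw// -/(H i s) -/(H j s) -/(K i s) -/(K j s).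
have hy := y1 (s j); have hyi := y1 (s i); have hz := z1 (s j); have hzi := z1 (s i).
move: (y (s j)) (y (s i)) (z (s j)) (z (s i)) hy hyi hz hzi (bstat _ _ _ _) (H i s) (H j s) (K i s) (K j s) (c i j) (c j i).
move=> a a' b b' ha ha' hb hb' B0 h h' k k' e e'.
have hp : `|a * (a - a')| <= 2.
  rewrite normrM -[2]mul1r; apply: ler_pM => //.
  by apply: le_trans (ler_normB _ _) _; rewrite (_ : 2 = 1 + 1)// lerD.
have hq : `|a * (b - b')| <= 2.
  rewrite normrM -[2]mul1r; apply: ler_pM => //.
  by apply: le_trans (ler_normB _ _) _; rewrite (_ : 2 = 1 + 1)// lerD.
have hr : `|a * (a - a') * ((b - b') / 2)| <= 2.
  rewrite normrM -[leRHS]mulr1; apply: ler_pM => //.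
  rewrite normrM [`|2^-1|]ger0_norm// ler_pdivrMr// mul1r.
  by apply: le_trans (ler_normB _ _) _; rewrite (_ : 2 = 1 + 1)// lerD.
have h1 := mul_le_sqrD h h hp.
have h2 := mul_le_sqrD h (- h') hp.
have h3 := mul_le_sqrD h k hq.
have h4 := mul_le_sqrD h (- k') hq.
have h5 := mul_le_sqrD h (- (e + e')) hr.
rewrite !sqrrN in h2 h4 h5.
have h6 : (e + e') ^+ 2 <= 2 * e ^+ 2 + 2 * e' ^+ 2.
  by have := sqr_ge0 (e - e'); nra.
have -> : a * h * (B0 + (a - a') * (h - h') + (b - b') * (k - k') - (a - a') * (b - b') * (e + e') - B0)
  = a * (a - a') * (h * h) + a * (a - a') * (h * - h') + a * (b - b') * (h * k)
   + a * (b - b') * (h * - k') + 2 * (a * (a - a') * ((b - b') / 2) * (h * - (e + e'))).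
  by field.
move: h1 h2 h3 h4 h5 h6; lra.
Qed.

Lemma sum_lstat_var (d : 'I_n -> 'I_n -> R) (x : 'I_n -> R) :
  \sum_p x p = 0 -> (forall p, `|x p| <= 1) ->
  permE (fun s => \sum_i lstat (d i) x s ^+ 2) <= 2 * \sum_i \sum_j d i j ^+ 2.
Proof.
by move=> x0 x1; rewrite permE_sum mulr_sumr; apply: ler_sum => i _; exact: lstat_var.
Qed.

(** A self-bounding argument: [bstat_stein] with F the statistic itself. Young's inequality absorbs
    half of n E[B^2] from the [Rem] term, and 60 = 2 (28 + 2). *)
Lemma bstat_var :
  permE (fun s => bstat c y z s ^+ 2) <= 60 * \sum_i \sum_j c i j ^+ 2.
Proof.
set C2 := \sum_i \sum_j c i j ^+ 2.
have C20 : 0 <= C2 by apply: sumr_ge0 => i _; apply: sumr_ge0 => j _; exact: sqr_ge0.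
have n0 : 0 < n%:R :> R by rewrite ltr0n ltnW.
have n1' : 1 <= n%:R :> R by rewrite ler1n ltnW.
have C2T : \sum_i \sum_j c j i ^+ 2 = C2 by rewrite exchange_big.
have := bstat_stein B; rewrite -/B.
have -> : permE (fun s => B s * B s) = permE (fun s => B s ^+ 2) by [].
have hR : - permE (fun s => Rem s * B s) <= n%:R / 2 * permE (fun s => B s ^+ 2) + 2 * n%:R * C2.
  rewrite -permEN -permEZ -[2 * n%:R * C2](@permE_cst R n) -permED.
  apply: permE_le => s; have := bstat_rem_sqr s; rewrite -/C2.
  move: (Rem s) (B s) => r b hr.
  have := sqr_ge0 (n%:R * b + r); rewrite sqrrD => h.
  have h' : 2 * n%:R * (- (r * b)) <= 2 * n%:R * (n%:R / 2 * b ^+ 2 + 2 * n%:R * C2).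
    apply: (@le_trans _ _ ((n%:R * b) ^+ 2 + r ^+ 2)).
      by rewrite mulrN -subr_ge0 opprK; move: h; nra.
    apply: (@le_trans _ _ ((n%:R * b) ^+ 2 + 4 * n%:R ^+ 2 * C2)); first by rewrite lerD2l.
    by rewrite le_eqVlt; apply/orP; left; apply/eqP; field.
  by rewrite ler_pM2l ?mulr_gt0// in h'.
have hM : permE (fun s => \sum_i \sum_j y (s j) * H i s * (B (sw i j s) - B s)) <= 28 * n%:R * C2.
  apply: (@le_trans _ _ (permE (fun s => \sum_i \sum_j (7 * H i s ^+ 2 + H j s ^+ 2
     + K i s ^+ 2 + K j s ^+ 2 + 4 * c i j ^+ 2 + 4 * c j i ^+ 2)))).
    by apply: permE_le => s; apply: ler_sum => i _; apply: ler_sum => j _; exact: bstat_incr_le.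
  have -> : permE (fun s => \sum_i \sum_j (7 * H i s ^+ 2 + H j s ^+ 2
     + K i s ^+ 2 + K j s ^+ 2 + 4 * c i j ^+ 2 + 4 * c j i ^+ 2)) =
     8 * n%:R * permE (fun s => \sum_i H i s ^+ 2) + 2 * n%:R * permE (fun s => \sum_i K i s ^+ 2)
     + 8 * C2.
    rewrite -!permEZ -[8 * C2](@permE_cst R n) -!permED; apply: eq_permE => s.
    under eq_bigr do rewrite !big_split/= !sum_cst_ord -!mulr_sumr.
    rewrite !big_split/= !sum_cst_ord -!mulr_sumr -/C2 C2T.
    by ring.
  have hH := sum_lstat_var c z0 z1; have hK := sum_lstat_var (fun i k => c k i) y0 y1.
  rewrite C2T -/C2 in hK; rewrite -/C2 in hH.
  apply: (@le_trans _ _ (8 * n%:R * (2 * C2) + 2 * n%:R * (2 * C2) + 8 * (n%:R * C2))).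
    apply: lerD; [apply: lerD|].
    - by apply: ler_wpM2l => //; rewrite mulr_ge0.
    - by apply: ler_wpM2l => //; rewrite mulr_ge0.
    - by apply: ler_wpM2l => //; rewrite ler_peMl.
  by rewrite le_eqVlt; apply/orP; left; apply/eqP; ring.
move=> e; have := lerD hM hR; rewrite -e.
move: (permE _) => E h.
have : n%:R * E <= n%:R * (60 * C2) by nra.
by rewrite ler_pM2l.
Qed.
End Bilinear.

(** * Moment bounds under the Stein hypotheses *)

Section PairBounds.
Context {R : realType} {n : nat}.
Variables (a : 'I_n -> R) (h : 'I_n -> 'I_n -> R) (del : R).
Definition hdeg i : R := \sum_j h i j.
Definition rho i : R := \sum_j h i j ^+ 2.
Definition hsq i j : R := \sum_l h i l * h l j.

(* [sh_hsq] bounds the number of closed 4-walks (it is of order del^4 so that its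
   square root, which enters the variance of the quadratic terms, is of order
   del^2); [sh_a3] and [sh_hdegrho] are Lyapunov-type conditions. *)
Record stein_hyp : Prop := SteinHyp {
  sh_n : (1 < n)%N;
  sh_a0 : \sum_i a i = 0;
  sh_a2 : \sum_i a i ^+ 2 = 1;
  sh_h0 : forall i, h i i = 0;
  sh_hsym : forall i j, h i j = h j i;
  sh_hpos : forall i j, 0 <= h i j;
  sh_h2 : \sum_i rho i = 2;
  sh_del0 : 0 < del;
  sh_del1 : del <= 1;
  sh_deln : 1 <= n%:R * del ^+ 2;
  sh_hdeg : \sum_i hdeg i ^+ 2 <= n%:R * del ^+ 2;
  sh_a3 : \sum_i `|a i| ^+ 3 <= del;
  sh_hdegrho : \sum_i hdeg i * rho i <= del;
  sh_hsq : \sum_i \sum_j hsq i j ^+ 2 <= (del ^+ 2) ^+ 2 }.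
Hypothesis HS : stein_hyp.

Record cfun (y : 'I_n -> R) : Prop := CFun {
  cf0 : \sum_p y p = 0; cf1 : forall p, `|y p| <= 1 }.

(** The L2 scale of the sum of all [lstat (h i) y]. From 1 <= r, r <= n del and r^2 <= n del, every
    error below is expressed in the unit n del, which becomes del after division by n. *)
Let r := Num.sqrt n%:R * del.

Lemma r_sqr : r ^+ 2 = n%:R * del ^+ 2.
Proof. by rewrite exprMn sqr_sqrtr. Qed.

Lemma r_ge1 : 1 <= r.
Proof.
have r0 : 0 <= r by rewrite mulr_ge0// ltW// (sh_del0 HS).
rewrite -(@ler_pXn2r _ 2)// ?nnegrE// r_sqr expr1n; exact: (sh_deln HS).
Qed.

Lemma nat_ge1 : 1 <= n%:R :> R.
Proof. by rewrite ler1n ltnW// (sh_n HS). Qed.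

Lemma r_le : r <= n%:R * del.
Proof.
have n1 := nat_ge1.
apply: ler_wpM2r; first by rewrite ltW// (sh_del0 HS).
rewrite -{2}(@sqr_sqrtr _ n%:R)// expr2 ler_peMr ?sqrtr_ge0//.
by rewrite -[leLHS]sqrtr1 ler_wsqrtr.
Qed.

Lemma ndel_ge1 : 1 <= n%:R * del.
Proof. exact: le_trans r_ge1 r_le. Qed.

Lemma rsqr_le : r ^+ 2 <= n%:R * del.
Proof.
have d0 := sh_del0 HS; have d1 := sh_del1 HS; rewrite r_sqr ler_wpM2l//; nra.
Qed.

Section TwoFunctions.
Variables y z : 'I_n -> R.
Hypotheses (hy : cfun y) (hz : cfun z).
Definition Kn : R := (\sum_p y p * z p) / n%:R.
(** The centred product has values in [-2, 2]; its half is again a [cfun], so the moment bounds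
    apply to it. *)
Definition wc p : R := y p * z p - Kn.

Lemma KnE : \sum_p y p * z p = n%:R * Kn.
Proof.
by rewrite /Kn mulrC divfK// pnatr_eq0 -lt0n ltnW// (sh_n HS).
Qed.

Lemma Kn_le1 : `|Kn| <= 1.
Proof.
have n1 := nat_ge1; have n0 : 0 < n%:R :> R by apply: lt_le_trans n1.
rewrite normf_div [`|n%:R|]ger0_norm// ler_pdivrMr// mul1r.
apply: le_trans (ler_norm_sum _ _ _) _.
rewrite -[n in leRHS]card_ord -sum1_card natr_sum; apply: ler_sum => p _.
rewrite normrM -[1%:R]mulr1; apply: ler_pM => //; [exact: (cf1 hy)|exact: (cf1 hz)].
Qed.

Lemma wc_half : cfun (fun p => wc p / 2).
Proof.
split=> [|p].
  by rewrite -mulr_suml /wc sumrB KnE sum_cst_ord subrr mul0r.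
rewrite normrM [`|2^-1|]ger0_norm// ler_pdivrMr// mul1r.
apply: le_trans (ler_normB _ _) _; rewrite (_ : 2 = 1 + 1)//; apply: lerD.
  by rewrite normrM -[1]mulr1; apply: ler_pM => //; [exact: (cf1 hy)|exact: (cf1 hz)].
exact: Kn_le1.
Qed.
End TwoFunctions.

Local Notation X y s := (lstat a y s).
Local Notation S y i s := (lstat (h i) y s).

Lemma X_L2 y : cfun y -> permE (fun s => X y s ^+ 2) <= 2 ^+ 2.
Proof.
move=> hy; apply: le_trans (lstat_var a (sh_n HS) (cf0 hy) (cf1 hy)) _.
by rewrite (sh_a2 HS); lra.
Qed.

Lemma Q_L2 y z : cfun y -> cfun z -> permE (fun s => bstat h y z s ^+ 2) <= 11 ^+ 2.
Proof.
move=> hy hz.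
apply: le_trans (bstat_var (sh_n HS) (sh_h0 HS) (cf0 hy) (cf0 hz) (cf1 hy) (cf1 hz)) _.
by rewrite (sh_h2 HS); lra.
Qed.

Lemma sumS s y : \sum_i S y i s = lstat hdeg y s.
Proof.
rewrite /lstat exchange_big/=; apply: eq_bigr => l _.
by rewrite -mulr_suml /hdeg; congr (_ * _); apply: eq_bigr => j _; rewrite (sh_hsym HS).
Qed.

Lemma sumS_L2 y : cfun y -> permE (fun s => (\sum_i S y i s) ^+ 2) <= (2 * r) ^+ 2.
Proof.
move=> hy; under eq_permE do rewrite sumS.
apply: le_trans (lstat_var hdeg (sh_n HS) (cf0 hy) (cf1 hy)) _.
rewrite exprMn r_sqr; have := sh_hdeg HS; have := sh_deln HS; lra.
Qed.

Lemma lstat_wc b y z s : lstat b (wc y z) s = 2 * lstat b (fun p => wc y z p / 2) s.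
Proof.
by rewrite /lstat mulr_sumr; apply: eq_bigr => l _; field.
Qed.

Lemma aw_L2 y z : cfun y -> cfun z ->
  permE (fun s : {perm 'I_n} => (\sum_l a l * (y (s l) * z (s l))) ^+ 2) <= 3 ^+ 2.
Proof.
move=> hy hz.
have e (s : {perm 'I_n}) : \sum_l a l * (y (s l) * z (s l)) = 2 * lstat a (fun p => wc y z p / 2) s.
  rewrite -lstat_wc /lstat /wc; under [RHS]eq_bigr do rewrite mulrBr.
  by rewrite sumrB -mulr_suml (sh_a0 HS) mul0r subr0.
under eq_permE do rewrite e exprMn.
rewrite permEZ.
have hw := wc_half hy hz.
have := lstat_var a (sh_n HS) (cf0 hw) (cf1 hw); rewrite (sh_a2 HS); lra.
Qed.

Lemma wS_split y z x (s : {perm 'I_n}) : \sum_l S x l s * (y (s l) * z (s l)) =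
  2 * bstat h (fun p => wc y z p / 2) x s + Kn y z * \sum_l S x l s.
Proof.
rewrite /bstat !mulr_sumr -big_split; apply: eq_bigr => l _.
by rewrite /wc /=; field.
Qed.

Lemma aS_tr y s : \sum_l a l * S y l s = lstat (fun l => \sum_i a i * h i l) y s.
Proof.
rewrite /lstat; under eq_bigr do rewrite mulr_sumr.
rewrite exchange_big/=; apply: eq_bigr => l _; rewrite mulr_suml.
by apply: eq_bigr => i _; ring.
Qed.

(** This is the linear-bilinear cross coefficient. It is linear with weights h a, and the squared
    norm of h a is the quadratic form of h^2 at the unit vector a, hence at most the Hilbert-Schmidt
    norm of h^2. *)
Lemma aS_L2 y : cfun y -> permE (fun s => (\sum_l a l * S y l s) ^+ 2) <= (2 * del) ^+ 2.
Proof.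
move=> hy; under eq_permE do rewrite aS_tr.
apply: le_trans (lstat_var _ (sh_n HS) (cf0 hy) (cf1 hy)) _.
set V := \sum_l _.
have d0 : 0 <= del ^+ 2 by exact: sqr_ge0.
suff : V <= del ^+ 2 by rewrite exprMn; nra.
have V0 : 0 <= V by apply: sumr_ge0 => l _; exact: sqr_ge0.
have VE : V = \sum_(p : 'I_n * 'I_n) (a p.1 * a p.2) * hsq p.1 p.2.
  rewrite -(pair_bigA _ (fun i j => (a i * a j) * hsq i j))/= /V.
  transitivity (\sum_l \sum_i \sum_j (a i * h i l) * (a j * h j l)).
    by apply: eq_bigr => l _; rewrite expr2 sum2_prod.
  rewrite exchange_big/=; apply: eq_bigr => i _.
  rewrite exchange_big/=; apply: eq_bigr => j _.
  rewrite /hsq mulr_sumr; apply: eq_bigr => l _.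
  by rewrite (sh_hsym HS l j); ring.
have V2 : V ^+ 2 <= (del ^+ 2) ^+ 2.
  rewrite VE; apply: le_trans (sum_CS _ _) _.
  have -> : \sum_(p : 'I_n * 'I_n) (a p.1 * a p.2) ^+ 2 = 1.
    rewrite -(pair_bigA _ (fun i j => (a i * a j) ^+ 2))/=.
    under eq_bigr do under eq_bigr do rewrite exprMn.
    by rewrite sum2_prod (sh_a2 HS) mulr1.
  rewrite mul1r; have := sh_hsq HS.
  by rewrite -(pair_bigA _ (fun i j => hsq i j ^+ 2))/=.
by rewrite ler_sqr ?nnegrE in V2.
Qed.

(** The diagonal is removed because [bstat_var] requires it to be zero; the removed part is [rho],
    treated as a linear statistic. *)
Definition hoff i j : R := if i == j then 0 else hsq i j.

Lemma hoff_sum : \sum_i \sum_j hoff i j ^+ 2 <= (del ^+ 2) ^+ 2.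
Proof.
apply: le_trans (sh_hsq HS); apply: ler_sum => i _; apply: ler_sum => j _.
by rewrite /hoff; case: eqP => // _; rewrite expr0n sqr_ge0.
Qed.

Lemma hsq_diag i : hsq i i = rho i.
Proof. by apply: eq_bigr => l _; rewrite (sh_hsym HS l i) expr2. Qed.

Lemma rho_sum : \sum_i rho i ^+ 2 <= (del ^+ 2) ^+ 2.
Proof.
apply: le_trans (sh_hsq HS); apply: ler_sum => i _.
rewrite (bigD1 i)//= hsq_diag lerDl; apply: sumr_ge0 => j _; exact: sqr_ge0.
Qed.

(** The diagonal of h^2 has total weight 2, which gives the constant 2 [Kn y z]; what remains is a
    centred linear statistic and an off-diagonal bilinear one. *)
Lemma SS_split y z (s : {perm 'I_n}) : \sum_i S y i s * S z i s - 2 * Kn y z =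
  2 * lstat rho (fun p => wc y z p / 2) s + bstat hoff y z s.
Proof.
have -> : \sum_i S y i s * S z i s = \sum_l \sum_m hsq l m * (y (s l) * z (s m)).
  transitivity (\sum_i \sum_l \sum_m (h i l * y (s l)) * (h i m * z (s m))).
    by apply: eq_bigr => i _; rewrite /lstat sum2_prod.
  rewrite exchange_big/=; apply: eq_bigr => l _.
  rewrite exchange_big/=; apply: eq_bigr => m _.
  rewrite /hsq mulr_suml; apply: eq_bigr => i _.
  by rewrite (sh_hsym HS l i); ring.
rewrite -lstat_wc -(sh_h2 HS) mulr_suml /lstat /bstat -sumrB -big_split.
apply: eq_bigr => l _; rewrite /lstat mulr_sumr /=.
rewrite (bigD1 l)//= [in RHS](bigD1 l)//= hsq_diag /hoff eqxx /wc.
rewrite (eq_bigr (fun m => y (s l) * ((if l == m then 0 else hsq l m) * z (s m)))) => [|m ml].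
  by ring.
by rewrite eq_sym (negbTE ml); ring.
Qed.

Lemma SS_L1 y z : cfun y -> cfun z ->
  permE (fun s => `|\sum_i S y i s * S z i s - 2 * Kn y z|) <= 14 * del ^+ 2.
Proof.
move=> hy hz; have hw := wc_half hy hz; have d0 := sqr_ge0 del.
under eq_permE do rewrite SS_split.
apply: (@le_trans _ _ (permE (fun s => 2 * `|lstat rho (fun p => wc y z p / 2) s| + `|bstat hoff y z s|))).
  apply: permE_le => s; apply: le_trans (ler_normD _ _) _.
  by rewrite normrM [`|2|]ger0_norm.
(* The constants come from 2 <= 3^2 here and 60 <= 8^2 below; then 14 = 2 * 3 + 8. *)
have h1 : permE (fun s => `|lstat rho (fun p => wc y z p / 2) s|) <= 3 * del ^+ 2.
  apply: permE_norm_le; first by rewrite mulr_ge0.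
  apply: le_trans (lstat_var _ (sh_n HS) (cf0 hw) (cf1 hw)) _.
  by have := rho_sum; have := sqr_ge0 (del ^+ 2); rewrite exprMn; lra.
have h2 : permE (fun s => `|bstat hoff y z s|) <= 8 * del ^+ 2.
  apply: permE_norm_le; first by rewrite mulr_ge0.
  have hoff0 i : hoff i i = 0 by rewrite /hoff eqxx.
  apply: le_trans (bstat_var (sh_n HS) hoff0 (cf0 hy) (cf0 hz) (cf1 hy) (cf1 hz)) _.
  by have := hoff_sum; have := sqr_ge0 (del ^+ 2); rewrite exprMn; lra.
by rewrite permED permEZ; lra.
Qed.
End PairBounds.

(** * Increments of the combined statistic *)

Section SteinT.
Context {R : realType} {n : nat}.
Variables (a : 'I_n -> R) (h : 'I_n -> 'I_n -> R) (del : R).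
Hypothesis HS : stein_hyp a h del.
Variables (k : nat) (y : 'I_k -> 'I_n -> R).
Hypothesis hy : forall b, cfun (y b).
Variables al be : 'I_k -> R.
Implicit Type s : {perm 'I_n}.

Definition xst b s := lstat a (y b) s.
Definition qst b s := bstat h (y b) (y b) s / 2 - permE (fun s => bstat h (y b) (y b) s / 2).
Definition tst s := \sum_b (al b * xst b s + be b * qst b s).
Let S b i s := lstat (h i) (y b) s.
Let K c b := Kn (y c) (y b).
Let w := \sum_b (`|al b| + `|be b|).

Lemma w_ge0 : 0 <= w.
Proof. by apply: sumr_ge0 => b _; rewrite addr_ge0. Qed.

Lemma xst_sw b i j s : xst b (sw i j s) - xst b s =
  (y b (s j) - y b (s i)) * (a i - a j).
Proof. by rewrite /xst lstat_sw addrC addKr. Qed.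

Lemma qst_sw b i j s : qst b (sw i j s) - qst b s =
  (y b (s j) - y b (s i)) * (S b i s - S b j s) - h i j * (y b (s j) - y b (s i)) ^+ 2.
Proof.
rewrite /qst bstat_sw; last exact: (sh_h0 HS).
have e i' : lstat (fun k => h k i') (y b) s = S b i' s.
  by apply: eq_bigr => l _; rewrite (sh_hsym HS).
rewrite !e -!/(S b _ s) (sh_hsym HS j i).
by field.
Qed.

Lemma tst_sw i j s : tst (sw i j s) - tst s =
  \sum_b (al b * ((y b (s j) - y b (s i)) * (a i - a j)) +
     be b * ((y b (s j) - y b (s i)) * (S b i s - S b j s) - h i j * (y b (s j) - y b (s i)) ^+ 2)).
Proof.
rewrite /tst -sumrB; apply: eq_bigr => b _.
by rewrite -xst_sw -qst_sw; ring.
Qed.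

Definition hterm (f : 'I_n -> R) c b s :=
  \sum_i \sum_j f i * y c (s j) * (h i j * (y b (s j) - y b (s i)) ^+ 2).

(** Used with f = a and with f = [S c]. Leading order comes only from the products with n K, through
    the sums of a^2 and of [S c] times [S b]; the other terms are shown to be of size n del. *)
Lemma tst_incr_sum (f : 'I_n -> R) c s :
  \sum_i \sum_j f i * y c (s j) * (tst (sw i j s) - tst s) =
  \sum_b (al b * ((\sum_l f l * a l) * (n%:R * K c b)
      - (\sum_l f l) * (\sum_l a l * (y c (s l) * y b (s l)))
      + (\sum_l f l * y b (s l)) * xst c s)
   + be b * ((\sum_l f l * S b l s) * (n%:R * K c b)
      - (\sum_l f l) * (\sum_l S b l s * (y c (s l) * y b (s l)))
      + (\sum_l f l * y b (s l)) * bstat h (y c) (y b) s - hterm f c b s)).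
Proof.
have yc0 : \sum_l y c (s l) = 0 by rewrite sum_perm (cf0 (hy c)).
have kE b : \sum_l y c (s l) * y b (s l) = n%:R * K c b.
  by rewrite (sum_perm (fun p => y c p * y b p)) (KnE HS).
transitivity (\sum_b (al b * (\sum_i \sum_j f i * y c (s j) * ((y b (s j) - y b (s i)) * (a i - a j)))
  + be b * (\sum_i \sum_j f i * y c (s j) * ((y b (s j) - y b (s i)) * (S b i s - S b j s)) - hterm f c b s))).
  under eq_bigr do under eq_bigr do rewrite tst_sw mulr_sumr.
  under eq_bigr do rewrite exchange_big/=.
  rewrite exchange_big/=; apply: eq_bigr => b _.
  rewrite /hterm -sumrB !mulr_sumr -big_split; apply: eq_bigr => i _ /=.
  rewrite -sumrB !mulr_sumr -big_split; apply: eq_bigr => j _ /=.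
  by ring.
apply: eq_bigr => b _.
rewrite (@swap_form _ _ f a (fun l => y c (s l)) (fun l => y b (s l)))//.
rewrite (@swap_form _ _ f (fun l => S b l s) (fun l => y c (s l)) (fun l => y b (s l)))//.
rewrite !kE; congr (_ * _ + _ * (_ - _)); congr (_ + _ * _).
by apply: eq_bigr => l _; rewrite mulrC.
Qed.

Lemma hdeg_ge0 i : 0 <= hdeg h i.
Proof. by apply: sumr_ge0 => j _; exact: (sh_hpos HS). Qed.

Lemma h_le_hdeg i j : h i j <= hdeg h i.
Proof.
by rewrite /hdeg (bigD1 j)//= lerDl; apply: sumr_ge0 => l _; exact: (sh_hpos HS).
Qed.

Lemma S_le_hdeg b i s : `|S b i s| <= hdeg h i.
Proof.
apply: le_trans (ler_norm_sum _ _ _) _; apply: ler_sum => l _.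
rewrite normrM ger0_norm ?(sh_hpos HS)// ler_piMr ?(sh_hpos HS)//.
exact: (cf1 (hy b)).
Qed.

Lemma ydiff_le b p q : `|y b p - y b q| <= 2.
Proof.
apply: le_trans (ler_normB _ _) _; rewrite (_ : 2 = 1 + 1)//.
by apply: lerD; exact: (cf1 (hy b)).
Qed.

Lemma hterm_le (f : 'I_n -> R) c b s : `|hterm f c b s| <= 4 * \sum_i `|f i| * hdeg h i.
Proof.
apply: le_trans (ler_norm_sum _ _ _) _; rewrite mulr_sumr; apply: ler_sum => i _.
apply: le_trans (ler_norm_sum _ _ _) _.
rewrite /hdeg !mulr_sumr; apply: ler_sum => j _.
have hh := sh_hpos HS i j.
rewrite !normrM [`|h i j|]ger0_norm//.
have y1 := cf1 (hy c) (s j).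
have t2 := ydiff_le b (s j) (s i).
have := normr_ge0 (y c (s j)); have := normr_ge0 (f i); have := normr_ge0 (y b (s j) - y b (s i)).
move: (`|f i|) (`|y c _|) (`|_ - _|) (h i j) y1 t2 hh => F Y t H0 y1 t2 H00 t0 F0 Y0.
have -> : 4 * (F * H0) = F * 1 * (H0 * 4) by ring.
have tt : t * t <= 4 by nra.
by apply: ler_pM; rewrite ?mulr_ge0//; apply: ler_wpM2l.
Qed.

(** The influence of observation i. It dominates the weights a and [S c] and, by [tst_incr_le], the
    increments, so second-order remainders reduce to sums of cubes. *)
Definition uu i s := `|a i| + \sum_b `|S b i s|.

Lemma uu_ge0 i s : 0 <= uu i s.
Proof. by rewrite addr_ge0// sumr_ge0. Qed.

Lemma tst_incr_le i j s : `|tst (sw i j s) - tst s| <= 4 * w * (uu i s + uu j s + h i j).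
Proof.
have hh := sh_hpos HS i j.
have Suu b l : `|S b l s| <= uu l s.
  rewrite /uu (bigD1 b)//= addrA [`|a l| + _]addrC -addrA lerDl addr_ge0// sumr_ge0//.
have auu l : `|a l| <= uu l s by rewrite lerDl sumr_ge0.
rewrite tst_sw; apply: le_trans (ler_norm_sum _ _ _) _.
rewrite -mulrA mulrCA /w mulr_suml; apply: ler_sum => b _.
have y2 := ydiff_le b (s j) (s i).
apply: le_trans (ler_normD _ _) _; rewrite [leRHS]mulrDl !normrM.
have t0 := normr_ge0 (y b (s j) - y b (s i)).
have h1 : `|a i - a j| <= uu i s + uu j s.
  by apply: le_trans (ler_normB _ _) _; exact: lerD.
have h2 : `|S b i s - S b j s| <= uu i s + uu j s.
  by apply: le_trans (ler_normB _ _) _; exact: lerD.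
apply: lerD; apply: ler_wpM2l => //.
  have := normr_ge0 (a i - a j).
  by move: (`|y b _ - _|) (`|a i - a j|) y2 t0 h1 hh => t v; nra.
apply: le_trans (ler_normB _ _) _; rewrite !normrM [`|h i j|]ger0_norm//.
have := normr_ge0 (S b i s - S b j s).
move: (`|y b _ - _|) (`|S b i s - _|) y2 t0 h2 hh => t v t2 t0 v2 hh v0.
have : t * v <= 2 * (uu i s + uu j s) by nra.
have : h i j * (t * t) <= h i j * 4 by apply: ler_wpM2l => //; nra.
nra.
Qed.
End SteinT.

(** * The second-order remainder *)

Section Remainder.
Context {R : realType} {n : nat}.
Variables (a : 'I_n -> R) (h : 'I_n -> 'I_n -> R) (del : R).
Hypothesis HS : stein_hyp a h del.
Variables (k : nat) (y : 'I_k -> 'I_n -> R).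
Hypothesis hy : forall b, cfun (y b).
Variables al be : 'I_k -> R.
Implicit Type s : {perm 'I_n}.
Let S b i s := lstat (h i) (y b) s.
Let w := \sum_b (`|al b| + `|be b|).
Notation T := (tst a h y al be).
Notation u := (uu a h y).

Lemma cube_sum_le (I : finType) (x : I -> R) : (forall i, 0 <= x i) ->
  (\sum_i x i) ^+ 3 <= #|I|%:R ^+ 2 * \sum_i x i ^+ 3.
Proof.
move=> x0.
have amgm (p q r : R) : 0 <= p -> 0 <= q -> 0 <= r -> 3 * (p * q * r) <= p ^+ 3 + q ^+ 3 + r ^+ 3.
  move=> p0 q0 r0; rewrite -subr_ge0.
  have -> : p ^+ 3 + q ^+ 3 + r ^+ 3 - 3 * (p * q * r) =
     (p + q + r) * (((p - q) ^+ 2 + (q - r) ^+ 2 + (p - r) ^+ 2) / 2) by field.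
  by rewrite mulr_ge0 ?addr_ge0// divr_ge0// !addr_ge0// sqr_ge0.
have e : 3 * (\sum_i x i) ^+ 3 = \sum_i \sum_j \sum_l 3 * (x i * x j * x l).
  rewrite (_ : (\sum_i x i) ^+ 3 = (\sum_i x i) * ((\sum_i x i) * (\sum_i x i))); last by ring.
  rewrite mulr_suml mulr_sumr; apply: eq_bigr => i _.
  rewrite mulr_suml !mulr_sumr; apply: eq_bigr => j _.
  by rewrite !mulr_sumr; apply: eq_bigr => l _; ring.
have e2 : \sum_i \sum_j \sum_l (x i ^+ 3 + x j ^+ 3 + x l ^+ 3) =
   3 * (#|I|%:R ^+ 2 * \sum_i x i ^+ 3).
  have sc (v : R) : \sum_(i : I) v = #|I|%:R * v by rewrite sumr_const mulr_natl.
  under eq_bigr do under eq_bigr do rewrite !big_split/= !sc.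
  under eq_bigr do rewrite !big_split/= !sc -!mulr_sumr.
  rewrite !big_split/= !sc -!mulr_sumr.
  by ring.
have : 3 * (\sum_i x i) ^+ 3 <= 3 * (#|I|%:R ^+ 2 * \sum_i x i ^+ 3).
  rewrite e -e2; do 3! (apply: ler_sum => ? _); exact: amgm.
by rewrite ler_pM2l.
Qed.

Lemma cube_add_le (p q : R) : 0 <= p -> 0 <= q -> (p + q) ^+ 3 <= 4 * p ^+ 3 + 4 * q ^+ 3.
Proof.
move=> p0 q0; have := mulr_ge0 (addr_ge0 p0 q0) (sqr_ge0 (p - q)).
rewrite -subr_ge0 => h0; rewrite -subr_ge0.
by rewrite [leRHS](_ : _ = 3 * ((p + q) * (p - q) ^+ 2)); [lra|ring].
Qed.

Lemma cube3_le (p q r : R) : 0 <= p -> 0 <= q -> 0 <= r ->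
  (p + q + r) ^+ 3 <= 16 * p ^+ 3 + 16 * q ^+ 3 + 4 * r ^+ 3.
Proof.
move=> p0 q0 r0.
apply: le_trans (cube_add_le (addr_ge0 p0 q0) r0) _.
by have := cube_add_le p0 q0; lra.
Qed.

(** One factor is bounded by the weighted degree and the other two have second moment at most 2
    [rho h i]; this is how the sum of [hdeg] times [rho] enters. *)
Lemma S_cube b : permE (fun s => \sum_i `|S b i s| ^+ 3) <= 2 * del.
Proof.
apply: (@le_trans _ _ (permE (fun s => \sum_i hdeg h i * S b i s ^+ 2))).
  apply: permE_le => s; apply: ler_sum => i _.
  rewrite exprS real_normK ?num_real// ler_wpM2r ?sqr_ge0//; exact: (S_le_hdeg HS).
rewrite permE_sum; apply: (@le_trans _ _ (\sum_i hdeg h i * (2 * rho h i))).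
  apply: ler_sum => i _; rewrite permEZ ler_wpM2l ?(hdeg_ge0 HS)//.
  exact: (lstat_var (h i) (sh_n HS) (cf0 (hy b)) (cf1 (hy b))).
under eq_bigr do rewrite mulrCA.
by rewrite -mulr_sumr ler_pM2l// (sh_hdegrho HS).
Qed.

Lemma u_cube : permE (fun s => \sum_i u i s ^+ 3) <= (4 + 8 * k%:R ^+ 3) * del.
Proof.
apply: (@le_trans _ _ (permE (fun s => 4 * \sum_i `|a i| ^+ 3 +
   4 * k%:R ^+ 2 * \sum_b \sum_i `|S b i s| ^+ 3))).
  apply: permE_le => s; rewrite exchange_big/= !mulr_sumr -big_split.
  apply: ler_sum => i _ /=; rewrite /uu.
  apply: le_trans (cube_add_le (normr_ge0 _) _) _; first exact: sumr_ge0.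
  rewrite lerD2l -mulrA ler_pM2l//.
  by have := @cube_sum_le _ (fun b => `|S b i s|); rewrite card_ord; apply.
rewrite permED permE_cst permEZ permE_sum.
have h1 := sh_a3 HS.
have h2 : \sum_b permE (fun s => \sum_i `|S b i s| ^+ 3) <= k%:R * (2 * del).
  by rewrite -(sum_cst_ord k); apply: ler_sum => b _; exact: S_cube.
have k0 : 0 <= 4 * k%:R ^+ 2 :> R by rewrite mulr_ge0// sqr_ge0.
have := ler_wpM2l k0 h2.
rewrite (_ : 4 * k%:R ^+ 2 * (k%:R * (2 * del)) = 8 * k%:R ^+ 3 * del); last by ring.
by rewrite mulrDl; lra.
Qed.

Lemma h_cube : \sum_i \sum_j h i j ^+ 3 <= del.
Proof.
apply: le_trans (sh_hdegrho HS); apply: ler_sum => i _.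
rewrite /rho mulr_sumr; apply: ler_sum => j _.
by rewrite exprS ler_wpM2r ?sqr_ge0// (h_le_hdeg HS).
Qed.

(** 16 w^2 is the square of 4 w in [tst_incr_le], and 132 + 256 k^3 = 32 (4 + 8 k^3) + 4 combines
    [u_cube] and [h_cube]. *)
Definition crem : R := 16 * w ^+ 2 * (132 + 256 * k%:R ^+ 3).

Lemma crem_ge0 : 0 <= crem.
Proof.
by apply: mulr_ge0; [rewrite mulr_ge0// sqr_ge0|rewrite addr_ge0// mulr_ge0// exprn_ge0].
Qed.

Lemma remainder_le :
  permE (fun s => \sum_i \sum_j u i s * (T (sw i j s) - T s) ^+ 2) <= crem * (n%:R * del).
Proof.
have w0 : 0 <= w by exact: w_ge0.
apply: (@le_trans _ _ (permE (fun s => 16 * w ^+ 2 *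
   (32 * n%:R * \sum_i u i s ^+ 3 + 4 * \sum_i \sum_j h i j ^+ 3)))).
  apply: permE_le => s.
  apply: (@le_trans _ _ (\sum_i \sum_j 16 * w ^+ 2 * (16 * u i s ^+ 3 + 16 * u j s ^+ 3 + 4 * h i j ^+ 3))).
    apply: ler_sum => i _; apply: ler_sum => j _.
    have ui := uu_ge0 a h y i s; have uj := uu_ge0 a h y j s; have hh := sh_hpos HS i j.
    have m0 : 0 <= u i s + u j s + h i j by exact: addr_ge0 (addr_ge0 ui uj) hh.
    have um : u i s <= u i s + u j s + h i j by rewrite -addrA lerDl; exact: addr_ge0.
    apply: (@le_trans _ _ (16 * w ^+ 2 * (u i s + u j s + h i j) ^+ 3)); last first.
      by apply: ler_wpM2l; [rewrite mulr_ge0// sqr_ge0|exact: cube3_le].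
    rewrite [leRHS](_ : _ = (u i s + u j s + h i j) * (4 * w * (u i s + u j s + h i j)) ^+ 2); last by ring.
    apply: ler_pM => //; first exact: sqr_ge0.
    rewrite -real_normK ?num_real// lerXn2r ?nnegrE//; last exact: (tst_incr_le HS hy).
    by rewrite mulr_ge0// mulr_ge0.
  under eq_bigr do rewrite -mulr_sumr !big_split/= sum_cst_ord -!mulr_sumr.
  rewrite -mulr_sumr !big_split/= sum_cst_ord -!mulr_sumr.
  by rewrite le_eqVlt; apply/orP; left; apply/eqP; ring.
rewrite permEZ permED permE_cst [permE (fun s => 32 * _ * _)]permEZ /crem -[leRHS]mulrA.
apply: ler_wpM2l; first by rewrite mulr_ge0// sqr_ge0.
have hu := u_cube; have hc := h_cube.
have n1 := nat_ge1 HS; have d0 := sh_del0 HS.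
have n0 : 0 <= 32 * n%:R :> R by rewrite mulr_ge0.
have hc2 : \sum_i \sum_j h i j ^+ 3 <= n%:R * del.
  by apply: le_trans hc _; rewrite ler_peMl// ltW.
apply: le_trans (lerD (ler_wpM2l n0 hu) (ler_wpM2l (ler0n R 4) hc2)) _.
by rewrite le_eqVlt; apply/orP; left; apply/eqP; ring.
Qed.

(* First-order expansion of psi (T o swap) - psi T; the second-order terms are
   controlled by [remainder_le]. *)
Lemma expand_le (psi dpsi : R -> R) (f : 'I_n -> {perm 'I_n} -> R) (c : 'I_k)
    (mm E0 : R) (err : {perm 'I_n} -> R) :
  (forall x t, `|psi (x + t) - psi x - t * dpsi x| <= t ^+ 2) ->
  (forall x, `|dpsi x| <= 1) ->
  (forall i s, `|f i s| <= u i s) ->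
  (forall s, \sum_i \sum_j f i s * y c (s j) * (T (sw i j s) - T s) = mm + err s) ->
  permE (fun s => `|err s|) <= E0 ->
  `|permE (fun s => \sum_i \sum_j f i s * y c (s j) * (psi (T (sw i j s)) - psi (T s)))
    - mm * permE (fun s => dpsi (T s))| <= E0 + crem * (n%:R * del).
Proof.
move=> hpsi hd hf hs hE.
rewrite -permEZ -permEB; apply: le_trans (permE_norm _) _.
apply: (@le_trans _ _ (permE (fun s => `|err s| + \sum_i \sum_j u i s * (T (sw i j s) - T s) ^+ 2))).
  apply: permE_le => s.
  have -> : \sum_i \sum_j f i s * y c (s j) * (psi (T (sw i j s)) - psi (T s)) - mm * dpsi (T s) =
    err s * dpsi (T s) + \sum_i \sum_j f i s * y c (s j) *
      (psi (T (sw i j s)) - psi (T s) - (T (sw i j s) - T s) * dpsi (T s)).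
    apply/eqP; rewrite subr_eq addrAC -mulrDl addrC [err s + mm]addrC -hs mulr_suml -big_split.
    apply/eqP; apply: eq_bigr => i _ /=; rewrite mulr_suml -big_split.
    by apply: eq_bigr => j _ /=; ring.
  apply: le_trans (ler_normD _ _) _; apply: lerD.
    by rewrite normrM ler_piMr.
  apply: le_trans (ler_norm_sum _ _ _) _; apply: ler_sum => i _.
  apply: le_trans (ler_norm_sum _ _ _) _; apply: ler_sum => j _.
  rewrite normrM; apply: ler_pM => //.
    rewrite normrM; apply: le_trans (hf i s); rewrite ler_piMr//.
    exact: (cf1 (hy c)).
  by have := hpsi (T s) (T (sw i j s) - T s); rewrite [T s + _]addrC subrK.
by rewrite permED; apply: lerD => //; exact: remainder_le.
Qed.
End Remainder.

Section NormLemmas.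
Context {R : realType} {n : nat}.
Implicit Types f g : {perm 'I_n} -> R.

Lemma permE_normD f g (A B : R) : permE (fun s => `|f s|) <= A ->
  permE (fun s => `|g s|) <= B -> permE (fun s => `|f s + g s|) <= A + B.
Proof.
move=> hf hg; apply: le_trans _ (lerD hf hg); rewrite -permED.
by apply: permE_le => s; exact: ler_normD.
Qed.

Lemma permE_normB f g (A B : R) : permE (fun s => `|f s|) <= A ->
  permE (fun s => `|g s|) <= B -> permE (fun s => `|f s - g s|) <= A + B.
Proof.
move=> hf hg; apply: permE_normD => //.
by rewrite (eq_permE (g := fun s => `|g s|))// => s; rewrite normrN.
Qed.

Lemma permE_normZ f (c A : R) : permE (fun s => `|f s|) <= A ->
  permE (fun s => `|c * f s|) <= `|c| * A.
Proof.
move=> hf; under eq_permE do rewrite normrM.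
by rewrite permEZ; apply: ler_wpM2l.
Qed.

Lemma permE_norm_sum (I : Type) (r : seq I) (F : I -> {perm 'I_n} -> R) (A : I -> R) :
  (forall i, permE (fun s => `|F i s|) <= A i) ->
  permE (fun s => `|\sum_(i <- r) F i s|) <= \sum_(i <- r) A i.
Proof.
move=> hF; apply: (@le_trans _ _ (permE (fun s => \sum_(i <- r) `|F i s|))).
  by apply: permE_le => s; exact: ler_norm_sum.
by rewrite permE_sum; apply: ler_sum => i _; exact: hF.
Qed.
End NormLemmas.

(** * Approximate Stein identities for the linear and bilinear parts *)

Section SteinXQ.
Context {R : realType} {n : nat}.
Variables (a : 'I_n -> R) (h : 'I_n -> 'I_n -> R) (del : R).
Hypothesis HS : stein_hyp a h del.
Variables (k : nat) (y : 'I_k -> 'I_n -> R).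
Hypothesis hy : forall b, cfun (y b).
Variables al be : 'I_k -> R.
Implicit Type s : {perm 'I_n}.
Let S b i s := lstat (h i) (y b) s.
Let K c b := Kn (y c) (y b).
Let w := \sum_b (`|al b| + `|be b|).
Let r := Num.sqrt n%:R * del.
Notation T := (tst a h y al be).
Notation X := (xst a y).
Notation Q := (qst h y).
Notation B b c := (bstat h (y b) (y c)).

Let n1 : 1 <= n%:R :> R. Proof. exact: nat_ge1 HS. Qed.
Let nd1 : 1 <= n%:R * del. Proof. exact: ndel_ge1 HS. Qed.
Let d0 : 0 < del. Proof. exact: sh_del0 HS. Qed.
Let rn : r <= n%:R * del. Proof. exact: r_le HS. Qed.
Let r1 : 1 <= r. Proof. exact: r_ge1 HS. Qed.
Let r0 : 0 <= r. Proof. exact: le_trans ler01 r1. Qed.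
Let rr : r ^+ 2 <= n%:R * del. Proof. exact: rsqr_le HS. Qed.

Lemma K_norm c b : `|K c b| <= 1.
Proof. exact: (Kn_le1 HS). Qed.

Lemma nK_norm c b : `|n%:R * K c b| <= n%:R.
Proof. by rewrite normrM ger0_norm// ler_piMr// K_norm. Qed.

Lemma XX_L1 b c : permE (fun s => `|X b s * X c s|) <= 4 * (n%:R * del).
Proof.
apply: (@le_trans _ _ (2 * 2)); last by have := nd1; have := rn; lra.
by apply: permE_CS_le => //; exact: (X_L2 HS).
Qed.

Lemma XB_L1 b c e : permE (fun s => `|X b s * B c e s|) <= 22 * (n%:R * del).
Proof.
apply: (@le_trans _ _ (2 * 11)); last by have := nd1; have := rn; lra.
by apply: permE_CS_le => //; [exact: (X_L2 HS)|exact: (Q_L2 HS)].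
Qed.

Lemma BB_L1 b c e f : permE (fun s => `|B b c s * B e f s|) <= 121 * (n%:R * del).
Proof.
apply: (@le_trans _ _ (11 * 11)); last by have := nd1; have := rn; lra.
by apply: permE_CS_le => //; exact: (Q_L2 HS).
Qed.

Lemma aS_L1 b c e : permE (fun s => `|(\sum_l a l * S b l s) * (n%:R * K c e)|) <= 2 * (n%:R * del).
Proof.
under eq_permE do rewrite mulrC.
apply: (@le_trans _ _ (`|n%:R * K c e| * (2 * del))).
  apply: permE_normZ; apply: permE_norm_le; first by rewrite mulr_ge0// ltW.
  exact: (aS_L2 HS).
by rewrite [leRHS]mulrCA; apply: ler_wpM2r (nK_norm _ _); rewrite mulr_ge0// ltW.
Qed.

Lemma hdeg_le : \sum_i hdeg h i ^+ 2 <= r ^+ 2.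
Proof. by rewrite (r_sqr (n := n)); exact: (sh_hdeg HS). Qed.

Lemma hterm_a_L1 c b : permE (fun s => `|hterm h y a c b s|) <= 4 * (n%:R * del).
Proof.
apply: (@le_trans _ _ (4 * \sum_i `|a i| * hdeg h i)).
  rewrite -[leRHS](@permE_cst R n); apply: permE_le => s; exact: (hterm_le HS hy).
rewrite ler_pM2l//; apply: le_trans rn.
have : (\sum_i `|a i| * hdeg h i) ^+ 2 <= r ^+ 2.
  apply: le_trans (sum_CS _ _) _.
  under eq_bigr do rewrite real_normK ?num_real//.
  by rewrite (sh_a2 HS) mul1r hdeg_le.
rewrite ler_sqr// nnegrE; apply: sumr_ge0 => i _.
by rewrite mulr_ge0// (hdeg_ge0 HS).
Qed.

Lemma SS2_L1 c : permE (fun s => \sum_i S c i s ^+ 2) <= 2 ^+ 2.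
Proof.
apply: le_trans (sum_lstat_var (sh_n HS) h (cf0 (hy c)) (cf1 (hy c))) _.
by rewrite -/(rho h _) (sh_h2 HS); lra.
Qed.

Lemma hterm_S_L1 c b : permE (fun s => `|hterm h y (fun i => S c i s) c b s|) <= 8 * (n%:R * del).
Proof.
apply: (@le_trans _ _ (permE (fun s => 4 * \sum_i `|S c i s| * hdeg h i))).
  by apply: permE_le => s; exact: (hterm_le HS hy).
rewrite permEZ (_ : 8 * (n%:R * del) = 4 * (2 * (n%:R * del))); last by ring.
rewrite ler_pM2l//.
have S0 s : 0 <= \sum_i `|S c i s| * hdeg h i.
  by apply: sumr_ge0 => i _; rewrite mulr_ge0// (hdeg_ge0 HS).
rewrite (eq_permE (g := fun s => `|\sum_i `|S c i s| * hdeg h i|)) => [|s]; last by rewrite ger0_norm.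
apply: (@le_trans _ _ (2 * r)); last by rewrite ler_pM2l.
apply: permE_norm_le; first by rewrite mulr_ge0.
apply: (@le_trans _ _ (permE (fun s => r ^+ 2 * \sum_i S c i s ^+ 2))).
  apply: permE_le => s; apply: le_trans (sum_CS _ _) _.
  under eq_bigr do rewrite real_normK ?num_real//.
  rewrite mulrC ler_wpM2r ?hdeg_le//; apply: sumr_ge0 => i _; exact: sqr_ge0.
by rewrite permEZ [leRHS]exprMn [leLHS]mulrC ler_wpM2r ?sqr_ge0// SS2_L1.
Qed.

Lemma sumS_aw_L1 c b e : permE (fun s => `|(\sum_l S c l s) * (\sum_l a l * (y b (s l) * y e (s l)))|)
   <= 6 * (n%:R * del).
Proof.
apply: (@le_trans _ _ ((2 * r) * 3)); last by have := nd1; have := rn; lra.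
apply: permE_CS_le => //; [by rewrite mulr_ge0|exact: (sumS_L2 HS)|exact: (aw_L2 HS)].
Qed.

(** Centring the product window splits off K times a product of two sums of S. That piece has size
    r^2, not r, and uses r^2 <= n del. *)
Lemma sumS_wS_L1 c b : permE (fun s => `|(\sum_l S c l s) * (\sum_l S b l s * (y c (s l) * y b (s l)))|)
   <= 48 * (n%:R * del).
Proof.
have e s : (\sum_l S c l s) * (\sum_l S b l s * (y c (s l) * y b (s l))) =
   2 * ((\sum_l S c l s) * bstat h (fun p => wc (y c) (y b) p / 2) (y b) s) +
   K c b * ((\sum_l S c l s) * (\sum_l S b l s)).
  by rewrite /S wS_split /K; ring.
under eq_permE do rewrite e.
apply: (@le_trans _ _ (`|2| * ((2 * r) * 11) + `|K c b| * ((2 * r) * (2 * r)))).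
  apply: permE_normD; apply: permE_normZ; apply: permE_CS_le => //; try exact: (sumS_L2 HS).
  - by rewrite mulr_ge0.
  - by apply: (Q_L2 HS) => //; exact: (wc_half HS).
  - by rewrite mulr_ge0.
  - by rewrite mulr_ge0.
rewrite [`|2|]ger0_norm//.
have : `|K c b| * ((2 * r) * (2 * r)) <= 1 * ((2 * r) * (2 * r)).
  have r20 : 0 <= 2 * r by rewrite mulr_ge0.
  by apply: ler_wpM2r (K_norm _ _); exact: mulr_ge0.
by move: rr rn; rewrite expr2; lra.
Qed.

Lemma SS_K_L1 c b : permE (fun s => `|(\sum_l S c l s * S b l s - 2 * K c b) * (n%:R * K c b)|)
   <= 14 * (n%:R * del).
Proof.
under eq_permE do rewrite mulrC.
apply: (@le_trans _ _ (`|n%:R * K c b| * (14 * del ^+ 2))).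
  by apply: permE_normZ; exact: (SS_L1 HS).
apply: (@le_trans _ _ (n%:R * (14 * del ^+ 2))).
  by apply: ler_wpM2r (nK_norm _ _); rewrite mulr_ge0// sqr_ge0.
by rewrite mulrCA ler_pM2l// -(r_sqr del) rr.
Qed.

Section Psi.
Variables (psi dpsi : R -> R) (C0 : R).
Hypotheses (hpsi : forall x t, `|psi (x + t) - psi x - t * dpsi x| <= t ^+ 2)
  (hdpsi : forall x, `|dpsi x| <= 1) (C00 : 0 <= C0)
  (hC0 : permE (fun s => psi (T s) ^+ 2) <= C0 ^+ 2).
Notation crem := (crem al be).

Lemma lstat_stein c (F : {perm 'I_n} -> R) : n%:R * permE (fun s => X c s * F s) =
  permE (fun s => \sum_i \sum_j a i * y c (s j) * (F (sw i j s) - F s)).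
Proof.
transitivity (\sum_i a i * (n%:R * permE (fun s => y c (s i) * F s))).
  under eq_bigr do rewrite mulrCA -permEZ.
  rewrite -mulr_sumr -permE_sum; congr (_ * _); apply: eq_permE => s.
  by rewrite /xst /lstat mulr_suml; apply: eq_bigr => i _; ring.
under eq_bigr do rewrite (swap_stein _ _ (cf0 (hy c))) -permEZ.
rewrite -permE_sum; apply: eq_permE => s; apply: eq_bigr => i _.
by rewrite mulr_sumr; apply: eq_bigr => j _; rewrite mulrA.
Qed.

(** With f = a, the relations sum a = 0 and sum a^2 = 1 isolate the leading term; the coefficient of
    [be b] is the small cross term of [aS_L2]. *)
Lemma stein_X c :
  `|permE (fun s => X c s * psi (T s)) - (\sum_b al b * K c b) * permE (fun s => dpsi (T s))|
  <= (w * 30 + crem) * del.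
Proof.
have n0 : 0 < n%:R :> R by apply: lt_le_trans n1.
rewrite -(ler_pM2l n0) -[X in X * `|_|](@ger0_norm _ n%:R)// -normrM mulrBr lstat_stein.
rewrite [n%:R * (_ * permE _)]mulrA.
pose err s := \sum_b (al b * (X b s * X c s) +
  be b * ((\sum_l a l * S b l s) * (n%:R * K c b) + X b s * B c b s - hterm h y a c b s)).
apply: le_trans (@expand_le _ _ _ _ _ HS _ _ hy al be psi dpsi (fun i _ => a i) c
   (n%:R * \sum_b al b * K c b) (w * 30 * (n%:R * del)) err hpsi hdpsi _ _ _) _.
- by move=> i s; rewrite lerDl sumr_ge0.
- move=> s; rewrite (tst_incr_sum HS hy).
  have -> : \sum_l a l * a l = 1 by rewrite -(sh_a2 HS); apply: eq_bigr.
  rewrite (sh_a0 HS) mulr_sumr -big_split; apply: eq_bigr => b _ /=.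
  by rewrite /S /K /xst /lstat; ring.
- rewrite /w !mulr_suml; apply: permE_norm_sum => b; rewrite -mulrA [leRHS]mulrDl.
  apply: permE_normD.
    apply: permE_normZ; apply: le_trans (XX_L1 _ _) _.
    by have := nd1; lra.
  apply: permE_normZ.
  rewrite (_ : 30 * (n%:R * del) = 2 * (n%:R * del) + 24 * (n%:R * del) + 4 * (n%:R * del)); last by ring.
  apply: permE_normB; last exact: hterm_a_L1.
  apply: permE_normD; first exact: aS_L1.
  by apply: le_trans (XB_L1 _ _ _) _; have := nd1; lra.
- by rewrite le_eqVlt; apply/orP; left; apply/eqP; ring.
Qed.

Lemma hdeg_wc_L2 c : permE (fun s => lstat (hdeg h) (wc (y c) (y c)) s ^+ 2) <= (3 * r) ^+ 2.
Proof.
have hw := wc_half HS (hy c) (hy c).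
under eq_permE do rewrite lstat_wc exprMn.
rewrite permEZ [leRHS]exprMn; have := lstat_var (hdeg h) (sh_n HS) (cf0 hw) (cf1 hw).
by have := hdeg_le; have := sqr_ge0 r; lra.
Qed.

(** The statistic Q is centred but [bstat] is not; centring psi instead has the same effect and also
    removes the constant part of the remainder of [bstat_stein]. *)
Let psic s := psi (T s) - permE (fun s => psi (T s)).

Lemma psic_L2 : permE (fun s => psic s ^+ 2) <= C0 ^+ 2.
Proof.
apply: le_trans hC0; rewrite /psic; set m := permE (fun s => psi (T s)).
have -> : permE (fun s => (psi (T s) - m) ^+ 2) = permE (fun s => psi (T s) ^+ 2) - m ^+ 2.
  transitivity (permE (fun s => psi (T s) ^+ 2 - 2 * m * psi (T s) + m ^+ 2)).
    by apply: eq_permE => s; ring.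
  by rewrite permED permEB permEZ permE_cst -/m; ring.
by rewrite lerBlDr lerDl sqr_ge0.
Qed.

Lemma psic0 : permE psic = 0.
Proof. by rewrite /psic permEB permE_cst subrr. Qed.

Lemma stein_Q_raw c :
  `|(n%:R - 1) * permE (fun s => B c c s * psic s)
    - n%:R * (2 * \sum_b be b * K c b ^+ 2) * permE (fun s => dpsi (T s))|
  <= (w * 200 + crem) * (n%:R * del) + 3 * r * C0.
Proof.
(* The remainder of [bstat_stein] is the sum of hdeg h i * y c (s i)^2 minus the statistic itself.
   The latter turns n into n - 1; the former is a centred linear statistic plus a constant, which
   [psic0] annihilates. *)
have e1 : (n%:R - 1) * permE (fun s => B c c s * psic s) =
   permE (fun s => \sum_i \sum_j S c i s * y c (s j) * (psi (T (sw i j s)) - psi (T s)))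
   - permE (fun s => lstat (hdeg h) (wc (y c) (y c)) s * psic s).
  rewrite mulrBl (bstat_stein _ (sh_h0 HS) (cf0 (hy c))) mul1r -addrA; congr (_ + _).
    apply: eq_permE => s; apply: eq_bigr => i _; apply: eq_bigr => j _.
    by rewrite /psic /S; ring.
  rewrite -opprD; congr (- _).
  transitivity (permE (fun s => lstat (hdeg h) (wc (y c) (y c)) s * psic s) +
     permE (fun s => (\sum_i hdeg h i) * K c c * psic s)); last first.
    by rewrite [X in _ + X]permEZ psic0 mulr0 addr0.
  rewrite -!permED.
  apply: eq_permE => s; rewrite -!mulrDl; congr (_ * _).
  transitivity (\sum_i hdeg h i * (y c (s i) * y c (s i))).
    rewrite /bstat -big_split; apply: eq_bigr => i _ /=.
    rewrite /lstat mulr_sumr -big_split /hdeg mulr_suml; apply: eq_bigr => j _ /=.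
    by ring.
  rewrite /lstat mulr_suml -big_split; apply: eq_bigr => i _ /=.
  by rewrite /wc /K; ring.
rewrite e1.
pose err s := \sum_b (al b * ((\sum_l a l * S c l s) * (n%:R * K c b)
     - (\sum_l S c l s) * (\sum_l a l * (y c (s l) * y b (s l))) + X c s * B b c s) +
  be b * ((\sum_l S c l s * S b l s - 2 * K c b) * (n%:R * K c b)
     - (\sum_l S c l s) * (\sum_l S b l s * (y c (s l) * y b (s l)))
     + B b c s * B c b s - hterm h y (fun i => S c i s) c b s)).
have h1 := @expand_le _ _ _ _ _ HS _ _ hy al be psi dpsi (fun i s => S c i s) c
   (n%:R * (2 * \sum_b be b * K c b ^+ 2)) (w * 200 * (n%:R * del)) err hpsi hdpsi.
have h2 : permE (fun s => `|lstat (hdeg h) (wc (y c) (y c)) s * psic s|) <= 3 * r * C0.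
  apply: permE_CS_le => //; [by rewrite mulr_ge0|exact: hdeg_wc_L2|exact: psic_L2].
rewrite addrAC; apply: le_trans (ler_normB _ _) _; apply: lerD; last first.
  by apply: le_trans (permE_norm _) h2.
apply: le_trans (h1 _ _ _) _.
- move=> i s; rewrite /uu (bigD1 c)//= addrA [`|a i| + _]addrC -addrA lerDl addr_ge0// sumr_ge0//.
- move=> s; rewrite (tst_incr_sum HS hy) 2!mulr_sumr -big_split; apply: eq_bigr => b _ /=.
  have -> : \sum_l S c l s * a l = \sum_l a l * S c l s by apply: eq_bigr => l _; rewrite mulrC.
  have -> : \sum_l S c l s * y b (s l) = B b c s.
    by apply: eq_bigr => l _; rewrite mulrC.
  by rewrite /S /K; ring.
- rewrite /w !mulr_suml; apply: permE_norm_sum => b; rewrite -mulrA [leRHS]mulrDl.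
  apply: permE_normD.
    apply: permE_normZ.
    apply: (@le_trans _ _ (2 * (n%:R * del) + 6 * (n%:R * del) + 22 * (n%:R * del))); last by have := nd1; have := rn; lra.
    apply: permE_normD; last exact: XB_L1.
    by apply: permE_normB; [exact: aS_L1|exact: sumS_aw_L1].
  apply: permE_normZ.
  (* 14 + 48 + 121 + 8 = 191, rounded up to 200. *)
  apply: (@le_trans _ _ (14 * (n%:R * del) + 48 * (n%:R * del) + 121 * (n%:R * del) + 8 * (n%:R * del))); last by have := nd1; have := rn; lra.
  apply: permE_normB; last exact: hterm_S_L1.
  apply: permE_normD; last exact: BB_L1.
  by apply: permE_normB; [exact: SS_K_L1|exact: sumS_wS_L1].
- by rewrite le_eqVlt; apply/orP; left; apply/eqP; ring.
Qed.

(** C0 bounds psi (T s) in L2 only, so that the statement covers sines, for characteristic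
    functions, and the identity, for variances. *)
Lemma stein_Q c :
  `|permE (fun s => Q c s * psi (T s)) - (\sum_b be b * K c b ^+ 2) * permE (fun s => dpsi (T s))|
  <= (w * 200 + crem + 14 * C0) * del.
Proof.
have n0 : 0 < n%:R :> R by apply: lt_le_trans n1.
have e : permE (fun s => B c c s * psic s) = 2 * permE (fun s => Q c s * psi (T s)).
  rewrite -permEZ; set q := permE (fun s => B c c s / 2).
  have eq1 : permE (fun s => B c c s) = 2 * q by rewrite -permEZ; apply: eq_permE => s; field.
  transitivity (permE (fun s => B c c s * psi (T s)) - permE (fun s => psi (T s)) * permE (fun s => B c c s)).
    by rewrite -permEZ -permEB; apply: eq_permE => s; rewrite /psic; ring.
  rewrite eq1 [_ * (2 * q)]mulrC -permEZ -permEB; apply: eq_permE => s.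
  by rewrite /qst -/q; field.
have hB : `|permE (fun s => B c c s * psic s)| <= 11 * C0.
  apply: le_trans (permE_norm _) _; apply: permE_CS_le => //; [exact: (Q_L2 HS)|exact: psic_L2].
have := stein_Q_raw c; rewrite e in hB *.
move: (permE (fun s => Q c s * psi (T s))) (permE (fun s => dpsi (T s))) (\sum_b _) hB => q D M hB hraw.
have h9 : `|n%:R * (2 * (q - M * D))| <= (w * 200 + crem) * (n%:R * del) + 3 * r * C0 + 11 * C0.
  have -> : n%:R * (2 * (q - M * D)) = ((n%:R - 1) * (2 * q) - n%:R * (2 * M) * D) + 2 * q by ring.
  by apply: le_trans (ler_normD _ _) _; apply: lerD.
rewrite normrM [`|n%:R|]ger0_norm// normrM [`|2|]ger0_norm// in h9.
rewrite -(ler_pM2l n0).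
have c0 : 0 <= crem by exact: crem_ge0.
have w0 : 0 <= w by exact: w_ge0.
have g1 : r * C0 <= n%:R * del * C0 by apply: ler_wpM2r.
have g2 : C0 <= n%:R * del * C0 by rewrite ler_peMl.
have g3 : 0 <= w * (n%:R * del) by rewrite mulr_ge0// mulr_ge0// ltW.
have g4 : 0 <= crem * (n%:R * del) by rewrite mulr_ge0// mulr_ge0// ltW.
move: (`|q - _|) h9 => t h9. move: (w) (r) crem g1 g2 g3 g4 h9 (C00) => w9 r9 c9 g1 g2 g3 g4 h9 C09; nra.
Qed.
End Psi.
End SteinXQ.

(** * Characteristic function of the combined statistic *)

Section CharFun.
Context {R : realType}.

Lemma sin_affine_taylor (s b x h : R) : `|s| <= 1 ->
  `|sin (s * (x + h) + b) - sin (s * x + b) - h * (s * cos (s * x + b))| <= h ^+ 2.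
Proof.
move=> s1; rewrite mulrDr [h * _]mulrA [h * s]mulrC [s * x + s * h + b]addrAC.
have cl (y z : R) : `|cos z - cos y| <= 1 * `|z - y| by rewrite mul1r cos_lipschitz.
apply: le_trans (derive_taylor1 (s * x + b) (s * h) (@is_derive_sin R) cl ler01) _.
rewrite mul1r exprMn ler_piMl ?sqr_ge0// -real_normK ?num_real//.
by rewrite exprn_ile1.
Qed.

Lemma is_derive_bigsum (I : Type) (l : seq I) (f df : I -> R -> R) (x : R) :
  (forall i, is_derive x 1 (f i) (df i x)) ->
  is_derive x 1 (fun t => \sum_(i <- l) f i t) (\sum_(i <- l) df i x).
Proof.
move=> hd; elim: l => [|i l IH].
  rewrite big_nil (_ : (fun t => _) = cst 0); first exact: is_derive_cst.
  by apply/funext => t; rewrite big_nil.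
rewrite big_cons (_ : (fun t => _) = (fun t => f i t + \sum_(i <- l) f i t)).
  by have := hd i => hi; exact: is_deriveD.
by apply/funext => t; rewrite big_cons.
Qed.

Lemma is_derive_permE_cos n (T : {perm 'I_n} -> R) (b x : R) :
  is_derive x 1 (fun t => permE (fun s => cos (t * T s + b)))
    (- permE (fun s => T s * sin (x * T s + b))).
Proof.
rewrite -permEN /permE.
have h0 : is_derive x 1 (fun t => \sum_(s : {perm 'I_n}) cos (t * T s + b))
   (\sum_(s : {perm 'I_n}) - (T s * sin (x * T s + b))).
  apply: (@is_derive_bigsum _ _ _ (fun s t => - (T s * sin (t * T s + b)))) => s.
  rewrite (_ : (fun t => _) = (fun t => cos (T s * t + b))); last first.
    by apply/funext => t; rewrite mulrC.
  by rewrite [x * T s]mulrC; exact: is_derive_cos_affine.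
by apply: is_derive_eq; rewrite /GRing.scale/=; ring.
Qed.
End CharFun.

Section CharT.
Context {R : realType} {n : nat}.
Variables (a : 'I_n -> R) (h : 'I_n -> 'I_n -> R) (del : R).
Hypothesis HS : stein_hyp a h del.
Variables (k : nat) (y : 'I_k -> 'I_n -> R).
Hypothesis hy : forall b, cfun (y b).
Variables al be : 'I_k -> R.
Let K c b := Kn (y c) (y b).
Let w := \sum_b (`|al b| + `|be b|).
Notation T := (tst a h y al be).

Definition lam : R := \sum_c (al c * (\sum_b al b * K c b) + be c * (\sum_b be b * K c b ^+ 2)).

Definition cchar : R := w * (w * 200 + crem al be + 14).

Lemma stein_T (psi dpsi : R -> R) :
  (forall x t, `|psi (x + t) - psi x - t * dpsi x| <= t ^+ 2) ->
  (forall x, `|dpsi x| <= 1) -> (forall x, `|psi x| <= 1) ->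
  `|permE (fun s => T s * psi (T s)) - lam * permE (fun s => dpsi (T s))| <= cchar * del.
Proof.
move=> hpsi hd h1.
have hC0 : permE (fun s => psi (T s) ^+ 2) <= 1 ^+ 2.
  rewrite -(@permE_cst R n (1 ^+ 2)); apply: permE_le => s.
  by rewrite -real_normK ?num_real// lerXn2r ?nnegrE.
have hX c := stein_X HS hy al be hpsi hd c.
have hQ c := stein_Q HS hy hpsi hd ler01 hC0 c.
have -> : permE (fun s => T s * psi (T s)) =
  \sum_c (al c * permE (fun s => xst a y c s * psi (T s)) + be c * permE (fun s => qst h y c s * psi (T s))).
  transitivity (permE (fun s => \sum_c (al c * (xst a y c s * psi (T s)) + be c * (qst h y c s * psi (T s))))).
    apply: eq_permE => s; rewrite {1}/tst mulr_suml; apply: eq_bigr => c _; ring.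
  by rewrite permE_sum; apply: eq_bigr => c _; rewrite permED !permEZ.
rewrite /lam mulr_suml -sumrB.
apply: le_trans (ler_norm_sum _ _ _) _.
rewrite /cchar -mulrA {1}/w mulr_suml; apply: ler_sum => c _.
set D := permE (fun s => dpsi (T s)).
have -> : al c * permE (fun s => xst a y c s * psi (T s)) + be c * permE (fun s => qst h y c s * psi (T s))
   - (al c * (\sum_b al b * K c b) + be c * (\sum_b be b * K c b ^+ 2)) * D =
   al c * (permE (fun s => xst a y c s * psi (T s)) - (\sum_b al b * K c b) * D)
   + be c * (permE (fun s => qst h y c s * psi (T s)) - (\sum_b be b * K c b ^+ 2) * D) by ring.
have d0 := sh_del0 HS; have w0 : 0 <= w by exact: w_ge0.
apply: le_trans (ler_normD _ _) _; rewrite mulrDl !normrM; apply: lerD; apply: ler_wpM2l => //.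
  apply: le_trans (hX c) _; rewrite ler_pM2r// -/w; move: (w) w0 => w9 w90; lra.
by apply: le_trans (hQ c) _; rewrite ler_pM2r// mulr1.
Qed.

Lemma lam_le : `|lam| <= w ^+ 2.
Proof.
have K1 c b : `|K c b| <= 1 by exact: (Kn_le1 HS).
have K2 c b : `|K c b ^+ 2| <= 1 by rewrite normrX exprn_ile1.
rewrite expr2 {1}/w mulr_suml; apply: le_trans (ler_norm_sum _ _ _) _.
apply: ler_sum => c _; apply: le_trans (ler_normD _ _) _.
rewrite mulrDl !normrM; apply: lerD; apply: ler_wpM2l => //.
  apply: le_trans (ler_norm_sum _ _ _) _; apply: ler_sum => b _; rewrite normrM.
  apply: (@le_trans _ _ `|al b|); first by rewrite ler_piMr.
  by rewrite lerDl.
apply: le_trans (ler_norm_sum _ _ _) _; apply: ler_sum => b _; rewrite normrM.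
apply: (@le_trans _ _ `|be b|); first by rewrite ler_piMr.
by rewrite lerDr.
Qed.

(** [phi] is the characteristic function divided by its Gaussian candidate. With psi x = sin (t x +
    b), [stein_T] says exactly that its derivative is small, and the mean value theorem on [0, 1]
    concludes. Only the size of [lam] enters, through [lam_le]. *)
Lemma char_le (b : R) :
  `|permE (fun s => cos (T s + b)) - expR (- lam / 2) * cos b| <= expR (w ^+ 2) * (cchar * del).
Proof.
pose c (t : R) := permE (fun s => cos (t * T s + b)).
pose phi t := expR (lam / 2 * t ^+ 2) * c t.
pose dphi t := expR (lam / 2 * t ^+ 2) * (lam * t * c t - permE (fun s => T s * sin (t * T s + b))).
have dP (t : R) : is_derive t 1 phi (dphi t).
  have h1 : is_derive t 1 (fun t : R => lam / 2 * t ^+ 2) (lam * t).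
    by apply: is_derive_eq; rewrite /GRing.scale/=; field.
  have h2 := is_derive_expR_comp h1; have h3 := is_derive_permE_cos T b t.
  by apply: is_derive_eq; rewrite /GRing.scale/= /dphi /c; ring.
have [t t1 e] := MVT_between 0 1 dP.
rewrite !subr0 normr1 mulr1 in t1 e.
have e0 : phi 0 = cos b.
  rewrite /phi /c expr0n/= mulr0 expR0 mul1r.
  rewrite (eq_permE (g := fun=> cos b)) ?permE_cst// => s.
  by rewrite mul0r add0r.
have e1 : phi 1 = expR (lam / 2) * permE (fun s => cos (T s + b)).
  rewrite /phi /c expr1n mulr1; congr (_ * _).
  by apply: eq_permE => s; rewrite mul1r.
have hs := @stein_T (fun x => sin (t * x + b)) (fun x => t * cos (t * x + b)).
have {hs} : `|permE (fun s => T s * sin (t * T s + b)) - lam * permE (fun s => t * cos (t * T s + b))| <= cchar * del.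
  apply: hs => x.
  - by move=> z; exact: sin_affine_taylor.
  - by rewrite normrM; apply: le_trans t1; rewrite ler_piMr// cos_norm_le1.
  - exact: sin_norm_le1.
rewrite permEZ distrC mulrA => hs.
have dphi_le : `|dphi t| <= expR (w ^+ 2 / 2) * (cchar * del).
  rewrite normrM; apply: ler_pM => //.
  rewrite ger0_norm ?expR_ge0// ler_expR mulrAC ler_pM2r ?invr_gt0//.
  apply: le_trans lam_le.
  apply: le_trans (ler_norm _) _; rewrite normrM ler_piMr//.
  by rewrite normrX exprn_ile1.
have -> : permE (fun s => cos (T s + b)) - expR (- lam / 2) * cos b = expR (- lam / 2) * dphi t.
  rewrite -e e1 e0 mulrBr mulrA -expRD -mulrDl addNr mul0r expR0 mul1r//.
rewrite normrM ger0_norm ?expR_ge0//.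
apply: le_trans (ler_wpM2l (expR_ge0 _) dphi_le) _.
rewrite [leLHS]mulrA -expRD; apply: ler_wpM2r.
  apply: le_trans (normr_ge0 _) hs.
rewrite ler_expR; have := lam_le; rewrite ler_norml; lra.
Qed.

End CharT.

(** * Variances of the two statistics *)

Section Variances.
Context {R : realType} {n : nat}.
Variables (a : 'I_n -> R) (h : 'I_n -> 'I_n -> R) (del : R).
Hypothesis HS : stein_hyp a h del.
Variable (y : 'I_n -> R).
Hypothesis hy : cfun y.

Definition qc s := bstat h y y s / 2 - permE (fun s => bstat h y y s / 2).

Lemma centered_L2_le (f : {perm 'I_n} -> R) :
  permE (fun s => (f s - permE f) ^+ 2) <= permE (fun s => f s ^+ 2).
Proof.
set m := permE f.
have -> : permE (fun s => (f s - m) ^+ 2) = permE (fun s => f s ^+ 2) - m ^+ 2.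
  transitivity (permE (fun s => f s ^+ 2 - 2 * m * f s + m ^+ 2)).
    by apply: eq_permE => s; ring.
  by rewrite permED permEB permEZ permE_cst -/m; ring.
by rewrite lerBlDr lerDl sqr_ge0.
Qed.

Lemma qc_L2 : permE (fun s => qc s ^+ 2) <= 6 ^+ 2.
Proof.
apply: le_trans (centered_L2_le _) _.
rewrite (eq_permE (g := fun s => 2^-1 ^+ 2 * bstat h y y s ^+ 2)) => [|s]; last by rewrite exprMn mulrC.
by rewrite permEZ; have := Q_L2 HS hy hy; lra.
Qed.

(** [stein_Q] with psi the identity, a single window and weights al = 0, be = 1, for which T is [qc]
    itself. The constant covers 200 + 16 (132 + 256) + 14 * 6 = 6492. *)
Lemma qc_var : `|permE (fun s => qc s ^+ 2) - Kn y y ^+ 2| <= 6508 * del.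
Proof.
pose y' (b : 'I_1) := y; pose al (b : 'I_1) := 0 : R; pose be (b : 'I_1) := 1 : R.
have hy' b : cfun (y' b) by [].
have TE s : tst a h y' al be s = qc s.
  by rewrite /tst big_ord1 mul0r add0r mul1r.
have hpsi (x t : R) : `|id (x + t) - id x - t * (fun=> 1) x| <= t ^+ 2.
  by rewrite /= (_ : _ - _ - _ = 0) ?normr0 ?sqr_ge0//; ring.
have hd (x : R) : `|(fun=> 1 : R) x| <= 1 by rewrite normr1.
have hC0 : permE (fun s => id (tst a h y' al be s) ^+ 2) <= 6 ^+ 2.
  by under eq_permE do rewrite /= TE; exact: qc_L2.
have := stein_Q HS hy' hpsi hd (ler0n R 6) hC0 ord0.
rewrite permE_cst mulr1 !big_ord1 /be /al /crem !big_ord1 normr0 normr1 add0r !mul1r !expr1n !mulr1.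
rewrite (eq_permE (g := fun s => qc s ^+ 2)) => [|s]; last by rewrite TE expr2.
move=> hq; apply: le_trans hq _; rewrite ler_pM2r ?(sh_del0 HS)//.
by clear hd hpsi hC0; lra.
Qed.

(** The exact covariance formula makes the difference equal to K / (n - 1). *)
Lemma xst_var : `|permE (fun s => lstat a y s ^+ 2) - Kn y y| <= 2 * del.
Proof.
have := lstat_cov y (sh_a0 HS) (cf0 hy).
rewrite (sh_a2 HS) mul1r (KnE HS).
rewrite -[permE (fun s => lstat a y s * lstat a y s)]/(permE (fun s => lstat a y s ^+ 2)).
have := Kn_le1 HS hy hy; have := ndel_ge1 HS.
have n2 : 2 <= n%:R :> R by rewrite (ler_nat _ 2) (sh_n HS).
have d0 := sh_del0 HS.
move: (permE _) (Kn _ _) => E K h1 h2 h3.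
have e : (n%:R - 1) * (E - K) = K by rewrite mulrBr h3; ring.
have n1 : 0 < n%:R - 1 :> R by lra.
rewrite -(ler_pM2l n1) -[X in X * `|_|](@gtr0_norm _ (n%:R - 1))// -normrM e.
by apply: le_trans h2 _; nra.
Qed.
End Variances.

(** * Edge counts of a graph *)

Section GraphSums.
Context {R : realType} {n : nat}.
Variable g : rel 'I_n.
Hypotheses (gsym : symmetric g) (girr : irreflexive g).
Definition adj i j : R := (g i j)%:R.
Definition degr i : R := #|inc_edges g i|%:R.
Definition nedges : R := #|edges g|%:R.
Definition Asq : R := \sum_(e in edges g) (#|Aset g e| ^ 2)%:R.

Lemma adj_sym i j : adj i j = adj j i. Proof. by rewrite /adj gsym. Qed.

Lemma adj_ge0 i j : 0 <= adj i j. Proof. exact: ler0n. Qed.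

Lemma adj_le1 i j : adj i j <= 1. Proof. by rewrite /adj; case: (g i j). Qed.

Lemma adj_sqr i j : adj i j ^+ 2 = adj i j.
Proof. by rewrite /adj; case: (g i j); rewrite ?expr1n ?expr0n. Qed.

Lemma adj_diag i : adj i i = 0. Proof. by rewrite /adj girr. Qed.

Lemma edge_sum_lt (F : 'I_n -> 'I_n -> R) :
  \sum_(e in edges g) F e.1 e.2 = \sum_(i < n) \sum_(j < n | (i < j)%N) adj i j * F i j.
Proof.
rewrite big_mkcond/= (eq_bigr (fun e : 'I_n * 'I_n =>
   if (e.1 < e.2)%N then adj e.1 e.2 * F e.1 e.2 else 0)).
  rewrite -(pair_bigA _ (fun i j : 'I_n => if (i < j)%N then adj i j * F i j else 0))/=.
  by apply: eq_bigr => i _; rewrite [RHS]big_mkcond.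
move=> e _; rewrite inE /adj; case: ltnP => //= _.
by case: (g _ _); rewrite ?mul1r ?mul0r.
Qed.

(** Edges are stored once, with increasing endpoints, while the statistics sum over ordered pairs;
    this is the passage between the two. *)
Lemma edge_sum (F : 'I_n -> 'I_n -> R) :
  \sum_(e in edges g) (F e.1 e.2 + F e.2 e.1) = \sum_i \sum_j adj i j * F i j.
Proof.
rewrite (edge_sum_lt (fun i j => F i j + F j i)).
have -> : \sum_i \sum_j adj i j * F i j = \sum_(i < n) \sum_(j < n | (i < j)%N) adj i j * F i j +
   \sum_(i < n) \sum_(j < n | (j < i)%N) adj i j * F i j.
  rewrite -big_split; apply: eq_bigr => i _ /=.
  rewrite (bigID (fun j : 'I_n => (i < j)%N))/=; congr (_ + _).
  rewrite [RHS](big_mkcond)/= [LHS]big_mkcond/=; apply: eq_bigr => j _.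
  rewrite -leqNgt leq_eqVlt; case: eqP => [/val_inj ->|_]//=.
  by rewrite ltnn adj_diag mul0r.
have -> : \sum_(i < n) \sum_(j < n | (j < i)%N) adj i j * F i j = \sum_(i < n) \sum_(j < n | (i < j)%N) adj i j * F j i.
  rewrite (exchange_big_dep xpredT)//=; apply: eq_bigr => i _.
  by apply: eq_bigr => j _; rewrite adj_sym.
rewrite -big_split; apply: eq_bigr => i _ /=; rewrite -big_split.
by apply: eq_bigr => j _ /=; rewrite mulrDr.
Qed.

Lemma degrE i : degr i = \sum_j adj i j.
Proof.
rewrite /degr -sum1_card natr_sum.
have -> : \sum_(e in inc_edges g i) 1%:R = \sum_(e in edges g) ((e.1 == i)%:R + (e.2 == i)%:R : R).
  rewrite [LHS]big_mkcond [RHS]big_mkcond/=; apply: eq_bigr => e _.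
  rewrite !inE; case: ltnP => //= lt12; case: (g _ _) => //=.
  have [e1|e1] := eqVneq e.1 i; have [e2|e2] := eqVneq e.2 i => //=; rewrite ?addr0 ?add0r//.
  by move: lt12; rewrite e1 e2 ltnn.
rewrite (edge_sum (fun a b => (a == i)%:R)) (bigD1 i)//= [X in _ + X]big1 => [|l li].
  by rewrite addr0; apply: eq_bigr => j _; rewrite eqxx mulr1.
by apply: big1 => j _; rewrite (negbTE li) mulr0.
Qed.

Lemma degr_ge0 i : 0 <= degr i. Proof. exact: ler0n. Qed.

Lemma sum_adj : \sum_i \sum_j adj i j = 2 * nedges.
Proof.
transitivity (\sum_i \sum_j adj i j * (fun _ _ => 1 : R) i j).
  by apply: eq_bigr => i _; apply: eq_bigr => j _; rewrite mulr1.
rewrite -edge_sum /nedges -sum1_card natr_sum mulr_sumr.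
by apply: eq_bigr => e _; rewrite mulr1.
Qed.

Lemma sum_degr : \sum_i degr i = 2 * nedges.
Proof. by rewrite -sum_adj; apply: eq_bigr => i _; rewrite degrE. Qed.

Lemma degr_le_A e : degr e.1 <= #|Aset g e|%:R /\ degr e.2 <= #|Aset g e|%:R.
Proof.
by split; rewrite ler_nat; apply: subset_leq_card; rewrite /Aset ?finset.subsetUl ?finset.subsetUr.
Qed.

Lemma A_ge1 e : e \in edges g -> 1 <= #|Aset g e|%:R :> R.
Proof.
move=> eE; rewrite ler1n; apply/card_gt0P; exists e.
by rewrite !inE eqxx; move: eE; rewrite inE => ->.
Qed.

(** Both endpoint degrees are at most |A_e|, and |A_e| >= 1 on edges, so any sum over adjacent pairs
    of terms at most quadratic in the degrees can be charged to [Asq]. *)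
Lemma edge_bound (F : 'I_n -> 'I_n -> R) :
  (forall e, e \in edges g -> F e.1 e.2 + F e.2 e.1 <= 2 * #|Aset g e|%:R ^+ 2) ->
  \sum_i \sum_j adj i j * F i j <= 2 * Asq.
Proof.
move=> hF; rewrite -edge_sum /Asq mulr_sumr; apply: ler_sum => e eE.
by rewrite natrX; exact: hF.
Qed.

Lemma sum_degr2 : \sum_i degr i ^+ 2 <= 2 * Asq.
Proof.
have -> : \sum_i degr i ^+ 2 = \sum_i \sum_j adj i j * degr i.
  by apply: eq_bigr => i _; rewrite expr2 {1}degrE mulr_suml.
apply: (@edge_bound (fun i j => degr i)) => e eE.
have [h1 h2] := degr_le_A e; have := A_ge1 eE; nra.
Qed.

Lemma sum_degr3 : \sum_i degr i ^+ 3 <= 2 * Asq.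
Proof.
have -> : \sum_i degr i ^+ 3 = \sum_i \sum_j adj i j * degr i ^+ 2.
  by apply: eq_bigr => i _; rewrite exprS {1}degrE mulr_suml.
apply: (@edge_bound (fun i j => degr i ^+ 2)) => e eE.
have [h1 h2] := degr_le_A e; have := A_ge1 eE.
have := degr_ge0 e.1; have := degr_ge0 e.2; nra.
Qed.

Definition codeg l m : R := \sum_i adj l i * adj i m.

(** The left side counts closed 4-walks. Dropping the closing adjacency leaves walks with three
    edges; summing over the two end vertices gives degree products along the middle edge. *)
Lemma sum_codeg2 : \sum_l \sum_m codeg l m ^+ 2 <= 2 * Asq.
Proof.
apply: (@le_trans _ _ (\sum_i \sum_m adj i m * (degr i * degr m))); last first.
  apply: (@edge_bound (fun i j => degr i * degr j)) => e eE.
  have [h1 h2] := degr_le_A e; have := A_ge1 eE.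
  have := degr_ge0 e.1; have := degr_ge0 e.2; nra.
apply: (@le_trans _ _ (\sum_l \sum_m \sum_i \sum_i' (adj l i * adj i m) * adj i' m)).
  apply: ler_sum => l _; apply: ler_sum => m _.
  rewrite expr2 /codeg mulr_suml; apply: ler_sum => i _.
  rewrite mulr_sumr; apply: ler_sum => i' _.
  apply: ler_wpM2l; first by rewrite mulr_ge0 ?adj_ge0.
  by rewrite ler_piMl ?adj_ge0 ?adj_le1.
rewrite le_eqVlt; apply/orP; left; apply/eqP.
rewrite exchange_big/= exchange_big [RHS]exchange_big/=.
rewrite [LHS]exchange_big/=; apply: eq_bigr => m _.
rewrite exchange_big/=; apply: eq_bigr => i _.
transitivity (\sum_l (adj l i * adj i m) * degr m).
  apply: eq_bigr => l _; rewrite degrE mulr_sumr; apply: eq_bigr => i' _.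
  by rewrite (adj_sym m).
rewrite -mulr_suml -mulr_suml [degr i]degrE mulrCA mulrA; congr (_ * _ * _).
by apply: eq_bigr => l _; rewrite adj_sym.
Qed.

Definition dmean : R := 2 * nedges / n%:R.
(** Kept in the form of the hypothesis; [dvarE] identifies it with the sum of squared degree
    deviations. *)
Definition dvar : R := \sum_i degr i ^+ 2 - 4 * nedges ^+ 2 / n%:R.

Hypothesis n1 : (1 < n)%N.
Let n0 : n%:R != 0 :> R. Proof. by rewrite pnatr_eq0 -lt0n ltnW. Qed.
Let np : 0 < n%:R :> R. Proof. by rewrite ltr0n ltnW. Qed.

Lemma dvarE : \sum_i (degr i - dmean) ^+ 2 = dvar.
Proof.
have -> : \sum_i (degr i - dmean) ^+ 2 = \sum_i (degr i ^+ 2 - 2 * dmean * degr i + dmean ^+ 2).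
  by apply: eq_bigr => i _; ring.
rewrite big_split sumrB/= -mulr_sumr sum_degr sum_cst_ord /dvar /dmean; field.
exact: n0.
Qed.

Lemma dmean0 : \sum_i (degr i - dmean) = 0.
Proof. by rewrite sumrB sum_degr sum_cst_ord /dmean [n%:R * _]mulrC divfK// subrr. Qed.

Lemma sum_degr_CS : 4 * nedges ^+ 2 / n%:R <= \sum_i degr i ^+ 2.
Proof.
rewrite ler_pdivrMr//; have := sum_sqr_le degr; rewrite card_ord sum_degr exprMn mulrC.
by rewrite (_ : 2 ^+ 2 = 4) ?(mulrC 4) ?[n%:R * _]mulrC// -natrX.
Qed.

Lemma dev_cube : \sum_i `|degr i - dmean| ^+ 3 <= 16 * Asq.
Proof.
have m0 : 0 <= dmean by rewrite divr_ge0 ?mulr_ge0// ler0n.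
(* Power mean inequality: the cubed mean costs no more than the cubed degrees. *)
have h1 : n%:R * dmean ^+ 3 <= \sum_i degr i ^+ 3.
  have := cube_sum_le degr_ge0; rewrite card_ord sum_degr.
  have -> : 2 * nedges = n%:R * dmean by rewrite /dmean [RHS]mulrC divfK.
  have -> : (n%:R * dmean) ^+ 3 = n%:R ^+ 2 * (n%:R * dmean ^+ 3) by ring.
  by rewrite ler_pM2l// exprn_gt0.
apply: (@le_trans _ _ (\sum_i (4 * degr i ^+ 3 + 4 * dmean ^+ 3))).
  apply: ler_sum => i _; apply: le_trans (cube_add_le (degr_ge0 i) m0).
  rewrite lerXn2r ?nnegrE ?addr_ge0 ?degr_ge0//.
  apply: le_trans (ler_normB _ _) _.
  by rewrite (ger0_norm (degr_ge0 i)) (ger0_norm m0).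
by rewrite big_split/= sum_cst_ord -mulr_sumr; have := sum_degr3; lra.
Qed.

Definition avec i : R := (degr i - dmean) / Num.sqrt dvar.
Definition hmat i j : R := adj i j / Num.sqrt nedges.

(** After normalisation, each field of [stein_hyp] that involves degrees or walks is a graph sum
    bounded by [Asq], divided by a power of [dvar] or [nedges]; the four inequalities are what these
    quotients require. *)
Lemma graph_stein_hyp (del : R) : 0 < nedges -> 0 < dvar -> 0 < del -> del <= 1 ->
  1 <= n%:R * del ^+ 2 ->
  2 * Asq <= n%:R * del ^+ 2 * nedges ->
  16 * Asq <= del * (dvar * Num.sqrt dvar) ->
  2 * Asq <= del * (nedges * Num.sqrt nedges) ->
  2 * Asq <= (del ^+ 2) ^+ 2 * nedges ^+ 2 ->
  stein_hyp avec hmat del.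
Proof.
move=> E0 V0 d0 d1 nd hb1 hb2 hb3 hb4.
have sE0 : 0 < Num.sqrt nedges by rewrite sqrtr_gt0.
have sV0 : 0 < Num.sqrt dvar by rewrite sqrtr_gt0.
have sE : Num.sqrt nedges ^+ 2 = nedges by rewrite sqr_sqrtr// ltW.
have sV : Num.sqrt dvar ^+ 2 = dvar by rewrite sqr_sqrtr// ltW.
have hdegE i : hdeg hmat i = degr i / Num.sqrt nedges.
  by rewrite /hdeg /hmat -mulr_suml degrE.
have rhoE i : rho hmat i = degr i / nedges.
  rewrite /rho /hmat; under eq_bigr do rewrite expr_div_n sE adj_sqr.
  by rewrite -mulr_suml degrE.
have hsqE l m : hsq hmat l m = codeg l m / nedges.
  rewrite /hsq /hmat /codeg mulr_suml; apply: eq_bigr => i _.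
  rewrite -{3}sE; field; exact: lt0r_neq0.
split => //.
- by rewrite /avec -mulr_suml dmean0 mul0r.
- rewrite /avec; under eq_bigr do rewrite expr_div_n sV.
  by rewrite -mulr_suml dvarE divff// lt0r_neq0.
- by move=> i; rewrite /hmat adj_diag mul0r.
- by move=> i j; rewrite /hmat adj_sym.
- by move=> i j; rewrite /hmat divr_ge0 ?adj_ge0// ltW.
- under eq_bigr do rewrite rhoE.
  by rewrite -mulr_suml sum_degr mulfK// lt0r_neq0.
- under eq_bigr do rewrite hdegE expr_div_n sE.
  by rewrite -mulr_suml ler_pdivrMr//; apply: le_trans sum_degr2 hb1.
- have -> : \sum_i `|avec i| ^+ 3 = (\sum_i `|degr i - dmean| ^+ 3) / (dvar * Num.sqrt dvar).
    rewrite mulr_suml; apply: eq_bigr => i _.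
    rewrite /avec normrM normfV (gtr0_norm sV0) -{2}sV; field; exact: lt0r_neq0.
  by rewrite ler_pdivrMr ?mulr_gt0//; apply: le_trans dev_cube hb2.
- have -> : \sum_i hdeg hmat i * rho hmat i = (\sum_i degr i ^+ 2) / (nedges * Num.sqrt nedges).
    rewrite mulr_suml; apply: eq_bigr => i _.
    by rewrite hdegE rhoE; field; rewrite !lt0r_neq0.
  by rewrite ler_pdivrMr ?mulr_gt0//; apply: le_trans sum_degr2 hb3.
- have -> : \sum_i \sum_j hsq hmat i j ^+ 2 = (\sum_i \sum_j codeg i j ^+ 2) / nedges ^+ 2.
    rewrite mulr_suml; apply: eq_bigr => i _; rewrite mulr_suml; apply: eq_bigr => j _.
    by rewrite hsqE expr_div_n.
  by rewrite ler_pdivrMr ?exprn_gt0//; apply: le_trans sum_codeg2 hb4.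
Qed.
End GraphSums.

(** * Standardisation *)

Section Standardize.
Context {R : realType} {n : nat}.
Implicit Types f u : {perm 'I_n} -> R.

Lemma standardize_affine f u (c k : R) : 0 < c -> (forall s, f s = c * u s + k) ->
  standardize f =1 standardize u.
Proof.
move=> c0 fE s; rewrite /standardize /permSD.
have Ef : permE f = c * permE u + k.
  by rewrite (eq_permE fE) permED permEZ permE_cst.
have e t : f t - permE f = c * (u t - permE u) by rewrite fE Ef; ring.
have v : permE (fun s => (f s - permE f) ^+ 2) = c ^+ 2 * permE (fun s => (u s - permE u) ^+ 2).
  by rewrite -permEZ; apply: eq_permE => t; rewrite e exprMn.
rewrite e v sqrtrM ?sqr_ge0// sqrtr_sqr gtr0_norm// -mulf_div divff ?mul1r//.
exact: lt0r_neq0.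
Qed.

Lemma eq_standardize f u : f =1 u -> standardize f =1 standardize u.
Proof. by move=> /funext ->. Qed.

(** An inequality, not an equality: when the variance is 0 the division returns 0. The bound thus
    holds for every n and supplies tightness. *)
Lemma standardize_L2 f : permE (fun s => standardize f s ^+ 2) <= 1.
Proof.
rewrite (eq_permE (g := fun s => (permSD f ^+ 2)^-1 * (f s - permE f) ^+ 2)) => [|s]; last first.
  by rewrite /standardize expr_div_n mulrC.
have v0 : 0 <= permE (fun s => (f s - permE f) ^+ 2).
  by apply: permE_ge0 => s; exact: sqr_ge0.
rewrite permEZ /permSD sqr_sqrtr//.
by have [->|nz] := eqVneq (permE (fun s => (f s - permE f) ^+ 2)) 0; rewrite ?mulr0// mulVf.
Qed.

Lemma permE_lstat (b y : 'I_n -> R) : \sum_p y p = 0 -> permE (lstat b y) = 0.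
Proof.
move=> y0; rewrite /lstat permE_sum big1// => i _; rewrite permEZ.
apply/eqP; rewrite mulf_eq0; apply/orP; right.
have := swap_stein i (fun=> 1) y0.
rewrite [RHS](_ : _ = 0); last first.
  rewrite -[RHS](@permE_cst R n); apply: eq_permE => s.
  by apply: big1 => j _; rewrite subrr mulr0.
under eq_permE do rewrite mulr1.
move/eqP; rewrite mulf_eq0 => /orP[|//]; rewrite pnatr_eq0 => /eqP n0.
by exfalso; move: i; rewrite n0 => -[].
Qed.
End Standardize.

(** * Edge counts as linear and bilinear statistics *)

Section GraphStats.
Context {R : realType} {n : nat}.
Variable g : rel 'I_n.
Hypotheses (gsym : symmetric g) (girr : irreflexive g) (n2 : (2 < n)%N).
Variable p : pred nat.
Definition pcount : R := \sum_(i < n) (p i)%:R.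
Definition yv (q : 'I_n) : R := (p q)%:R - pcount / n%:R.
Definition inst (s : {perm 'I_n}) : R :=
  #|[set e in edges g | p (s e.1) && p (s e.2)]|%:R.
Definition outst (s : {perm 'I_n}) : R :=
  #|[set e in edges g | ~~ p (s e.1) && ~~ p (s e.2)]|%:R.
Definition dstat s := inst s - outst s.
(** The predicate p selects the positions of the first count R_1: an initial segment for a single
    change point, the complement of the window for a changed interval. *)
Definition wstat s := (n%:R - pcount - 1) / (n%:R - 2) * inst s + (pcount - 1) / (n%:R - 2) * outst s.
Local Notation E := (@nedges R _ g).
Local Notation V := (@dvar R _ g).
Local Notation a := (@avec R _ g).
Local Notation h := (@hmat R _ g).
Hypotheses (E0 : 0 < E) (V0 : 0 < V).

Let np : 0 < n%:R :> R. Proof. by rewrite ltr0n (leq_trans _ n2). Qed.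
Let nn0 : n%:R != 0 :> R. Proof. exact: lt0r_neq0. Qed.
Let n20 : n%:R - 2 != 0 :> R.
Proof. by rewrite lt0r_neq0// subr_gt0 (ltr_nat _ 2). Qed.

Lemma pcount_ge0 : 0 <= pcount. Proof. by apply: sumr_ge0. Qed.

Lemma pcount_le : pcount <= n%:R.
Proof.
rewrite -[n in leRHS]card_ord -sum1_card natr_sum; apply: ler_sum => i _.
by rewrite ler_nat; case: (p i).
Qed.

Lemma yv_cfun : cfun yv.
Proof.
split=> [|q].
  by rewrite /yv sumrB sum_cst_ord [n%:R * _]mulrC divfK// subrr.
have h0 : 0 <= pcount / n%:R by rewrite divr_ge0 ?pcount_ge0.
have h1 : pcount / n%:R <= 1 by rewrite ler_pdivrMr// mul1r pcount_le.
by rewrite /yv ler_norml; case: (p q) => /=; rewrite ?mulr1n ?mulr0n; lra.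
Qed.

Lemma inst_sum s : inst s = \sum_(e in edges g) (p (s e.1))%:R * (p (s e.2))%:R.
Proof.
rewrite /inst -sum1_card natr_sum.
rewrite (eq_bigl (fun e => (e \in edges g) && (p (s e.1) && p (s e.2)))); last first.
  by move=> e; rewrite !inE.
rewrite big_mkcondr/=; apply: eq_bigr => e _.
by case: (p _); case: (p _); rewrite /= ?mulr1 ?mulr0.
Qed.

Lemma outst_sum s : outst s = \sum_(e in edges g) (1 - (p (s e.1))%:R) * (1 - (p (s e.2))%:R).
Proof.
rewrite /outst -sum1_card natr_sum.
rewrite (eq_bigl (fun e => (e \in edges g) && (~~ p (s e.1) && ~~ p (s e.2)))); last first.
  by move=> e; rewrite !inE.
rewrite big_mkcondr/=; apply: eq_bigr => e _.
by case: (p _); case: (p _); rewrite /= ?subrr ?subr0 ?mulr1 ?mulr0.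
Qed.

Lemma edge_sum_y (s : {perm 'I_n}) : \sum_(e in edges g) (yv (s e.1) + yv (s e.2)) = Num.sqrt V * lstat a yv s.
Proof.
rewrite (edge_sum gsym girr (fun i j => yv (s i))).
transitivity (\sum_i (degr g i - dmean g) * yv (s i)).
  under [RHS]eq_bigr do rewrite mulrBl.
  rewrite sumrB -mulr_sumr sum_perm (cf0 yv_cfun) mulr0 subr0.
  by apply: eq_bigr => i _; rewrite -mulr_suml degrE.
rewrite /lstat mulr_sumr; apply: eq_bigr => i _; rewrite /avec.
by field; rewrite lt0r_neq0// sqrtr_gt0.
Qed.

Lemma edge_sum_yy (s : {perm 'I_n}) : \sum_(e in edges g) yv (s e.1) * yv (s e.2) =
  Num.sqrt E * (bstat h yv yv s / 2).
Proof.
transitivity (\sum_i \sum_j adj g i j * (yv (s i) * yv (s j) / 2)).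
  rewrite -(edge_sum gsym girr (fun i j => yv (s i) * yv (s j) / 2)).
  by apply: eq_bigr => e _; field.
rewrite /bstat mulr_suml mulr_sumr; apply: eq_bigr => i _.
rewrite /lstat mulr_sumr mulr_suml mulr_sumr; apply: eq_bigr => j _.
rewrite /hmat; field; rewrite lt0r_neq0// sqrtr_gt0//.
Qed.

(** On each edge, x x' - (1 - x)(1 - x') = x + x' - 1 is affine in the indicators. *)
Lemma dstatE : exists k, forall s, dstat s = Num.sqrt V * lstat a yv s + k.
Proof.
exists (\sum_(e in edges g) (2 * (pcount / n%:R) - 1)) => s.
rewrite -edge_sum_y /dstat inst_sum outst_sum -sumrB -big_split.
by apply: eq_bigr => e _ /=; rewrite /yv; ring.
Qed.

(** The two weights of R_w add up to 1 on products of centred indicators, but on their sums they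
    leave only (1 - 2 pcount / n) / (n - 2). *)
Definition weps : R := (1 - 2 * (pcount / n%:R)) / (n%:R - 2) * (Num.sqrt V / Num.sqrt E).

Lemma wstatE : exists k, forall s,
  wstat s = Num.sqrt E * (bstat h yv yv s / 2 + weps * lstat a yv s) + k.
Proof.
pose pi0 := pcount / n%:R.
exists (\sum_(e in edges g) ((n%:R - pcount - 1) / (n%:R - 2) * pi0 ^+ 2 +
   (pcount - 1) / (n%:R - 2) * (1 - pi0) ^+ 2)) => s.
have sE : Num.sqrt E != 0 by rewrite lt0r_neq0// sqrtr_gt0.
have -> : Num.sqrt E * (bstat h yv yv s / 2 + weps * lstat a yv s) =
   Num.sqrt E * (bstat h yv yv s / 2) + (1 - 2 * pi0) / (n%:R - 2) * (Num.sqrt V * lstat a yv s).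
  by rewrite /weps -/pi0; field; rewrite n20 sE.
rewrite -edge_sum_y -edge_sum_yy mulr_sumr -big_split -big_split.
rewrite /wstat inst_sum outst_sum !mulr_sumr -big_split.
apply: eq_bigr => e _ /=.
have pE : pcount = n%:R * pi0 by rewrite /pi0 [RHS]mulrC divfK.
by rewrite /yv -/pi0 pE; field; exact: n20.
Qed.

(** V is at most the sum of squared degrees, hence at most E n del^2; so the ratio of square roots
    is at most sqrt n * del, and sqrt n <= n - 2 from n = 4 on. *)
Lemma weps_le del : stein_hyp a h del -> (3 < n)%N -> `|weps| <= del.
Proof.
move=> HS n3.
have n4 : 4 <= n%:R :> R by rewrite (ler_nat _ 4).
have d0 := sh_del0 HS.
have h0 : 0 <= pcount / n%:R by rewrite divr_ge0 ?pcount_ge0.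
have h1 : pcount / n%:R <= 1 by rewrite ler_pdivrMr// mul1r pcount_le.
have nr2 : 0 < n%:R - 2 :> R by lra.
have hV : V <= E * (n%:R * del ^+ 2).
  have : \sum_i hdeg h i ^+ 2 <= n%:R * del ^+ 2 by exact: (sh_hdeg HS).
  have hE i : hdeg h i ^+ 2 = degr g i ^+ 2 / E.
    rewrite /hdeg /hmat -mulr_suml -degrE// expr_div_n sqr_sqrtr// ltW//.
  under eq_bigr do rewrite hE.
  rewrite -mulr_suml ler_pdivrMr// mulrC; apply: le_trans.
  by rewrite /dvar lerBlDr lerDl divr_ge0// mulr_ge0// sqr_ge0.
have hs : Num.sqrt V / Num.sqrt E <= Num.sqrt n%:R * del.
  rewrite ler_pdivrMr ?sqrtr_gt0//; apply: le_trans (ler_wsqrtr hV) _.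
  by rewrite sqrtrM ?(ltW E0)// sqrtrM// sqrtr_sqr gtr0_norm// mulrC.
have hn : Num.sqrt n%:R <= n%:R - 2 :> R.
  rewrite -[leRHS](@gtr0_norm _ (n%:R - 2))// -sqrtr_sqr ler_sqrt ?sqr_ge0//.
  by have := n4; nra.
rewrite /weps !normrM normfV (gtr0_norm nr2).
have g1 : `|1 - 2 * (pcount / n%:R)| <= 1 by rewrite ler_norml; lra.
have q0 : 0 <= Num.sqrt V / Num.sqrt E by rewrite divr_ge0 ?sqrtr_ge0.
rewrite -normrM (ger0_norm q0) mulrAC ler_pdivrMr//.
apply: (@le_trans _ _ (1 * (Num.sqrt n%:R * del))); first exact: ler_pM.
by rewrite mul1r mulrC ler_pM2l.
Qed.

Lemma Zdiff_gen s : standardize dstat s =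
  lstat a yv s / Num.sqrt (permE (fun s => lstat a yv s ^+ 2)).
Proof.
have [k hk] := dstatE.
have sV : 0 < Num.sqrt V by rewrite sqrtr_gt0.
rewrite (standardize_affine sV hk) /standardize /permSD (permE_lstat _ (cf0 yv_cfun)) subr0.
by congr (_ / Num.sqrt _); apply: eq_permE => t; rewrite subr0.
Qed.

Lemma Zw_gen s : standardize wstat s = (qc h yv s + weps * lstat a yv s) /
  Num.sqrt (permE (fun s => (qc h yv s + weps * lstat a yv s) ^+ 2)).
Proof.
have [k hk] := wstatE.
have sE : 0 < Num.sqrt E by rewrite sqrtr_gt0.
rewrite (standardize_affine sE hk) /standardize /permSD.
have e t : bstat h yv yv t / 2 + weps * lstat a yv t
   - permE (fun t => bstat h yv yv t / 2 + weps * lstat a yv t) = qc h yv t + weps * lstat a yv t.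
  by rewrite permED permEZ (permE_lstat _ (cf0 yv_cfun)) mulr0 addr0 /qc addrAC.
by rewrite e; congr (_ / Num.sqrt _); apply: eq_permE => t; rewrite e.
Qed.
End GraphStats.

(** * Gaussian limits *)

Section PsdFactor.
Context {R : realType}.

Definition ocons k (t : R) (v : 'I_k -> R) (i : 'I_k.+1) : R :=
  if unlift ord0 i is Some j then v j else t.

Lemma ocons0 k t (v : 'I_k -> R) : ocons t v ord0 = t.
Proof. by rewrite /ocons unlift_none. Qed.

Lemma oconsS k t (v : 'I_k -> R) j : ocons t v (lift ord0 j) = v j.
Proof. by rewrite /ocons liftK. Qed.

(* Cholesky factorisation; a vanishing pivot forces its whole row to vanish, so
   the junk value x / 0 = 0 does no harm. *)
Lemma psd_factor k (A : 'I_k -> 'I_k -> R) : (forall i j, A i j = A j i) ->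
  (forall x : 'I_k -> R, 0 <= \sum_i \sum_j x i * x j * A i j) ->
  exists L : 'I_k -> 'I_k -> R, forall i j, \sum_l L l i * L l j = A i j.
Proof.
elim: k A => [|k IH] A sA pA; first by exists (fun _ _ => 0) => -[].
pose a := A ord0 ord0; pose r j := A ord0 (lift ord0 j).
pose B i j := A (lift ord0 i) (lift ord0 j).
have qE t (v : 'I_k -> R) : \sum_i \sum_j ocons t v i * ocons t v j * A i j =
   t ^+ 2 * a + 2 * t * (\sum_j v j * r j) + \sum_i \sum_j v i * v j * B i j.
  rewrite big_ord_recl big_ord_recl !ocons0.
  under eq_bigr do rewrite !oconsS.
  under [X in _ + X]eq_bigr do rewrite big_ord_recl oconsS ocons0.
  under [X in _ + X]eq_bigr do under [X in _ + X]eq_bigr do rewrite !oconsS.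
  rewrite big_split/=.
  have -> : \sum_i v i * t * A (lift ord0 i) ord0 = t * \sum_j v j * r j.
    by rewrite mulr_sumr; apply: eq_bigr => i _; rewrite sA /r; ring.
  have -> : \sum_i t * v i * A ord0 (lift ord0 i) = t * \sum_j v j * r j.
    by rewrite mulr_sumr; apply: eq_bigr => i _; rewrite /r; ring.
  by rewrite /a /B; ring.
have a0 : 0 <= a.
  have := pA (ocons 1 (fun=> 0)); rewrite qE big1; last by move=> j _; rewrite mul0r.
  rewrite big1 => [|i _]; last by apply: big1 => j _; rewrite !mul0r.
  by rewrite mulr0 !addr0 expr1n mul1r.
have ra j : a = 0 -> r j = 0.
  move=> az; apply/eqP; apply/negP => rj0.
  pose v i : R := (i == j)%:R.
  have sv (f : 'I_k -> R) : \sum_i v i * f i = f j.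
    rewrite (bigD1 j)//= /v eqxx mul1r big1 ?addr0// => i /negbTE ->; exact: mul0r.
  (* If the pivot vanished while r j did not, this vector would give the form the value -1. *)
  have := pA (ocons (- (B j j + 1) / (2 * r j)) v); rewrite qE az mulr0 add0r sv.
  have -> : \sum_i \sum_l v i * v l * B i l = B j j.
    transitivity (\sum_i v i * \sum_l v l * B i l).
      by apply: eq_bigr => i _; rewrite mulr_sumr; apply: eq_bigr => l _; rewrite mulrA.
    by rewrite sv sv.
  have -> : 2 * (- (B j j + 1) / (2 * r j)) * r j + B j j = - 1.
    by field; apply/negP.
  by rewrite oppr_ge0 ler10.
(* The Schur complement of the pivot. For a = 0 the division by zero leaves B, as it should. *)
pose C i j := B i j - r i * r j / a.
have [L' hL'] : exists L : 'I_k -> 'I_k -> R, forall i j, \sum_l L l i * L l j = C i j.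
  apply: (IH C) => [i j|v]; first by rewrite /C /B sA [r i * _]mulrC.
  have cE : \sum_i \sum_j v i * v j * C i j = \sum_i \sum_j v i * v j * B i j - (\sum_j v j * r j) ^+ 2 / a.
    have -> : (\sum_j v j * r j) ^+ 2 / a = \sum_i \sum_j v i * v j * (r i * r j / a).
      rewrite expr2 -mulrA mulr_suml; apply: eq_bigr => i _.
      by rewrite mulr_suml mulr_sumr; apply: eq_bigr => j _; ring.
    rewrite -sumrB; apply: eq_bigr => i _; rewrite -sumrB; apply: eq_bigr => j _.
    by rewrite /C mulrBr.
  have [az|az] := eqVneq a 0.
    have := pA (ocons 0 v); rewrite qE cE az invr0 !mulr0 subr0.
    by rewrite mul0r !add0r.
  (* The first coordinate minimising the form; the minimum is the form of the Schur complement. *)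
  have := pA (ocons (- (\sum_j v j * r j) / a) v); rewrite qE cE.
  set u := \sum_j v j * r j; set q := \sum_i _.
  by rewrite (_ : _ + _ + q = q - u ^+ 2 / a)//; field.
have sa : Num.sqrt a ^+ 2 = a by rewrite sqr_sqrtr.
exists (fun l i => if unlift ord0 l is Some l' then ocons 0 (L' l') i
   else ocons (Num.sqrt a) (fun j => r j / Num.sqrt a) i) => i j.
rewrite big_ord_recl unlift_none; under eq_bigr do rewrite liftK.
have sq0 : Num.sqrt a = 0 -> a = 0 by move=> e; rewrite -sa e expr0n.
case: (unliftP ord0 i) => [i'|] ->; case: (unliftP ord0 j) => [j'|] ->; rewrite !(ocons0, oconsS).
- under eq_bigr do rewrite !oconsS.
  by rewrite hL' /C mulf_div -[Num.sqrt a * _]expr2 sa addrC subrK.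
- rewrite big1 ?addr0 => [|l _]; last by rewrite ocons0 mulr0.
  rewrite sA -/(r i'); have [e|e] := eqVneq (Num.sqrt a) 0; last by rewrite divfK.
  by rewrite e mulr0 (ra _ (sq0 e)).
- rewrite big1 ?addr0 => [|l _]; last by rewrite ocons0 mul0r.
  rewrite -/(r j') mulrC; have [e|e] := eqVneq (Num.sqrt a) 0; last by rewrite divfK.
  by rewrite e mulr0 (ra _ (sq0 e)).
- rewrite big1 ?addr0 => [|l _]; last by rewrite ocons0 mul0r.
  by rewrite -expr2 sa.
Qed.

Lemma psd_block_factor k (A B : 'I_k -> 'I_k -> R) :
  (forall i j, A i j = A j i) -> (forall i j, B i j = B j i) ->
  (forall x : 'I_k -> R, 0 <= \sum_i \sum_j x i * x j * A i j) ->
  (forall x : 'I_k -> R, 0 <= \sum_i \sum_j x i * x j * B i j) ->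
  exists L : 'M[R]_(k + k), L^T *m L =
    block_mx (\matrix_(i, j) A i j) 0 0 (\matrix_(i, j) B i j).
Proof.
move=> sA sB pA pB; have [LA hA] := psd_factor sA pA; have [LB hB] := psd_factor sB pB.
exists (block_mx (\matrix_(i, j) LA i j) 0 0 (\matrix_(i, j) LB i j)).
rewrite tr_block_mx mulmx_block !trmx0 !mulmx0 !mul0mx !addr0 !add0r.
congr block_mx; apply/matrixP => i j; rewrite !mxE -?hA -?hB.
  by apply: eq_bigr => l _; rewrite !mxE.
by apply: eq_bigr => l _; rewrite !mxE.
Qed.
End PsdFactor.

(** * The Stein hypotheses hold for large n *)

Section Eventually.
Context {R : realType}.
Variable G : forall n : nat, rel 'I_n.
Hypotheses (Gsym : forall n, symmetric (G (n := n))) (Girr : forall n, irreflexive (G (n := n))).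
Variable alpha : R.
Hypothesis halpha : 1 <= alpha.
Variables (c c2 : R).
Hypotheses (c0 : 0 < c) (c20 : 0 < c2).
Hypothesis hsize : \forall n \near \oo, c * n%:R `^ alpha <= nedges (G (n := n)).
Hypothesis hA2 : forall eps : R, 0 < eps -> \forall n \near \oo,
  Asq (G (n := n)) <= eps * n%:R `^ (alpha + 1 / 2).
Hypothesis hvar : \forall n \near \oo,
  c2 * \sum_i degr (G (n := n)) i ^+ 2 <= dvar (G (n := n)).

Lemma eventually_stein (del : R) : 0 < del -> del <= 1 ->
  \forall n \near \oo, [/\ (3 < n)%N, 0 < @nedges R n (G (n := n)), 0 < @dvar R n (G (n := n)) &
    stein_hyp (avec (G (n := n))) (hmat (G (n := n))) del].
Proof.
move=> d0 d1.
(* By Cauchy-Schwarz the squared degrees sum to at least 4 |G|^2 / n; with |G| >= c n^alpha and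
   alpha >= 1 the degree variance is at least c3 n^alpha. *)
pose c3 := 4 * c2 * c ^+ 2.
have c30 : 0 < c3 by rewrite !mulr_gt0// exprn_gt0.
(* One threshold for the four inequalities of [graph_stein_hyp]: each right-hand side is at least a
   constant times n^alpha sqrt n, the scale that bounds [Asq]. *)
pose ep := Num.min (Num.min (del ^+ 2 * c / 2) (del * (c3 * Num.sqrt c3) / 16))
   (Num.min (del * (c * Num.sqrt c) / 2) ((del ^+ 2) ^+ 2 * c ^+ 2 / 2)).
have ep0 : 0 < ep.
  by rewrite !lt_min !divr_gt0// !mulr_gt0// ?sqrtr_gt0// ?exprn_gt0// exprn_gt0.
have e1 : 2 * ep <= del ^+ 2 * c.
  have : ep <= del ^+ 2 * c / 2 by rewrite !ge_min lexx.
  by rewrite ler_pdivlMr// mulrC.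
have e2 : 16 * ep <= del * (c3 * Num.sqrt c3).
  have : ep <= del * (c3 * Num.sqrt c3) / 16 by rewrite !ge_min lexx !orbT.
  by rewrite ler_pdivlMr// mulrC.
have e3 : 2 * ep <= del * (c * Num.sqrt c).
  have : ep <= del * (c * Num.sqrt c) / 2 by rewrite !ge_min lexx !orbT.
  by rewrite ler_pdivlMr// mulrC.
have e4 : 2 * ep <= (del ^+ 2) ^+ 2 * c ^+ 2.
  have : ep <= (del ^+ 2) ^+ 2 * c ^+ 2 / 2 by rewrite !ge_min lexx !orbT.
  by rewrite ler_pdivlMr// mulrC.
near=> n.
have n3 : (3 < n)%N by near: n; exact: nbhs_infty_gt.
have nd : del ^-2 <= n%:R by near: n; exact: nbhs_infty_ger.
have hE : c * n%:R `^ alpha <= nedges (G (n := n)) by near: n.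
have hA : Asq (G (n := n)) <= ep * n%:R `^ (alpha + 1 / 2) by near: n; exact: hA2.
have hV : c2 * \sum_i degr (G (n := n)) i ^+ 2 <= dvar (G (n := n)) by near: n.
have n1 : 1 <= n%:R :> R by rewrite ler1n (leq_trans _ n3).
have n0 : 0 < n%:R :> R by apply: lt_le_trans n1.
set P := n%:R `^ alpha in hE.
have PE : n%:R `^ (alpha + 1 / 2) = P * Num.sqrt n%:R.
  by rewrite powRD ?mul1r ?powR12_sqrt// (gt_eqF n0) implybT.
rewrite PE in hA.
have nP : n%:R <= P by rewrite -[leLHS]powRr1// ler_powR.
have P0 : 0 < P by apply: lt_le_trans nP.
have sn0 : 0 < Num.sqrt n%:R :> R by rewrite sqrtr_gt0.
have sn1 : 1 <= Num.sqrt n%:R :> R by rewrite -[leLHS]sqrtr1 ler_wsqrtr.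
have snn : Num.sqrt n%:R <= n%:R :> R.
  by rewrite -{2}(@sqr_sqrtr _ n%:R)// expr2 ler_peMr// ltW.
set E := nedges _ in hE; set A := Asq _ in hA; set V := dvar _ in hV.
have E0 : 0 < E by apply: lt_le_trans hE; rewrite mulr_gt0.
have hVP : c3 * P <= V.
  apply: le_trans hV; have := sum_degr_CS (@Gsym n) (@Girr n) (ltnW (ltnW n3)) (R := R).
  rewrite -/E => hCS.
  apply: (@le_trans _ _ (c2 * (4 * E ^+ 2 / n%:R))); last by rewrite ler_pM2l.
  rewrite (_ : c3 * P = c2 * (4 * (c ^+ 2 * (P * n%:R)) / n%:R)); last first.
    by rewrite /c3; field; rewrite gt_eqF.
  rewrite ler_pM2l// ler_pM2r ?invr_gt0// ler_pM2l//.
  apply: (@le_trans _ _ ((c * P) ^+ 2)).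
    by rewrite [leRHS]exprMn ler_pM2l ?exprn_gt0// expr2 ler_pM2l.
  by rewrite lerXn2r ?nnegrE// ltW// mulr_gt0.
have V0 : 0 < V by apply: lt_le_trans hVP; rewrite mulr_gt0.
have sE : Num.sqrt c * Num.sqrt n%:R <= Num.sqrt E.
  rewrite -sqrtrM ?(ltW c0)// ler_wsqrtr//; apply: le_trans hE.
  by rewrite ler_pM2l.
have sV : Num.sqrt c3 * Num.sqrt n%:R <= Num.sqrt V.
  rewrite -sqrtrM ?(ltW c30)// ler_wsqrtr//; apply: le_trans hVP.
  by rewrite ler_pM2l.
have T0 : 0 <= P * Num.sqrt n%:R by rewrite ltW// mulr_gt0.
have scl (m x : R) : 0 < m -> m * ep <= x -> m * A <= x * (P * Num.sqrt n%:R).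
  move=> m0 h; apply: (@le_trans _ _ (m * (ep * (P * Num.sqrt n%:R)))); first by rewrite ler_pM2l.
  by rewrite [leLHS]mulrA; apply: ler_wpM2r.
have cP0 : 0 <= c * P by rewrite ltW// mulr_gt0.
have c3P0 : 0 <= c3 * P by rewrite ltW// mulr_gt0.
have sc0 : 0 <= Num.sqrt c * Num.sqrt n%:R by rewrite mulr_ge0.
have sc30 : 0 <= Num.sqrt c3 * Num.sqrt n%:R by rewrite mulr_ge0.
split => //; apply: graph_stein_hyp => //.
- by rewrite (leq_trans _ n3).
- by rewrite mulrC -ler_pdivrMl ?exprn_gt0// mulr1.
- apply: le_trans (scl _ _ _ e1) _ => //.
  rewrite (_ : n%:R * del ^+ 2 * E = del ^+ 2 * (E * n%:R)); last by ring.
  rewrite (_ : del ^+ 2 * c * _ = del ^+ 2 * ((c * P) * Num.sqrt n%:R)); last by ring.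
  by rewrite ler_pM2l ?exprn_gt0//; exact: ler_pM.
- apply: le_trans (scl _ _ _ e2) _ => //.
  rewrite -mulrA ler_pM2l// mulrACA; exact: ler_pM.
- apply: le_trans (scl _ _ _ e3) _ => //.
  rewrite -mulrA ler_pM2l// mulrACA; exact: ler_pM.
- apply: le_trans (scl _ _ _ e4) _ => //.
  rewrite -[(del ^+ 2) ^+ 2 * _ * _]mulrA ler_pM2l ?exprn_gt0 ?exprn_gt0//.
  apply: (@le_trans _ _ ((c * P) ^+ 2)).
    rewrite exprMn ler_pM2l ?exprn_gt0// expr2 ler_pM2l//.
    exact: le_trans nP.
  by rewrite lerXn2r ?nnegrE// ltW// mulr_gt0.
Unshelve. all: by end_near. Qed.
End Eventually.

(** * Limits of the characteristic functions *)

Section Limit.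
Context {R : realType}.
Variable G : forall n : nat, rel 'I_n.
Hypotheses (Gsym : forall n, symmetric (G (n := n))) (Girr : forall n, irreflexive (G (n := n))).
Hypothesis Hev : forall del : R, 0 < del -> del <= 1 ->
  \forall n \near \oo, [/\ (3 < n)%N, 0 < @nedges R n (G (n := n)), 0 < @dvar R n (G (n := n)) &
    stein_hyp (avec (G (n := n))) (hmat (G (n := n))) del].
Variables (k : nat) (P : nat -> 'I_k -> pred nat) (K0 : 'I_k -> 'I_k -> R).
Unset Implicit Arguments.
Let yb n b : 'I_n -> R := yv (P n b).
Hypothesis hK : forall b c, (fun n => Kn (yb n b) (yb n c)) @ \oo --> K0 b c.
Hypothesis K0pos : forall b, 0 < K0 b b.
Let an n : 'I_n -> R := avec (G (n := n)).
Let hn n : 'I_n -> 'I_n -> R := hmat (G (n := n)).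
Set Implicit Arguments.
Let sig2 b n := permE (fun s => lstat (an n) (yb n b) s ^+ 2).
Let ep b n : R := weps (G (n := n)) (P n b).
Let tau2 b n := permE (fun s => (qc (hn n) (yb n b) s + ep b n * lstat (an n) (yb n b) s) ^+ 2).

Lemma cvg0_del (f : nat -> R) (C : R) : 0 <= C ->
  (forall del, 0 < del -> del <= 1 -> \forall n \near \oo, `|f n| <= C * del) ->
  f @ \oo --> (0 : R).
Proof.
move=> C0 hf; apply/cvgrPdist_le => e e0.
have C1 : 0 < C + 1 by rewrite ltr_wpDl.
pose del := Num.min 1 (e / (C + 1)).
have d0 : 0 < del by rewrite lt_min ltr01 divr_gt0.
have d1 : del <= 1 by rewrite ge_min lexx.
have := hf _ d0 d1; apply: filterS => n h; rewrite sub0r normrN.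
apply: le_trans h _; apply: (@le_trans _ _ ((C + 1) * (e / (C + 1)))); last first.
  by rewrite mulrC divfK// gt_eqF.
by apply: ler_pM => //; [exact: ltW|rewrite lerDl|rewrite ge_min lexx orbT].
Qed.

Lemma cvg_of_diff0 (f u : nat -> R) (l : R) : (fun n => f n - u n) @ \oo --> (0 : R) ->
  u @ \oo --> l -> f @ \oo --> l.
Proof.
move=> h hu; rewrite (_ : f = (fun n => (f n - u n) + u n)); last first.
  by apply/funext => n; rewrite subrK.
by rewrite -[l]add0r; apply: cvgD.
Qed.

Lemma cvg_ep b : ep b @ \oo --> (0 : R).
Proof.
apply: (@cvg0_del _ 1) => // del d0 d1; have := Hev d0 d1; apply: filterS => n [n3 E0 V0 HS].
rewrite mul1r; exact: (weps_le (@Gsym n) (@Girr n) (ltnW n3) (P n b) E0 HS n3).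
Qed.

Lemma cvg_sig2 b : sig2 b @ \oo --> K0 b b.
Proof.
apply: cvg_of_diff0 (hK b b).
apply: (@cvg0_del _ 2) => // del d0 d1; have := Hev d0 d1; apply: filterS => n [n3 E0 V0 HS].
by apply: (xst_var HS); apply: yv_cfun; exact: ltnW.
Qed.

(** The residual linear part of R_w perturbs the variance of [qc] by at most 24 del from the cross
    term and 4 del from the square. *)
Lemma cvg_tau2 b : tau2 b @ \oo --> K0 b b ^+ 2.
Proof.
apply: (@cvg_of_diff0 _ (fun n => Kn (yb n b) (yb n b) ^+ 2)); last first.
  by rewrite expr2; apply: cvgM; exact: hK.
apply: (cvg0_del (addr_ge0 (ler0n R 6508) (ler0n R 28))) => del d0 d1; have := Hev d0 d1; apply: filterS => n [n3 E0 V0 HS].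
have hy : cfun (yb n b) by apply: yv_cfun; exact: ltnW.
have hq := qc_var HS hy; have he := weps_le (@Gsym n) (@Girr n) (ltnW n3) (P n b) E0 HS n3.
rewrite -/(ep b n) in he.
have hX := X_L2 HS hy; have hQ := qc_L2 HS hy.
have -> : tau2 b n = permE (fun s => qc (hn n) (yb n b) s ^+ 2)
   + (2 * ep b n) * permE (fun s => qc (hn n) (yb n b) s * lstat (an n) (yb n b) s)
   + ep b n ^+ 2 * permE (fun s => lstat (an n) (yb n b) s ^+ 2).
  rewrite -!permEZ -!permED; apply: eq_permE => s; ring.
have hQX : `|permE (fun s => qc (hn n) (yb n b) s * lstat (an n) (yb n b) s)| <= 6 * 2.
  by apply: le_trans (permE_norm _) _; apply: permE_CS_le.
have X0 : 0 <= permE (fun s => lstat (an n) (yb n b) s ^+ 2).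
  by apply: permE_ge0 => s; exact: sqr_ge0.
move: hq hQX hX X0; rewrite -/(hn n) -/(an n).
move: (permE (fun s => qc _ _ s ^+ 2)) (permE (fun s => qc _ _ s * _)) (permE (fun s => lstat _ _ s ^+ 2)) (Kn _ _) (ep b n) he.
move=> Q2 QX X2 K e he hq hQX hX X0.
have e2 : `|2 * e * QX| <= 24 * del.
  rewrite normrM normrM [`|2|]ger0_norm//.
  apply: (@le_trans _ _ (2 * del * (6 * 2))); last by lra.
  by apply: ler_pM => //; rewrite ?mulr_ge0// ler_pM2l.
have e3 : `|e ^+ 2 * X2| <= 4 * del.
  rewrite normrM normrX [`|X2|]ger0_norm//.
  apply: (@le_trans _ _ (del * 2 ^+ 2)); last by lra.
  apply: ler_pM => //; rewrite ?exprn_ge0// expr2 -[leRHS]mulr1.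
  by apply: ler_pM => //; apply: le_trans he d1.
have -> : Q2 + 2 * e * QX + e ^+ 2 * X2 - K ^+ 2 = (Q2 - K ^+ 2) + 2 * e * QX + e ^+ 2 * X2 by ring.
apply: le_trans (ler_normD _ _) _; rewrite (_ : (6508 + 28) * del = 6508 * del + 24 * del + 4 * del); last by ring.
apply: lerD => //; apply: le_trans (ler_normD _ _) _; exact: lerD.
Qed.

Let isq (f : nat -> R) n := (Num.sqrt (f n))^-1.

Lemma cvg_isq (f : nat -> R) (l : R) : 0 < l -> f @ \oo --> l -> isq f @ \oo --> (Num.sqrt l)^-1.
Proof.
move=> l0 hf; apply: cvgV; first by rewrite gt_eqF// sqrtr_gt0.
by apply: (@continuous_cvg _ _ _ _ _ f); [exact: sqrt_continuous|exact: hf].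
Qed.

Definition zrow n (s : {perm 'I_n}) : 'rV[R]_(k + k) :=
  row_mx (\row_j standardize (dstat (R := R) (G (n := n)) (P n j)) s)
         (\row_j standardize (wstat (R := R) (G (n := n)) (P n j)) s).

Section Theta.
Variables (th : 'I_(k + k) -> R) (b0 : R).
Let t1 j := th (lshift k j).
Let t2 j := th (rshift k j).
(** Coefficients for which the linear form th of the standardised vector is exactly a [tst]; t2 also
    enters here because R_w keeps the linear part [ep]. *)
Let al n b := t1 b * isq (sig2 b) n + t2 b * (ep b n * isq (tau2 b) n).
Let be n b := t2 b * isq (tau2 b) n.
Let al0 b := t1 b / Num.sqrt (K0 b b).
Let be0 b := t2 b / K0 b b.

Lemma cvg_al b : al ^~ b @ \oo --> al0 b.
Proof.
rewrite -[al0 b]addr0 -[X in _ + X](mulr0 (t2 b)) -[X in _ * X](mul0r (Num.sqrt (K0 b b ^+ 2))^-1).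
rewrite /al0; apply: cvgD.
  apply: cvgM; first exact: cvg_cst.
  exact: (cvg_isq (K0pos b) (@cvg_sig2 b)).
apply: cvgM; first exact: cvg_cst.
by apply: cvgM; [exact: cvg_ep|exact: cvg_isq (exprn_gt0 2 (K0pos b)) (@cvg_tau2 b)].
Qed.

Lemma cvg_be b : be ^~ b @ \oo --> be0 b.
Proof.
apply: cvgM; first exact: cvg_cst.
by have := cvg_isq (exprn_gt0 2 (K0pos b)) (@cvg_tau2 b); rewrite sqrtr_sqr gtr0_norm.
Qed.

Let wn n := \sum_b (`|al n b| + `|be n b|).
Let w0 := \sum_b (`|al0 b| + `|be0 b|).

Lemma cvg_wn : wn @ \oo --> w0.
Proof.
by apply: cvg_sumr => b; apply: cvgD; apply: cvg_norm; [exact: cvg_al|exact: cvg_be].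
Qed.

(** The factor of del in [char_le], as a continuous function of w: as the coefficients converge it
    stays bounded, while del is arbitrary. *)
Definition errf (w : R) : R :=
  expR (w ^+ 2) * (w * (w * 200 + 16 * w ^+ 2 * (132 + 256 * k%:R ^+ 3) + 14)).

Lemma cvg_errf : (fun n => errf (wn n)) @ \oo --> errf w0.
Proof.
apply: (@continuous_cvg _ _ _ _ _ wn); last exact: cvg_wn.
have ci : continuous (fun w : R => w) by move=> x; exact: cvg_id.
have cs : continuous (fun w : R => w ^+ 2).
  by move=> x; exact: (@exprn_continuous _ 2).
apply: continuous_mulf; first by apply: continuous_compf (@continuous_expR R).
apply: continuous_mulf => //; apply: continuous_addf; last exact: continuous_cstf.
apply: continuous_addf; first by apply: continuous_mulf => //; exact: continuous_cstf.
apply: continuous_mulf; last exact: continuous_cstf.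
by apply: continuous_mulf => //; exact: continuous_cstf.
Qed.

Let lamn n := lam (yb n) (al n) (be n).
Definition lam0 : R := \sum_c (al0 c * (\sum_b al0 b * K0 c b) + be0 c * (\sum_b be0 b * K0 c b ^+ 2)).

Lemma cvg_lamn : lamn @ \oo --> lam0.
Proof.
apply: cvg_sumr => c; apply: cvgD.
  apply: cvgM; first exact: cvg_al.
  by apply: cvg_sumr => b; apply: cvgM; [exact: cvg_al|exact: hK].
apply: cvgM; first exact: cvg_be.
by apply: cvg_sumr => b; apply: cvgM; [exact: cvg_be|apply: cvgM; exact: hK].
Qed.

Lemma zrow_tst n s : (3 < n)%N -> 0 < @nedges R n (G (n := n)) -> 0 < @dvar R n (G (n := n)) ->
  lin th (@zrow n s) = tst (an n) (hn n) (yb n) (al n) (be n) s.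
Proof.
move=> n3 E0 V0; rewrite /lin big_split_ord/= /tst -big_split; apply: eq_bigr => b _ /=.
rewrite row_mxEl row_mxEr !mxE.
rewrite (Zdiff_gen (@Gsym n) (@Girr n) (ltnW n3) (P n b) V0).
rewrite (Zw_gen (@Gsym n) (@Girr n) (ltnW n3) (P n b) E0 V0).
rewrite -/(an n) -/(hn n) -/(yb n b) -/(ep b n) -/(sig2 b n) -/(tau2 b n).
rewrite /al /be /isq -/(t1 b) -/(t2 b) /xst /qst -/(qc (hn n) (yb n b) s).
by ring.
Qed.

Lemma cvg_char : (fun n => permE (fun s => cos (lin th (@zrow n s) + b0))) @ \oo -->
  expR (- lam0 / 2) * cos b0.
Proof.
apply: (@cvg_of_diff0 _ (fun n => expR (- lamn n / 2) * cos b0)); last first.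
  apply: cvgM; last exact: cvg_cst.
  apply: (@continuous_cvg _ _ _ _ _ (fun n => - lamn n / 2)); first exact: continuous_expR.
  by apply: cvgM; [apply: cvgN; exact: cvg_lamn|exact: cvg_cst].
have err0 : 0 <= errf w0 + 1.
  have w00 : 0 <= w0 by apply: sumr_ge0 => b _; rewrite addr_ge0.
  rewrite addr_ge0// mulr_ge0 ?expR_ge0// mulr_ge0// !addr_ge0 ?mulr_ge0// ?sqr_ge0 ?addr_ge0 ?mulr_ge0 ?exprn_ge0//.
apply: (cvg0_del err0) => del d0 d1.
near=> n.
have : [/\ (3 < n)%N, 0 < @nedges R n (G (n := n)), 0 < @dvar R n (G (n := n)) &
    stein_hyp (avec (G (n := n))) (hmat (G (n := n))) del] by near: n; exact: Hev.
move=> [n3 E0 V0 HS].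
have hw : errf (wn n) <= errf w0 + 1.
  near: n; have /cvgrPdist_le /(_ 1 ltr01) := cvg_errf; apply: filterS => n.
  by rewrite ler_norml => /andP[h1 h2]; lra.
have hy b : cfun (yb n b) by apply: yv_cfun; exact: ltnW.
have := char_le HS hy (al n) (be n) b0.
rewrite (eq_permE (g := fun s => cos (lin th (@zrow n s) + b0))) => [|s]; last first.
  by rewrite zrow_tst.
rewrite -/(lamn n) => h; apply: le_trans h _.
rewrite mulrA; apply: ler_wpM2r; first exact: ltW.
exact: hw.
Unshelve. all: by end_near. Qed.
End Theta.
End Limit.

(** * Covariance kernels and the joint limit *)

Section GraphCLT.
Context {R : realType}.
Variable G : forall n : nat, rel 'I_n.
Hypotheses (Gsym : forall n, symmetric (G (n := n))) (Girr : forall n, irreflexive (G (n := n))).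
Hypothesis Hev : forall del : R, 0 < del -> del <= 1 ->
  \forall n \near \oo, [/\ (3 < n)%N, 0 < @nedges R n (G (n := n)), 0 < @dvar R n (G (n := n)) &
    stein_hyp (avec (G (n := n))) (hmat (G (n := n))) del].
Variables (k : nat) (P : nat -> 'I_k -> pred nat) (K0 : 'I_k -> 'I_k -> R).
Hypothesis hK : forall b c, (fun n => Kn (yv (n := n) (P n b)) (yv (n := n) (P n c))) @ \oo --> K0 b c.
Hypothesis K0pos : forall b, 0 < K0 b b.

Lemma K0_sym b c : K0 b c = K0 c b.
Proof.
have e : (fun n => Kn (yv (n := n) (P n b)) (yv (n := n) (P n c)) : R) =
   (fun n => Kn (yv (n := n) (P n c)) (yv (n := n) (P n b))).
  by apply/funext => n; rewrite /Kn; congr (_ / _); apply: eq_bigr => p _; rewrite mulrC.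
have h := @hK b c; rewrite e in h.
exact: (cvg_unique _ h (@hK c b)).
Qed.

Lemma Kn_psd n (y : 'I_k -> 'I_n -> R) (x : 'I_k -> R) :
  0 <= \sum_b \sum_c x b * x c * Kn (y b) (y c).
Proof.
have -> : \sum_b \sum_c x b * x c * Kn (y b) (y c) = (\sum_p (\sum_b x b * y b p) ^+ 2) / n%:R.
  transitivity (\sum_b \sum_c \sum_p (x b * y b p) * (x c * y c p) / n%:R).
    apply: eq_bigr => b _; apply: eq_bigr => c _.
    by rewrite /Kn mulr_suml mulr_sumr; apply: eq_bigr => p _; ring.
  rewrite mulr_suml; under eq_bigr do rewrite exchange_big/=.
  rewrite exchange_big/=; apply: eq_bigr => p _.
  rewrite expr2 mulr_suml mulr_suml; apply: eq_bigr => b _.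
  by rewrite mulr_sumr mulr_suml.
by rewrite divr_ge0//; apply: sumr_ge0 => p _; exact: sqr_ge0.
Qed.

(** An instance of the Schur product theorem: the squared kernel is the Gram matrix of the tensor
    squares (p, q) |-> y b p * y b q. *)
Lemma Kn_sqr_psd n (y : 'I_k -> 'I_n -> R) (x : 'I_k -> R) :
  0 <= \sum_b \sum_c x b * x c * Kn (y b) (y c) ^+ 2.
Proof.
have -> : \sum_b \sum_c x b * x c * Kn (y b) (y c) ^+ 2 =
   (\sum_p \sum_q (\sum_b x b * (y b p * y b q)) ^+ 2) / n%:R ^+ 2.
  transitivity (\sum_b \sum_c \sum_p \sum_q (x b * (y b p * y b q)) * (x c * (y c p * y c q)) / n%:R ^+ 2).
    apply: eq_bigr => b _; apply: eq_bigr => c _.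
    rewrite /Kn expr_div_n expr2 mulr_suml mulr_suml mulr_sumr; apply: eq_bigr => p _.
    rewrite mulr_sumr mulr_suml mulr_sumr; apply: eq_bigr => q _.
    by ring.
  rewrite mulr_suml; under eq_bigr do rewrite exchange_big/=.
  rewrite exchange_big/=; apply: eq_bigr => p _.
  rewrite mulr_suml; under eq_bigr do rewrite exchange_big/=.
  rewrite exchange_big/=; apply: eq_bigr => q _.
  rewrite [X in X / _]expr2 mulr_suml mulr_suml; apply: eq_bigr => b _.
  by rewrite mulr_sumr mulr_suml.
rewrite divr_ge0 ?sqr_ge0//; apply: sumr_ge0 => p _; apply: sumr_ge0 => q _; exact: sqr_ge0.
Qed.

Lemma K0_psd (x : 'I_k -> R) : 0 <= \sum_b \sum_c x b * x c * K0 b c.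
Proof.
pose f n := \sum_b \sum_c x b * x c * Kn (yv (n := n) (P n b)) (yv (n := n) (P n c)).
have hf : f @ \oo --> \sum_b \sum_c x b * x c * K0 b c.
  apply: cvg_sumr => b; apply: cvg_sumr => c.
  by apply: cvgM; [exact: cvg_cst|exact: hK].
by apply: (cvgr_to_ge hf); apply: nearW => n; exact: Kn_psd.
Qed.

Lemma K0_sqr_psd (x : 'I_k -> R) : 0 <= \sum_b \sum_c x b * x c * K0 b c ^+ 2.
Proof.
pose f n := \sum_b \sum_c x b * x c * Kn (yv (n := n) (P n b)) (yv (n := n) (P n c)) ^+ 2.
have hf : f @ \oo --> \sum_b \sum_c x b * x c * K0 b c ^+ 2.
  apply: cvg_sumr => b; apply: cvg_sumr => c.
  by apply: cvgM; [exact: cvg_cst|apply: cvgM; exact: hK].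
by apply: (cvgr_to_ge hf); apply: nearW => n; exact: Kn_sqr_psd.
Qed.

Definition kd b c : R := K0 b c / (Num.sqrt (K0 b b) * Num.sqrt (K0 c c)).
(** The bilinear statistic has limit standard deviation [K0 b b], so this is the square of the
    correlation [kd]. *)
Definition kw b c : R := K0 b c ^+ 2 / (K0 b b * K0 c c).

Lemma sqrtK0 b : 0 < Num.sqrt (K0 b b).
Proof. by rewrite sqrtr_gt0. Qed.

Lemma kd_psd (x : 'I_k -> R) : 0 <= \sum_b \sum_c x b * x c * kd b c.
Proof.
have := K0_psd (fun b => x b / Num.sqrt (K0 b b)).
rewrite (_ : \sum_b _ = \sum_b \sum_c x b * x c * kd b c)//.
apply: eq_bigr => b _; apply: eq_bigr => c _; rewrite /kd.
by field; rewrite !gt_eqF ?sqrtK0.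
Qed.

Lemma kw_psd (x : 'I_k -> R) : 0 <= \sum_b \sum_c x b * x c * kw b c.
Proof.
have := K0_sqr_psd (fun b => x b / K0 b b).
rewrite (_ : \sum_b _ = \sum_b \sum_c x b * x c * kw b c)//.
apply: eq_bigr => b _; apply: eq_bigr => c _; rewrite /kw.
by field; rewrite !gt_eqF.
Qed.

Lemma zrow_L2 n i : permE (fun s => zrow (R := R) G P (n := n) s 0 i ^+ 2) <= 1.
Proof.
rewrite /zrow -(splitK i); case: (fintype.split i) => j /=.
  rewrite (eq_permE (g := fun s => standardize (dstat (R := R) (G (n := n)) (P n j)) s ^+ 2)).
    exact: standardize_L2.
  by move=> s; rewrite row_mxEl mxE.
rewrite (eq_permE (g := fun s => standardize (wstat (R := R) (G (n := n)) (P n j)) s ^+ 2)).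
  exact: standardize_L2.
by move=> s; rewrite row_mxEr mxE.
Qed.

Theorem graph_clt : exists L : 'M[R]_(k + k),
  L^T *m L = block_mx (\matrix_(i, j) kd i j) 0 0 (\matrix_(i, j) kw i j) /\
  cvg_dist_gauss (fun n s => zrow (R := R) G P (n := n) s) 0 L.
Proof.
have sd b c : kd b c = kd c b by rewrite /kd K0_sym [X in _ / X]mulrC.
have sw b c : kw b c = kw c b by rewrite /kw K0_sym [X in _ / X]mulrC.
have [L hL] := psd_block_factor sd sw kd_psd kw_psd.
exists L; split => //.
apply: (@cvg_dist_gauss_cos _ _ _ _ 1).
  by apply: nearW => n i; exact: zrow_L2.
move=> th b.
have -> : \sum_i (\sum_j th j * L i j) ^+ 2 = lam0 K0 th; last exact: cvg_char.
transitivity (\sum_j \sum_j' th j * th j' * (L^T *m L) j j').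
  transitivity (\sum_i \sum_j \sum_j' th j * th j' * (L i j * L i j')).
    apply: eq_bigr => i _; rewrite expr2 mulr_suml; apply: eq_bigr => j _.
    by rewrite mulr_sumr; apply: eq_bigr => j' _; ring.
  rewrite exchange_big/=; apply: eq_bigr => j _.
  rewrite exchange_big/=; apply: eq_bigr => j' _.
  by rewrite mxE mulr_sumr; apply: eq_bigr => i _; rewrite mxE.
rewrite hL big_split_ord/= /lam0 -big_split.
apply: eq_bigr => c _ /=; rewrite !big_split_ord/=.
rewrite [X in _ + X + _]big1 => [|j _]; last by rewrite block_mxEur mxE mulr0.
rewrite [X in _ + (X + _)]big1 => [|j _]; last by rewrite block_mxEdl mxE mulr0.
rewrite addr0 add0r; congr (_ + _); rewrite mulr_sumr; apply: eq_bigr => j _.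
  by rewrite block_mxEul mxE /kd; field; rewrite !gt_eqF ?sqrtK0.
by rewrite block_mxEdr mxE /kw; field; rewrite !gt_eqF.
Qed.
End GraphCLT.

(** * Window covariances and the two scans *)

Section Intervals.
Context {R : realType}.

(** Truncated subtraction is the right count also when l > r, which occurs for the intersection of
    disjoint windows. *)
Lemma sum_inside n l r : (r <= n)%N ->
  \sum_(i < n) (inside l r i)%:R = (r - l)%N%:R :> R.
Proof.
move=> rn; rewrite -natr_sum; congr (_%:R).
suff -> : (\sum_(i < n) inside l r i = minn r n - l)%N by rewrite (minn_idPl rn).
elim: n {rn} => [|n IH]; first by rewrite big_ord0 minn0.
rewrite big_ord_recr /= IH /inside.
have [nr|rn] := boolP (n < r)%N; last first.
  rewrite -leqNgt in rn.
  by rewrite (minn_idPl rn) (minn_idPl (leqW rn)) andbF addn0.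
rewrite (minn_idPr (ltnW nr)) (minn_idPr nr) andbT.
have [ln|nl] := boolP (l <= n)%N; first by rewrite addn1 subSn.
rewrite -ltnNge in nl; rewrite addn0; have nl' := ltnW nl.
by rewrite -subn_eq0 in nl; rewrite -subn_eq0 in nl'; rewrite (eqP nl) (eqP nl').
Qed.

Lemma floorn_bounds (x : R) : 0 <= x -> (floorn x)%:R <= x < (floorn x)%:R + 1.
Proof.
move=> x0; have f0 : 0 <= Num.floor x by rewrite floor_ge0.
have -> : (floorn x)%:R = (Num.floor x)%:~R :> R.
  by rewrite /floorn -[in RHS](gez0_abs f0).
rewrite floor_le /=; have := floorD1_gt x; by rewrite intrD.
Qed.

Lemma floorn_le (x y : R) : 0 <= x -> x <= y -> (floorn x <= floorn y)%N.
Proof.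
move=> x0 xy; have /andP[h1 _] := floorn_bounds x0.
have /andP[_ h2] := floorn_bounds (le_trans x0 xy).
by rewrite -ltnS -(ltr_nat R) -[(floorn y).+1%:R]natr1; apply: le_lt_trans h1 _; apply: le_lt_trans xy h2.
Qed.

Lemma floorn_nat_le (n : nat) (u : R) : 0 <= u -> u <= 1 -> (floorn (n%:R * u) <= n)%N.
Proof.
move=> u0 u1; have /andP[h1 _] := floorn_bounds (mulr_ge0 (ler0n R n) u0).
by rewrite -(ler_nat R); apply: le_trans h1 _; rewrite ler_piMr.
Qed.

Lemma cvg_floorn (u : R) : 0 <= u ->
  (fun n => (floorn (n%:R * u))%:R / n%:R) @ \oo --> u.
Proof.
(* The shift avoids division by n = 0; the error is then at most 1 / n.+1. *)
move=> u0; rewrite -(cvg_shiftS (fun n => (floorn (n%:R * u))%:R / n%:R : R)).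
apply/cvgrPdist_le => e e0.
have /cvgrPdist_le /(_ e e0) := @cvg_harmonic R; apply: filterS => n.
rewrite sub0r normrN => h; apply: le_trans h.
have n0 : 0 < n.+1%:R :> R by rewrite ltr0n.
have /andP[h1 h2] := floorn_bounds (mulr_ge0 (ler0n R n.+1) u0).
rewrite [leRHS](_ : _ = n.+1%:R^-1); last by rewrite ger0_norm// invr_ge0.
rewrite -[leRHS]mul1r ler_pdivlMr// -[X in _ * X <= _](gtr0_norm n0) -normrM /= mulrBl divfK ?gt_eqF//.
rewrite [u * _]mulrC ger0_norm ?subr_ge0//.
by rewrite lerBlDl ltW.
Qed.

Lemma cvg_maxr (f u : nat -> R) (a b : R) : f @ \oo --> a -> u @ \oo --> b ->
  (fun n => Num.max (f n) (u n)) @ \oo --> Num.max a b.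
Proof.
move=> hf hu; rewrite maxr_absE; under eq_fun do rewrite maxr_absE.
apply: cvgM; last exact: cvg_cst.
by apply: cvgD; [exact: cvgD|apply: cvg_norm; exact: cvgB].
Qed.

Lemma cvg_minr (f u : nat -> R) (a b : R) : f @ \oo --> a -> u @ \oo --> b ->
  (fun n => Num.min (f n) (u n)) @ \oo --> Num.min a b.
Proof.
move=> hf hu; rewrite minr_absE; under eq_fun do rewrite minr_absE.
apply: cvgM; last exact: cvg_cst.
by apply: cvgB; [exact: cvgD|apply: cvg_norm; exact: cvgB].
Qed.

Lemma natr_subn (a b : nat) : (a - b)%N%:R = Num.max 0 (a%:R - b%:R) :> R.
Proof.
case: (leqP b a) => h; first by rewrite natrB// max_r// subr_ge0 ler_nat.
by rewrite (eqP (ltnW h : _ == 0)%N) max_l// subr_le0 ler_nat ltnW.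
Qed.

Lemma natr_minn (a b : nat) : (minn a b)%:R = Num.min a%:R b%:R :> R.
Proof.
case: (leqP a b) => h; first by rewrite min_l// ler_nat.
by rewrite min_r// ler_nat ltnW.
Qed.

Lemma natr_maxn (a b : nat) : (maxn a b)%:R = Num.max a%:R b%:R :> R.
Proof.
case: (leqP a b) => h; first by rewrite max_r// ler_nat.
by rewrite max_l// ler_nat ltnW.
Qed.

Lemma Kn_yv n (p q : pred nat) : (0 < n)%N ->
  Kn (yv (R := R) (n := n) p) (yv q) =
  (\sum_(i < n) (p i && q i)%:R) / n%:R - (@pcount R n p / n%:R) * (@pcount R n q / n%:R).
Proof.
move=> n0; have nn : n%:R != 0 :> R by rewrite pnatr_eq0 -lt0n.
rewrite /Kn /yv.
have -> : \sum_(i < n) ((p i)%:R - @pcount R n p / n%:R) * ((q i)%:R - @pcount R n q / n%:R) =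
   \sum_(i < n) ((p i && q i)%:R - @pcount R n q / n%:R * (p i)%:R - @pcount R n p / n%:R * (q i)%:R
     + @pcount R n p / n%:R * (@pcount R n q / n%:R)).
  apply: eq_bigr => i _; rewrite -mulnb natrM; ring.
rewrite big_split/= !sumrB -!mulr_sumr sum_cst_ord -/(@pcount R n p) -/(@pcount R n q).
by field.
Qed.

Lemma pcountC n (p : pred nat) : @pcount R n (fun i => ~~ p i) = n%:R - @pcount R n p :> R.
Proof.
rewrite /pcount -[n%:R]mulr1 -(sum_cst_ord n 1) -sumrB; apply: eq_bigr => i _.
by case: (p i); rewrite ?subrr ?subr0.
Qed.

(** Complementing a window negates its centred indicator, and [Kn] only sees products. *)
Lemma Kn_yvC n (p q : pred nat) : (0 < n)%N ->
  Kn (yv (R := R) (n := n) (fun i => ~~ p i)) (yv (fun i => ~~ q i)) = Kn (yv (n := n) p) (yv q).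
Proof.
move=> n0; have nn : n%:R != 0 :> R by rewrite pnatr_eq0 -lt0n.
have e (r : pred nat) (i : 'I_n) : yv (R := R) (fun i => ~~ r i) i = - yv r i.
  by rewrite /yv pcountC mulrBl divff//; case: (r i) => /=; ring.
by rewrite /Kn; congr (_ / _); apply: eq_bigr => i _; rewrite !e mulrNN.
Qed.

(** Overlap length minus product of lengths: the covariance of the increments of a Brownian bridge
    over the two intervals. For u = u' = 0 it is min v v' - v v'. *)
Definition itvK (u v u' v' : R) : R :=
  Num.max 0 (Num.min v v' - Num.max u u') - (v - u) * (v' - u').

Lemma cvg_Kn_inside (l r l' r' : nat -> nat) (u v u' v' : R) :
  (forall n, (l n <= r n <= n)%N) -> (forall n, (l' n <= r' n <= n)%N) ->
  (fun n => (l n)%:R / n%:R) @ \oo --> u -> (fun n => (r n)%:R / n%:R) @ \oo --> v ->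
  (fun n => (l' n)%:R / n%:R) @ \oo --> u' -> (fun n => (r' n)%:R / n%:R) @ \oo --> v' ->
  (fun n => Kn (yv (n := n) (inside (l n) (r n))) (yv (inside (l' n) (r' n)))) @ \oo -->
    itvK u v u' v'.
Proof.
move=> lr lr' hl hr hl' hr'.
pose f n : R := Num.max 0 (Num.min ((r n)%:R / n%:R) ((r' n)%:R / n%:R)
    - Num.max ((l n)%:R / n%:R) ((l' n)%:R / n%:R))
  - ((r n)%:R / n%:R - (l n)%:R / n%:R) * ((r' n)%:R / n%:R - (l' n)%:R / n%:R).
have hf : f @ \oo --> itvK u v u' v'.
  apply: cvgB; last by apply: cvgM; apply: cvgB.
  apply: cvg_maxr; first exact: cvg_cst.
  by apply: cvgB; [exact: cvg_minr|exact: cvg_maxr].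
apply: cvg_trans hf; apply: near_eq_cvg; near=> n.
have n0 : (0 < n)%N by near: n; exact: nbhs_infty_gt.
have ni : 0 <= n%:R^-1 :> R by rewrite invr_ge0.
have /andP[h1 h2] := lr n; have /andP[h1' h2'] := lr' n.
rewrite Kn_yv// /pcount !sum_inside// !natrB// /f !mulrBl; congr (_ - _).
rewrite (eq_bigr (fun i : 'I_n => (inside (maxn (l n) (l' n)) (minn (r n) (r' n)) i)%:R)); last first.
  by move=> i _; rewrite /inside geq_max leq_min; congr (_%:R); rewrite andbACA.
rewrite sum_inside; last by apply: leq_trans h2; exact: geq_minl.
by rewrite natr_subn natr_minn natr_maxn maxr_pMl// mul0r mulrBl minr_pMl// maxr_pMl.
Unshelve. all: by end_near. Qed.

Lemma itvK_pos (u v : R) : u < v -> v - u < 1 -> 0 < itvK u v u v.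
Proof.
move=> uv v1; rewrite /itvK minxx maxxx max_r ?subr_ge0 ?ltW//.
by rewrite subr_gt0 gtr_pMr ?subr_gt0.
Qed.

Section Partition.
Context {n : nat} (g : rel 'I_n).

Lemma Rdiff_dstat t : @Rdiff R n g t =1 dstat g (inside 0 t).
Proof.
move=> s; rewrite /Rdiff /dstat /R1 /R2 /inst /outst /inside.
by congr (_%:R - _%:R); apply: eq_card => e; rewrite !inE/= -?leqNgt.
Qed.

Lemma Rw_wstat t : (t <= n)%N -> @Rw R n g t =1 wstat g (inside 0 t).
Proof.
move=> tn s; rewrite /Rw /wstat /pcount (sum_inside 0 tn) subn0.
rewrite /R1 /R2 /inst /outst /inside.
by congr (_ * _%:R + _ * _%:R); apply: eq_card => e; rewrite !inE/= -?leqNgt.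
Qed.

(** For a changed interval R_1 counts edges outside the window, hence the complement. *)
Lemma Rdiffi_dstat l r : @Rdiffi R n g l r =1 dstat g (fun i => ~~ inside l r i).
Proof.
move=> s; rewrite /Rdiffi /dstat /R1i /R2i /inst /outst.
by congr (_%:R - _%:R); apply: eq_card => e; rewrite !inE/= ?negbK.
Qed.

Lemma Rwi_wstat l r : (l <= r <= n)%N ->
  @Rwi R n g l r =1 wstat g (fun i => ~~ inside l r i).
Proof.
move=> /andP[lr rn] s; rewrite /Rwi /wstat pcountC /pcount (sum_inside l rn) natrB//.
rewrite subKr /R1i /R2i /inst /outst.
by congr (_ * _%:R + _ * _%:R); apply: eq_card => e; rewrite !inE/= ?negbK.
Qed.
End Partition.
End Intervals.

Theorem theorem1 (R : realType) (G : forall n : nat, rel 'I_n)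
  (Gsym : forall n, symmetric (G n)) (Girr : forall n, irreflexive (G n))
  (alpha : R) (halpha : 1 <= alpha < 3 / 2)
  (hsize : exists c C : R, 0 < c /\ 0 < C /\
     \forall n \near \oo,
       c * n%:R `^ alpha <= #|edges (G n)|%:R <= C * n%:R `^ alpha)
  (hAB : forall eps : R, 0 < eps -> \forall n \near \oo,
     \sum_(e in edges (G n)) (#|Aset (G n) e| * #|Bset (G n) e|)%:R
       <= eps * n%:R `^ (3 / 2 * alpha))
  (hA2 : forall eps : R, 0 < eps -> \forall n \near \oo,
     \sum_(e in edges (G n)) (#|Aset (G n) e| ^ 2)%:R
       <= eps * n%:R `^ (alpha + 1 / 2))
  (hdeg : exists c C : R, 0 < c /\ 0 < C /\ \forall n \near \oo,
     c * \sum_(i < n) (#|inc_edges (G n) i| ^ 2)%:R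
       <= \sum_(i < n) (#|inc_edges (G n) i| ^ 2)%:R
          - 4 * (#|edges (G n)| ^ 2)%:R / n%:R
       <= C * \sum_(i < n) (#|inc_edges (G n) i| ^ 2)%:R) :
  (* 1. single change point: fidi convergence to independent Gaussian processes *)
  (exists (mD mW : R -> R) (KD KW : R -> R -> R),
    forall (k : nat) (u : 'I_k -> R), (forall j, 0 < u j < 1) ->
    exists L : 'M[R]_(k + k),
      L^T *m L = block_mx (\matrix_(i, j) KD (u i) (u j)) 0
                          0 (\matrix_(i, j) KW (u i) (u j)) /\
      cvg_dist_gauss
        (fun n s => row_mx (\row_j Zdiff (G n) (floorn (n%:R * u j)) s)
                           (\row_j Zw (G n) (floorn (n%:R * u j)) s))
        (row_mx (\row_j mD (u j)) (\row_j mW (u j))) L)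
  /\
  (* 2. changed interval: fidi convergence to independent Gaussian random fields *)
  (exists (mD mW : R -> R -> R) (KD KW : R -> R -> R -> R -> R),
    forall (k : nat) (u v : 'I_k -> R), (forall j, 0 < u j < v j /\ v j < 1) ->
    exists L : 'M[R]_(k + k),
      L^T *m L = block_mx (\matrix_(i, j) KD (u i) (v i) (u j) (v j)) 0
                          0 (\matrix_(i, j) KW (u i) (v i) (u j) (v j)) /\
      cvg_dist_gauss
        (fun n s => row_mx
           (\row_j Zdiffi (G n) (floorn (n%:R * u j)) (floorn (n%:R * v j)) s)
           (\row_j Zwi (G n) (floorn (n%:R * u j)) (floorn (n%:R * v j)) s))
        (row_mx (\row_j mD (u j) (v j)) (\row_j mW (u j) (v j))) L).
Proof.
have [a1 _] := andP halpha.
have [c [C [c0 [_ hs]]]] := hsize.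
have [c2 [C2 [c20 [_ hd]]]] := hdeg.
have Hev := @eventually_stein R G Gsym Girr alpha a1 c c2 c0 c20.
have {}Hev : forall del : R, 0 < del -> del <= 1 ->
  \forall n \near \oo, [/\ (3 < n)%N, 0 < @nedges R n (G n), 0 < @dvar R n (G n) &
    stein_hyp (avec (G n)) (hmat (G n)) del].
  apply: Hev.
  - by apply: filterS hs => n /andP[].
  - by move=> eps e0; apply: filterS (hA2 eps e0) => n.
  - apply: filterS hd => n /andP[+ _].
    rewrite /dvar /nedges natrX.
    by under eq_bigr do rewrite natrX.
split.
  exists (fun=> 0), (fun=> 0).
  exists (fun u u' => itvK 0 u 0 u' / (Num.sqrt (itvK 0 u 0 u) * Num.sqrt (itvK 0 u' 0 u'))).
  exists (fun u u' => itvK 0 u 0 u' ^+ 2 / (itvK 0 u 0 u * itvK 0 u' 0 u')).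
  move=> k u hu.
  have u0 j : 0 <= u j by have /andP[/ltW] := hu j.
  have u1 j : u j <= 1 by have /andP[_ /ltW] := hu j.
  (* A single change point is the window starting at position 0, so both parts are instances of
     [graph_clt]. *)
  pose P n (j : 'I_k) := inside 0 (floorn (n%:R * u j)).
  pose K0 i j := itvK 0 (u i) 0 (u j).
  have h0 : (fun n => 0%:R / n%:R) @ \oo --> (0 : R).
    by under eq_fun do rewrite mul0r; exact: cvg_cst.
  have hK b d : (fun n => Kn (yv (n := n) (P n b)) (yv (n := n) (P n d))) @ \oo --> K0 b d.
    apply: (cvg_Kn_inside (l := fun=> 0%N) (l' := fun=> 0%N)) => //; try exact: cvg_floorn.
      by move=> n; rewrite floorn_nat_le.
    by move=> n; rewrite floorn_nat_le.
  have K0pos b : 0 < K0 b b.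
    by have /andP[? ?] := hu b; rewrite itvK_pos// subr0.
  have [L [hL hc]] := graph_clt Gsym Girr Hev hK K0pos.
  exists L; split; first exact: hL.
  rewrite (_ : row_mx _ _ = 0); last first.
    by apply/rowP => j; rewrite !mxE; case: splitP => ? _; rewrite !mxE.
  rewrite (_ : (fun n => _) = (fun n s => zrow (R := R) G P (n := n) s))//.
  apply: functional_extensionality_dep => n; apply/funext => s; rewrite /zrow.
  congr row_mx; apply/rowP => j; rewrite !mxE.
    by apply: eq_standardize; exact: Rdiff_dstat.
  by apply: eq_standardize; apply: Rw_wstat; exact: floorn_nat_le.
exists (fun _ _ => 0), (fun _ _ => 0).
exists (fun u v u' v' => itvK u v u' v' / (Num.sqrt (itvK u v u v) * Num.sqrt (itvK u' v' u' v'))).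
exists (fun u v u' v' => itvK u v u' v' ^+ 2 / (itvK u v u v * itvK u' v' u' v')).
move=> k u v huv.
have u0 j : 0 <= u j by have [/andP[/ltW]] := huv j.
have uv j : u j <= v j by have [/andP[_ /ltW]] := huv j.
have v0 j : 0 <= v j := le_trans (u0 j) (uv j).
have v1 j : v j <= 1 by have [_ /ltW] := huv j.
pose l n (j : 'I_k) := floorn (n%:R * u j).
pose r n (j : 'I_k) := floorn (n%:R * v j).
have lr j n : (l n j <= r n j <= n)%N.
  by rewrite floorn_nat_le// andbT floorn_le ?mulr_ge0// ler_wpM2l.
pose P n (j : 'I_k) : pred nat := fun i => ~~ inside (l n j) (r n j) i.
pose K0 i j := itvK (u i) (v i) (u j) (v j).
have hK b d : (fun n => Kn (yv (n := n) (P n b)) (yv (n := n) (P n d))) @ \oo --> K0 b d.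
  apply: cvg_trans (cvg_Kn_inside (lr b) (lr d) (cvg_floorn (u0 b)) (cvg_floorn (v0 b))
    (cvg_floorn (u0 d)) (cvg_floorn (v0 d))).
  (* The complement identity needs n > 0, hence the passage through large n. *)
  apply: near_eq_cvg; near=> n; apply/esym/Kn_yvC.
  by near: n; exact: nbhs_infty_gt.
have K0pos b : 0 < K0 b b.
  have [/andP[? ?] ?] := huv b; apply: itvK_pos => //.
  by rewrite ltrBlDr ltr_wpDr.
have [L [hL hc]] := graph_clt Gsym Girr Hev hK K0pos.
exists L; split; first exact: hL.
rewrite (_ : row_mx _ _ = 0); last first.
  by apply/rowP => j; rewrite !mxE; case: splitP => ? _; rewrite !mxE.
rewrite (_ : (fun n => _) = (fun n s => zrow (R := R) G P (n := n) s))//.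
apply: functional_extensionality_dep => n; apply/funext => s; rewrite /zrow.
congr row_mx; apply/rowP => j; rewrite !mxE.
  by apply: eq_standardize; exact: Rdiffi_dstat.
by apply: eq_standardize; apply: Rwi_wstat; exact: lr.
Unshelve. all: by end_near. Qed.
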